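(* Let $(\mathcal G,\mathcal S)$ be a twisted Boolean inverse semigroup and $(G,\Sigma)$ its twisted groupoid of germs. Then the full C*-algebra $C^*(G,\Sigma)$ is universal with respect to the representations of $(\mathcal G,\mathcal S)$: the map $s\mapsto\Delta_{S(s)}$ is a representation of $(\mathcal G,\mathcal S)$ in $C^*(G,\Sigma)$, and for every representation $\pi$ of $(\mathcal G,\mathcal S)$ in a Hilbert space $K$ there is a unique $*$-representation $\tilde\pi$ of $C^*(G,\Sigma)$ in $K$ such that $\tilde\pi(\Delta_{S(s)})=\pi(s)$ for all $s\in\mathcal S$.
   Context: $\mathbb T$ is the group of complex numbers of modulus one. Inverse semigroup: each $s$ has a unique $s^*$ with $ss^*s=s$, $s^*ss^*=s^*$; $\mathcal G^{(0)}$ is the set of idempotents, $d(s)=s^*s$, $r(s)=ss^*$, $s\le t$ iff $s=te$ for some idempotent $e$. A pair $(s,t)$ is orthogonal if $s^*t=st^*=0$. $\mathcal G$ (with zero) is Boolean if $\mathcal G^{(0)}$ is a Boolean algebra (possibly without unit) and every orthogonal pair has a join $s\vee t$. Let $X$ be the dual Boolean space (locally compact Hausdorff totally disconnected) of $\mathcal G^{(0)}$, so $\mathcal G^{(0)}=\mathcal B(X)$, the compact open subsets of $X$. $\mathcal T(X)$ is the inverse semigroup (under multiplication) of continuous functions $h:\mathrm{supp}(h)\to\mathbb T$ with $\mathrm{supp}(h)\subset X$ compact open. Twisted Boolean inverse semigroup $(\mathcal G,\mathcal S)$: an inverse semigroup extension $\mathcal T\rightarrowtail\mathcal S\xrightarrow{p}\mathcal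 G$ ($p$ a surjective homomorphism, identifying the idempotents of $\mathcal S$ with $\mathcal G^{(0)}$, with $p^{-1}(\mathcal G^{(0)})=\mathcal T$), where $\mathcal G$ is Boolean, $\mathcal T=\mathcal T(X)$, and $shs^*=h\circ\varphi_s^{-1}$ for $s\in\mathcal S,h\in\mathcal T$; here $\varphi_s:\mathrm{dom}(s)\to\mathrm{ran}(s)$ is the homeomorphism between the compact open subsets of $X$ given by $d(s),r(s)$, dual to $e\mapsto ses^*$. Twisted groupoid of germs: on pairs $(s,x)$, $s\in\mathcal S$, $x\in\mathrm{dom}(s)$, let $(s,x)\sim(t,y)$ iff $x=y$ and $sa=tb$ for some $a,b\in\mathcal T(X)$ with $a(x)=b(x)=1$; $(s,x)\approx(t,y)$ iff $x=y$ and $sa=tb$ for some $a,b\in\mathcal T(X)$ with $x\in\mathrm{supp}(a)\cap\mathrm{supp}(b)$. Classes $[s,x]$ form $\Sigma$, classes $[[s,x]]$ form $G$; both are groupoids with unit space $X$, with $[s,\varphi_t(x)][t,x]=[st,x]$, $[s,x]^{-1}=[s^*,\varphi_s(x)]$, and similarly for $[[\cdot]]$. Basic open sets of $G$: $\{[[s,x]]:x\in\mathrm{dom}(s)\cap U\}$, $U\subset X$ open; of $\Sigma$: $S(s)W$ with $S(s)=\{[s,x]:x\in\mathrm{dom}(s)\}$, $W\subset\mathbb T$ open, where $[s,x]\theta=[sc,x]$ for $c\in\mathcal T(X)$ with $c(x)=\theta$. Then $G=\Sigma/\mathbb T$ is étale. Convolution algebra: $\Delta_{S(s)}(\sigma)=\overline\theta$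 if $\sigma=\theta\tau$ with $\theta\in\mathbb T,\tau\in S(s)$, and $0$ if $\sigma\notin\mathbb TS(s)$. $C_c(G,\Sigma)$ is the $*$-algebra of finite sums of functions $\sigma\mapsto\Delta_{S(s)}(\sigma)b(d(\sigma))$, $s\in\mathcal S$, $b\in C_c(X)$, with $f*g(\sigma)=\sum_{\tau'\in r^{-1}(r(\sigma))}f(\tau)g(\tau^{-1}\sigma)$ ($\tau\in\Sigma$ any lift of $\tau'\in G$), $f^*(\sigma)=\overline{f(\sigma^{-1})}$. $C^*(G,\Sigma)$ is its completion for the full C*-norm, the supremum of $\|L(f)\|$ over all $*$-representations $L$ of $C_c(G,\Sigma)$ in Hilbert spaces. Representation of $(\mathcal G,\mathcal S)$ in a Hilbert space $K$ (or in a C*-algebra): a map $\pi$ from $\mathcal S$ to $B(K)$ with (i) $\pi(st)=\pi(s)\pi(t)$; (ii) $\pi(s^* )=\pi(s)^*$; (iii) $\pi(s\vee t)=\pi(s)+\pi(t)$ for every orthogonal pair; (iv) $\pi(0)=0$; (v) $\pi(h)=\tilde\pi^{(0)}(h)$ for $h\in\mathcal T(X)$, where $\tilde\pi^{(0)}$ is the extension to $C_0(X)$ of $\pi_{|\mathcal B(X)}$ and $h$ is extended by $0$. *)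

(* Defs.v *)
From HB Require Import structures.
From mathcomp Require Import all_boot all_order all_algebra.
From mathcomp Require Import all_classical all_reals all_analysis.
From mathcomp Require Import complex.

Set Implicit Arguments.
Unset Strict Implicit.
Unset Printing Implicit Defensive.

Import Order.TTheory GRing.Theory Num.Theory numFieldNormedType.Exports.
Local Open Scope quotient_scope.
Local Open Scope classical_set_scope.
Local Open Scope ring_scope.

(* The complex numbers. The alias gives [R[i]] its normed topology: that
   structure is only inferred on a variable or constant of type
   [numClosedFieldType]. *)
Definition Cplx (R : realType) : numClosedFieldType := R[i].

Definition realnorm (R : realType) (V : normedModType (Cplx R)) (v : V) : R :=
  complex.Re (`|v| : R[i]).

HB.mixin Record Semigroup_isInverse S of Semigroup S := {
  istar : S -> S;
  izero : S;
  mul_istarK : forall s : S, (s * istar s * s = s)%g;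
  istar_mulK : forall s : S, (istar s * s * istar s = istar s)%g;
  istar_uniq : forall s t : S, (s * t * s = s)%g -> (t * s * t = t)%g ->
    t = istar s;
  mul_izero : forall s : S, (izero * s = izero)%g;
  izero_mul : forall s : S, (s * izero = izero)%g
}.

#[short(type="invSemigroupType")]
HB.structure Definition InvSemigroup :=
  {S of Semigroup_isInverse S & Semigroup S}.

Section InverseSemigroup.
Variable S : invSemigroupType.
Implicit Types s t u e f g : S.
Local Open Scope group_scope.

Definition idem e := e * e = e.

Definition dproj s := istar s * s.
Definition rproj s := s * istar s.

Definition ile s t := exists2 e, idem e & s = t * e.

Definition orthogonal_pair s t :=
  istar s * t = izero /\ s * istar t = izero.

Definition is_join s t u :=
  [/\ ile s u, ile t u & forall v, ile s v -> ile t v -> ile u v].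

Definition is_idem_join e f g :=
  [/\ idem g, ile e g, ile f g &
      forall k, idem k -> ile e k -> ile f k -> ile g k].

(* The idempotents form a meet semilattice with bottom (the meet is the
   product); it is a Boolean algebra, possibly without unit, when it is a
   distributive lattice with relative complements. *)
Definition boolean_idempotents :=
  [/\ forall e f, idem e -> idem f -> exists g, is_idem_join e f g,
      forall e f g k, idem e -> idem f -> idem k -> is_idem_join e f g ->
        is_idem_join (k * e) (k * f) (k * g) &
      forall e f, idem e -> idem f -> ile e f ->
        exists k, [/\ idem k, e * k = izero & is_idem_join e k f]].

Definition boolean_inverse_semigroup :=
  boolean_idempotents /\
  forall s t, orthogonal_pair s t -> exists u, is_join s t u.

End InverseSemigroup.

HB.mixin Record Topological_isBooleanSpace X of Topological X := {
  boolean_hausdorff : hausdorff_space X;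
  boolean_locally_compact : locally_compact [set: X];
  boolean_totally_disconnected : totally_disconnected [set: X]
}.

#[short(type="booleanSpaceType")]
HB.structure Definition BooleanSpace :=
  {X of Topological_isBooleanSpace X & Topological X}.

Definition compact_open (X : topologicalType) (U : set X) :=
  compact U /\ open U.

Section StoneDuality.
Variables (X : booleanSpaceType) (G : invSemigroupType) (D : G -> set X).
Implicit Types (e f g : G) (x y : X).

(* [X] is the dual space of the Boolean algebra of idempotents of [G]: [D]
   restricts to an order isomorphism from the idempotents onto the compact
   open subsets of [X]. *)
Definition stone_duality :=
  [/\ forall e, idem e -> compact_open (D e),
      forall U, compact_open U -> exists2 e, idem e & D e = U &
      forall e f, idem e -> idem f -> (ile e f <-> D e `<=` D f)].

(* The homeomorphism from [D (dproj g)] onto [D (rproj g)] dual to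
   [e |-> g e g^*], as a total function; it is only used on [D (dproj g)]. *)
Definition dual_map g x : X :=
  xget x [set y | D (rproj g) y /\
    forall e, idem e -> D e x -> D (g * e * istar g)%g y].

End StoneDuality.

Definition supp (T : Type) (V : nmodType) (h : T -> V) : set T :=
  [set x | h x != 0].

Section TorusFunctions.
Variables (R : realType) (X : booleanSpaceType).
Local Notation C := (Cplx R).

(* A continuous function from a compact open set to the unit circle,
   extended by 0. *)
Record torus_fun := TorusFun {
  torus_fun_val :> X -> C;
  torus_fun_supp : compact_open (supp torus_fun_val);
  torus_fun_continuous : {within supp torus_fun_val, continuous torus_fun_val};
  torus_fun_norm : forall x, supp torus_fun_val x -> `|torus_fun_val x| = 1
}.

Lemma torus_fun_eq (h k : torus_fun) : h =1 k -> h = k.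
Proof.
case: h k => [h ? ? ?] [k ? ? ?] /= hk.
have {}hk : h = k by apply/funext.
by subst k; congr TorusFun; exact: Prop_irrelevance.
Qed.

Lemma compact_openI (U V : set X) :
  compact_open U -> compact_open V -> compact_open (U `&` V).
Proof.
move=> [cU oU] [cV oV]; split; last exact: openI.
by apply: compact_closedI => //; apply: compact_closed => //;
  exact: boolean_hausdorff.
Qed.

Section Product.
Variables h k : torus_fun.

Local Notation hk := (fun x : X => h x * k x : C).

Lemma torus_mul_suppE : supp hk = supp h `&` supp k.
Proof.
apply/seteqP; split => x; rewrite /supp /= mulf_eq0 negb_or.
  by move/andP.
by move=> [-> ->].
Qed.

Lemma torus_mul_supp : compact_open (supp hk).
Proof. by rewrite torus_mul_suppE; apply: compact_openI; exact: torus_fun_supp. Qed.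

Lemma torus_mul_continuous : {within supp hk, continuous hk}.
Proof.
rewrite torus_mul_suppE => x; apply: (@cvgM C).
- apply: (continuous_subspaceW (B := supp h)).
    exact: subIsetl.
  exact: torus_fun_continuous.
- apply: (continuous_subspaceW (B := supp k)).
    exact: subIsetr.
  exact: torus_fun_continuous.
Qed.

Lemma torus_mul_norm x : supp hk x -> `|hk x| = 1.
Proof.
by rewrite torus_mul_suppE => -[hx kx]; rewrite normrM !torus_fun_norm // mulr1.
Qed.

Definition torus_mul : torus_fun :=
  TorusFun torus_mul_supp torus_mul_continuous torus_mul_norm.

End Product.

Section Indicator.
Variables (U : set X) (coU : compact_open U).

Local Notation ind := (\1_U : X -> C).

Lemma torus_ind_suppE : supp ind = U.
Proof.
apply/seteqP; split => x; rewrite /supp /indic /=.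
  by case: (boolP (x \in U)) => [/set_mem//|_]; rewrite eqxx.
by move/mem_set => ->; rewrite oner_neq0.
Qed.

Lemma torus_ind_supp : compact_open (supp ind).
Proof. by rewrite torus_ind_suppE. Qed.

Lemma torus_ind_continuous : {within supp ind, continuous ind}.
Proof.
rewrite torus_ind_suppE.
apply: (@subspace_eq_continuous _ U C (cst 1)); last first.
  by apply: continuous_subspaceT => x; exact: cvg_cst.
by move=> x /set_mem xU; rewrite /from_subspace /indic mem_set.
Qed.

Lemma torus_ind_norm x : supp ind x -> `|ind x| = 1.
Proof. by rewrite torus_ind_suppE /indic => /mem_set ->; rewrite normr1. Qed.

Definition torus_ind : torus_fun :=
  TorusFun torus_ind_supp torus_ind_continuous torus_ind_norm.

End Indicator.

End TorusFunctions.

(* An extension T(X) >-> S ->> G; [tbis_dom] identifies the idempotents of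
   [G] with the compact open subsets of [X], and, through [tbis_domE], those
   of [S] with those of [G]. Since [p (s e s^* ) = p s e (p s)^*], the map
   [phi_s] dual to [e |-> s e s^*] is [dual_map] of [p s]. The last field is
   [s h s^* = h \o phi_s^-1], where the right-hand side has its support in
   the range of [s]. *)
Record twisted_boolean (R : realType) (X : booleanSpaceType)
    (G S : invSemigroupType) := TwistedBoolean {
  tbis_boolean : boolean_inverse_semigroup G;
  tbis_dom : G -> set X;
  tbis_stone : stone_duality tbis_dom;
  tbis_proj : S -> G;
  tbis_projM : {morph tbis_proj : s t / (s * t)%g};
  tbis_proj_surj : forall g, exists s, tbis_proj s = g;
  tbis_inj : torus_fun R X -> S;
  tbis_injM : {morph tbis_inj : h k / torus_mul h k >-> (h * k)%g};
  tbis_inj_inj : injective tbis_inj;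
  tbis_exact : forall s, idem (tbis_proj s) <-> exists h, tbis_inj h = s;
  tbis_domE : forall h, tbis_dom (tbis_proj (tbis_inj h)) = supp h;
  tbis_conj : forall s h, exists k : torus_fun R X,
    [/\ (s * tbis_inj h * istar s)%g = tbis_inj k,
        supp k `<=` tbis_dom (rproj (tbis_proj s)) &
        forall x, tbis_dom (dproj (tbis_proj s)) x ->
          k (dual_map tbis_dom (tbis_proj s) x) = h x]
}.

Section Germs.
Variables (R : realType) (X : booleanSpaceType) (G S : invSemigroupType).
Variable E : twisted_boolean R X G S.
Local Notation C := (Cplx R).
Local Notation j := (tbis_inj E).
Implicit Types (s t : S) (x y : X).

Definition sdom s : set X := tbis_dom E (dproj (tbis_proj E s)).
Definition sran s : set X := tbis_dom E (rproj (tbis_proj E s)).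
Definition phi s : X -> X := dual_map (tbis_dom E) (tbis_proj E s).

Definition germ_pair := {sx : S * X | `[< sdom sx.1 sx.2 >]}.
Implicit Types p q : germ_pair.

Definition germ_sim p q := `[< (val p).2 = (val q).2 /\
  exists a b : torus_fun R X,
    [/\ ((val p).1 * j a)%g = ((val q).1 * j b)%g,
        a (val p).2 = 1 & b (val p).2 = 1] >].

Definition germ_approx p q := `[< (val p).2 = (val q).2 /\
  exists a b : torus_fun R X,
    [/\ ((val p).1 * j a)%g = ((val q).1 * j b)%g,
        supp a (val p).2 & supp b (val p).2] >].

Lemma sdom_compact_open s : compact_open (sdom s).
Proof.
apply: (let: And3 h _ _ := tbis_stone E in h).
by rewrite /idem /dproj mulgA istar_mulK.
Qed.

Lemma tbis_inj_comm a b : (j a * j b = j b * j a)%g.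
Proof.
rewrite -!tbis_injM; congr (tbis_inj E _).
by apply: torus_fun_eq => x /=; rewrite mulrC.
Qed.

Lemma germ_comp_eq s t u a b c e : (s * j a = t * j b)%g -> (t * j c = u * j e)%g ->
  (s * j (torus_mul a c) = u * j (torus_mul e b))%g.
Proof.
by move=> st tu; rewrite !tbis_injM !mulgA st -tu -!mulgA (tbis_inj_comm b c).
Qed.

Lemma germ_pair_ind p : exists a : torus_fun R X, a (val p).2 = 1.
Proof.
exists (torus_ind R (sdom_compact_open (val p).1)).
by have /asboolP/mem_set := valP p; rewrite /= /indic => ->.
Qed.

Lemma germ_sim_refl : reflexive germ_sim.
Proof.
move=> p; apply/asboolP; split=> //; have [a a1] := germ_pair_ind p.
by exists a, a.
Qed.

Lemma germ_sim_sym : symmetric germ_sim.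
Proof.
move=> p q; apply/asboolP/asboolP => -[xy [a [b [st a1 b1]]]];
  by split=> //; exists b, a; rewrite -?xy // xy.
Qed.

Lemma germ_sim_trans : transitive germ_sim.
Proof.
move=> q p r /asboolP[xy [a [b [st a1 b1]]]] /asboolP[yz [c [e [tu c1 e1]]]].
apply/asboolP; split; first by rewrite xy.
exists (torus_mul a c), (torus_mul e b); rewrite -xy in c1 e1.
by split; [exact: germ_comp_eq st tu|rewrite /= a1 c1 mulr1|
  rewrite /= e1 b1 mulr1].
Qed.

Lemma germ_approx_refl : reflexive germ_approx.
Proof.
move=> p; apply/asboolP; split=> //; have [a a1] := germ_pair_ind p.
by exists a, a; rewrite /supp /= a1 oner_neq0.
Qed.

Lemma germ_approx_sym : symmetric germ_approx.
Proof.
move=> p q; apply/asboolP/asboolP => -[xy [a [b [st a1 b1]]]];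
  by split=> //; exists b, a; rewrite -?xy // xy.
Qed.

Lemma germ_approx_trans : transitive germ_approx.
Proof.
move=> q p r /asboolP[xy [a [b [st a1 b1]]]] /asboolP[yz [c [e [tu c1 e1]]]].
apply/asboolP; split; first by rewrite xy.
exists (torus_mul a c), (torus_mul e b); rewrite -xy in c1 e1.
by split; [exact: germ_comp_eq st tu|exact: mulf_neq0|exact: mulf_neq0].
Qed.

Canonical germ_sim_equiv :=
  EquivRel germ_sim germ_sim_refl germ_sim_sym germ_sim_trans.
Canonical germ_approx_equiv :=
  EquivRel germ_approx germ_approx_refl germ_approx_sym germ_approx_trans.

Definition twist := {eq_quot germ_sim}.
HB.instance Definition _ := EqQuotient.on twist.
HB.instance Definition _ := Choice.on twist.

Definition germ_groupoid := {eq_quot germ_approx}.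
HB.instance Definition _ := EqQuotient.on germ_groupoid.
HB.instance Definition _ := Choice.on germ_groupoid.

Implicit Types (sigma tau rho : twist) (gamma : germ_groupoid).

(* [is_germ s x sigma] reads [sigma = [s, x]], including [x \in dom s]. *)
Definition is_germ s x sigma := exists px : `[< sdom s x >],
  sigma = \pi_twist (exist _ (s, x) px : germ_pair).

Definition src sigma : X := (val (repr sigma)).2.
Definition tgt sigma : X := phi (val (repr sigma)).1 (val (repr sigma)).2.
Definition groupoid_tgt gamma : X :=
  phi (val (repr gamma)).1 (val (repr gamma)).2.

Definition lift gamma : twist := \pi_twist (repr gamma).

(* In the following definitions the first argument of [xget] is a junk value;
   it is returned by [twist_mul] on pairs that are not composable and by
   [circle_act] for a scalar of modulus different from 1. *)
Definition twist_mul sigma tau : twist := xget sigma [set rho |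
  exists s t x, [/\ is_germ s (phi t x) sigma, is_germ t x tau &
                    is_germ (s * t)%g x rho]].

Definition twist_inv sigma : twist := xget sigma [set rho |
  exists s x, is_germ s x sigma /\ is_germ (istar s) (phi s x) rho].

Definition circle_act (theta : C) sigma : twist := xget sigma [set rho |
  exists s x (c : torus_fun R X), [/\ is_germ s x sigma, c x = theta,
    supp c x & is_germ (s * j c)%g x rho]].

Definition bisection s : set twist := [set sigma | exists x, is_germ s x sigma].

Definition Delta s : twist -> C := fun sigma => xget 0 [set z |
  exists theta tau, [/\ `|theta| = 1, bisection s tau,
    sigma = circle_act theta tau & z = theta^*]].

Definition CcX : set (X -> C) := [set b | continuous b /\
  exists2 K, compact K & forall x, ~ K x -> b x = 0].

Definition CcGS : set (twist -> C) := [set f |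
  exists n (s : 'I_n -> S) (b : 'I_n -> X -> C), (forall i, CcX (b i)) /\
    f = (fun sigma => \sum_(i < n) Delta (s i) sigma * b i (src sigma))].

(* The sum is finitely supported when [f] belongs to [CcGS]. *)
Definition convolution (f g : twist -> C) : twist -> C := fun sigma =>
  \sum_(gamma \in [set gamma | groupoid_tgt gamma = tgt sigma])
    f (lift gamma) * g (twist_mul (twist_inv (lift gamma)) sigma).

Definition twist_star (f : twist -> C) : twist -> C := fun sigma =>
  (f (twist_inv sigma))^*.

End Germs.

Arguments Delta {R X G S} E s.
Arguments twist_star {R X G S} E f.
Arguments convolution {R X G S} E f g.
Arguments CcGS {R X G S} E.

(* A subset of a vector space with a multiplication and the graph of an
   involution ([sa_adj f g] reads [g = f^*]). *)
Record star_alg (R : realType) := StarAlg {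
  sa_mod :> lmodType (Cplx R);
  sa_set : set sa_mod;
  sa_mul : sa_mod -> sa_mod -> sa_mod;
  sa_adj : sa_mod -> sa_mod -> Prop
}.

Record star_hom (R : realType) (A B : star_alg R) (rho : A -> B) : Prop :=
  StarHom {
  star_hom_in : forall f, sa_set f -> sa_set (rho f);
  star_homD : forall f g, sa_set f -> sa_set g -> rho (f + g) = rho f + rho g;
  star_homZ : forall (c : Cplx R) f, sa_set f -> rho (c *: f) = c *: rho f;
  star_homM : forall f g, sa_set f -> sa_set g ->
    rho (sa_mul f g) = sa_mul (rho f) (rho g);
  star_hom_star : forall f g, sa_set f -> sa_set g -> sa_adj f g ->
    sa_adj (rho f) (rho g)
}.

Record hilbert (R : realType) := Hilbert {
  hilbert_mod :> completeNormedModType (Cplx R);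
  hdot : {dot hilbert_mod for (@Num.conj (Cplx R))};
  hdotE : forall x : hilbert_mod, hdot x x = `|x| ^+ 2
}.

Definition bounded_operators (R : realType) (K : hilbert R) : star_alg R :=
  @StarAlg R (K -> K) [set T | linear T /\ continuous T]
    (fun T U => T \o U) (fun T U => forall x y, hdot K (T x) y = hdot K x (U y)).

Definition opnorm (R : realType) (K : hilbert R) (T : K -> K) : R :=
  sup [set r | exists2 x : K, realnorm x <= 1 & r = realnorm (T x)].

Record cstar_alg (R : realType) := CStarAlg {
  cs_mod :> completeNormedModType (Cplx R);
  cs_mul : {bilinear cs_mod -> cs_mod -> cs_mod};
  cs_star : cs_mod -> cs_mod;
  cs_mulA : associative cs_mul;
  cs_starK : involutive cs_star;
  cs_starD : {morph cs_star : a b / a + b};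
  cs_starZ : forall (c : Cplx R) a, cs_star (c *: a) = c^* *: cs_star a;
  cs_starM : forall a b, cs_star (cs_mul a b) = cs_mul (cs_star b) (cs_star a);
  cs_normM : forall a b, `|cs_mul a b| <= `|a| * `|b|;
  cs_normE : forall a, `|cs_mul (cs_star a) a| = `|a| ^+ 2
}.

Definition star_alg_of_cstar (R : realType) (A : cstar_alg R) : star_alg R :=
  @StarAlg R A setT (cs_mul A) (fun a b => b = cs_star a).
Coercion star_alg_of_cstar : cstar_alg >-> star_alg.

Definition C0X (R : realType) (X : topologicalType) : star_alg R :=
  @StarAlg R (X -> Cplx R)
    [set f | continuous f /\
      forall eps : Cplx R, 0 < eps -> compact [set x | eps <= `|f x|]]
    (fun f g => fun x => f x * g x) (fun f g => forall x, g x = (f x)^*).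

Section UniversalAlgebra.
Variables (R : realType) (X : booleanSpaceType) (G S : invSemigroupType).
Variable E : twisted_boolean R X G S.

Definition convolution_alg : star_alg R :=
  @StarAlg R (twist E -> Cplx R) (CcGS E) (convolution E)
    (fun f g => g = twist_star E f).

Definition full_norm (f : twist E -> Cplx R) : \bar R :=
  ereal_sup [set r | exists (K : hilbert R) (L : _ -> bounded_operators K),
    @star_hom R convolution_alg (bounded_operators K) L /\
    r = (opnorm (L f))%:E].

(* [A] together with [full_inj] (which is only meaningful on [CcGS]) is the
   completion of the convolution algebra for the full norm; this determines it
   up to a unique isomorphism. Hausdorffness of the completion is that of [A],
   and [full_injE] contains the finiteness of the full norm. *)
Record full_cstar := FullCStar {
  full_alg :> cstar_alg R;
  full_inj : convolution_alg -> full_alg;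
  full_inj_hom : star_hom (full_inj : convolution_alg -> (full_alg : star_alg R));
  full_injE : forall f, sa_set f -> (realnorm (full_inj f))%:E = full_norm f;
  full_inj_dense : closure (full_inj @` sa_set (s := convolution_alg)) = setT
}.

(* [pi0] in the last field is the extension to [C0X] of the restriction of
   [pi] to the compact open sets; such an extension is unique, the linear span
   of the indicators of compact open sets being dense in [C0X]. *)
Record is_representation (B : star_alg R) (pi : S -> B) : Prop :=
  IsRepresentation {
  rep_in : forall s, sa_set (pi s);
  repM : forall s t, pi (s * t)%g = sa_mul (pi s) (pi t);
  rep_star : forall s, sa_adj (pi s) (pi (istar s));
  rep_join : forall s t u, orthogonal_pair s t -> is_join s t u ->
    pi u = pi s + pi t;
  rep0 : pi izero = 0;
  rep_torus : exists pi0 : C0X R X -> B, [/\ star_hom pi0,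
    forall U (coU : compact_open U),
      pi0 (\1_U : X -> Cplx R) = pi (tbis_inj E (torus_ind R coU)) &
    forall h, pi (tbis_inj E h) = pi0 (h : X -> Cplx R)]
}.

End UniversalAlgebra.

(* Main.v *)
(* A continuous function with values in [-1, 1] and compact support is the
   average of a torus function and its conjugate, so that every element of
   C_c(X) is a combination of four torus functions and C_c(G, Sigma) is the
   linear span of the functions Delta s. Since Delta s * Delta t = Delta (s t)
   and (Delta s)^* = Delta (s^* ), a representation pi should integrate to
   sum c_i Delta s_i |-> sum c_i pi s_i, and the point is that this is well
   defined. If sum c_i Delta s_i = 0 then, near each x, grouping the indices
   according to the germ of s_i at x rewrites the operator as
   sum pi(s_k) pi0(b_k) with b_k continuous and b_k(x) = 0; gluing over a finite
   partition into compact open sets on which the b_k are at most eps bounds the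
   norm of the operator by a multiple of eps. The integrated homomorphism is
   bounded by the full norm by definition and extends by density.
   Uniqueness holds because every *-homomorphism rho from a C*-algebra to B(K)
   is contractive: if the norm of a is less than 1, then a^* a = 2 k - k^2 for
   some self-adjoint k, whence
   |rho(a) v|^2 = |v|^2 - |v - rho(k) v|^2 <= |v|^2. *)

Require Import Defs.
From HB Require Import structures.
From mathcomp Require Import all_boot all_order all_algebra.
From mathcomp Require Import all_classical all_reals all_analysis.
From mathcomp Require Import complex lra ring.

Set Implicit Arguments.
Unset Strict Implicit.
Unset Printing Implicit Defensive.

Import Order.TTheory GRing.Theory Num.Theory numFieldNormedType.Exports.
Local Open Scope classical_set_scope.
Local Open Scope ring_scope.

(* [compact_open] is shadowed by the compact-open topology of MathComp-Analysis. *)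
Local Notation compact_open := Defs.compact_open.

(** * Compact open sets of a Boolean space *)

(** The groupoid of germs need not be Hausdorff: elements with different germs at [x] may have equal
    germs at points arbitrarily near [x]. A relation between the functions [Delta s], read at the
    arrows over [x], therefore makes the grouped coefficients vanish at [x] only and not on a
    neighbourhood, so that well-definedness is an estimate rather than an algebraic cancellation.
    The estimate comes from the representation itself: each [pi s] is a partial isometry, hence a
    contraction, and the four torus functions bound the operator of a function of modulus at most
    [M] by [2 * M]. That [Delta] is itself a representation has its own difficulty, the last
    condition: the extension to C_0(X) has to be produced inside the completion. Functions in C_c(X)
    are placed on the unit space of the twist, the same factor 2 bounds this map for the sup norm,
    and it then extends to uniform limits. *)

Section CompactOpen.
Variable X : booleanSpaceType.
Implicit Types (x y : X) (K F U V : set X).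

Lemma hausX : hausdorff_space X. Proof. exact: boolean_hausdorff. Qed.

Lemma compact_openU U V : compact_open U -> compact_open V -> compact_open (U `|` V).
Proof. by move=> [? ?] [? ?]; split; [exact: compactU|exact: openU]. Qed.

Lemma compact_open0 : compact_open (set0 : set X).
Proof. by split; [exact: compact0|exact: open0]. Qed.

Lemma compact_openD U V : compact_open U -> compact_open V -> compact_open (U `\` V).
Proof.
move=> [cU oU] [cV oV]; split.
  apply: (subclosed_compact _ cU) => [|z []//].
  rewrite setDE; apply: closedI; first exact: compact_closed hausX cU.
  exact: open_closedC.
by rewrite setDE; apply: openI => //; apply: closed_openC; exact: compact_closed hausX cV.
Qed.

(* [split_nbhs K x] is the family of the relatively clopen subsets of the
   compact set [K] that contain [x]. *)
Definition split_nbhs K x : set (set X) :=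
  [set F | [/\ F `<=` K, F x, compact F & compact (K `\` F)]].

Lemma split_nbhsI K x F F' :
  split_nbhs K x F -> split_nbhs K x F' -> split_nbhs K x (F `&` F').
Proof.
move=> [FK Fx cF cKF] [FK' Fx' cF' cKF']; split => //.
- by move=> z [/FK].
- by apply: compact_closedI => //; exact: compact_closed hausX cF'.
- by rewrite setDIr; exact: compactU.
Qed.

(** [Phi] is the filter of properties shared by all small enough members of the family. A member
    avoiding [y] is closed, so all smaller ones avoid a neighbourhood of [y]; near-covering
    compactness of [D] then gives one member for the whole of [D]. *)
Lemma split_nbhs_avoid K x (D : set X) : split_nbhs K x K -> compact D ->
  (forall y, D y -> exists2 F, split_nbhs K x F & ~ F y) ->
  exists2 F, split_nbhs K x F & F `&` D = set0.
Proof.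
move=> KK cD DF.
pose Phi : set_system (set X) := [set P | exists2 F0, split_nbhs K x F0 &
  forall F, split_nbhs K x F -> F `<=` F0 -> P F].
have PhiF : Filter Phi.
  split; first by exists K.
  - move=> P Q [F0 F0K P0] [F1 F1K Q1]; exists (F0 `&` F1); first exact: split_nbhsI.
    by move=> F FK F01; split; [apply: P0 => // z /F01[]|apply: Q1 => // z /F01[]].
  - by move=> P Q PQ [F0 F0K P0]; exists F0 => // F FK F0'; apply: PQ; exact: P0.
have /compact_near_coveringP/(_ _ Phi (fun F y => ~ F y) PhiF) := cD.
case=> [y /DF[F0 F0K nF0y]|F0 F0K /(_ F0 F0K (fun _ => id)) DF0]; last first.
  by exists F0 => //; apply/seteqP; split => // z [F0z /DF0].
exists (~` F0, [set F | F `<=` F0]) => /=.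
  split; last by exists F0.
  apply: open_nbhs_nbhs; split => //; apply: closed_openC.
  by case: F0K => _ _ cF0 _; exact: compact_closed hausX cF0.
by move=> [z F] /= [nz FF0] /FF0.
Qed.

(** The usual two-step separation, with filters [Psi] of properties of all small open
    neighbourhoods, first of a point of [B], then of [A]. If every point of a set has a
    neighbourhood missing [V], that set lies in the open complement of the closure of [V]. *)
Lemma compact_disjoint_nbhs (A B : set X) : compact A -> compact B ->
  A `&` B = set0 ->
  exists U V, [/\ open U, open V, A `<=` U, B `<=` V & U `&` V = set0].
Proof.
move=> cA cB AB.
have pt y : B y -> exists U V, [/\ open U, open V, A `<=` U, V y & U `&` V = set0].
  move=> By.
  pose Psi : set_system (set X) := [set P | exists V0, [/\ open V0, V0 y &
    forall V, open V -> V y -> V `<=` V0 -> P V]].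
  have PsiF : Filter Psi.
    split; first by exists setT; split => //; exact: openT.
    - move=> P Q [V0 [oV0 V0y P0]] [V1 [oV1 V1y Q1]].
      exists (V0 `&` V1); split => //; first exact: openI.
      by move=> V oV Vy V01; split; [apply: P0|apply: Q1] => // z /V01[].
    - move=> P Q PQ [V0 [oV0 V0y P0]]; exists V0; split => // V *.
      by apply: PQ; exact: P0.
  have /compact_near_coveringP/(_ _ Psi _ PsiF) := cA.
  move=> /(_ (fun V a => exists2 U, nbhs a U & U `&` V = set0)).
  case=> [a Aa|V [oV Vy VA]].
    have ay : a != y.
      apply/eqP => e; rewrite -e in By; have : (A `&` B) a by [].
      by rewrite AB.
    have := hausX; rewrite open_hausdorff => /(_ _ _ ay)[[U V]/=].
    move=> [/set_mem Ua /set_mem Vy] [oU oV /eqP UV].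
    exists (U, [set V' | V' `<=` V]) => /=.
      split; first exact: open_nbhs_nbhs.
      by exists V; split.
    move=> [b V'] /= [Ub V'V]; exists U; first exact: open_nbhs_nbhs.
    by apply/seteqP; split => // z [Uz /V'V Vz]; rewrite -UV.
  have {}VA := VA V oV Vy (fun _ => id).
  exists (~` closure V), V; split => //.
  - by apply: closed_openC; exact: closed_closure.
  - move=> a /VA[U Ua UV] cVa; have /cVa := Ua => -[z [Vz Uz]].
    by have : (U `&` V) z by []; rewrite UV.
  - by apply/seteqP; split => // z [ncV /subset_closure].
pose Psi : set_system (set X) := [set P | exists U0, [/\ open U0, A `<=` U0 &
    forall U, open U -> A `<=` U -> U `<=` U0 -> P U]].
have PsiF : Filter Psi.
  split; first by exists setT; split => //; exact: openT.
  - move=> P Q [V0 [oV0 V0y P0]] [V1 [oV1 V1y Q1]].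
    exists (V0 `&` V1); split => //; [exact: openI|by move=> z Az; split; auto|].
    by move=> V oV Vy V01; split; [apply: P0|apply: Q1] => // z /V01[].
  - move=> P Q PQ [V0 [oV0 V0y P0]]; exists V0; split => // V *.
    by apply: PQ; exact: P0.
have /compact_near_coveringP/(_ _ Psi _ PsiF) := cB.
move=> /(_ (fun V a => exists2 U, nbhs a U & U `&` V = set0)).
case=> [b /pt[U [V [oU oV AU Vb UV]]]|V [oV AV VB]].
  exists (V, [set V' | V' `<=` U]) => /=.
    split; first exact: open_nbhs_nbhs.
    by exists U; split.
  move=> [c V'] /= [Vc V'U]; exists V; first exact: open_nbhs_nbhs.
  by apply/seteqP; split => // z [Uz /V'U Vz]; rewrite -UV.
have {}VB := VB V oV AV (fun _ => id).
exists V, (~` closure V); split => //.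
- by apply: closed_openC; exact: closed_closure.
- move=> a /VB[U Ua UV] cVa; have /cVa := Ua => -[z [Vz Uz]].
  by have : (U `&` V) z by []; rewrite UV.
- by apply/seteqP; split => // z [/subset_closure + ncV].
Qed.

(* In a compact set, quasi-components are connected, hence here trivial. *)
Lemma split_nbhs_point K x y : compact K -> K x -> x <> y ->
  exists2 F, split_nbhs K x F & ~ F y.
Proof.
move=> cK Kx xy; have KK : split_nbhs K x K.
  by split => //; rewrite setDv; exact: compact0.
apply: contrapT => noF.
pose Q := \bigcap_(F in split_nbhs K x) F.
have Qy : Q y by move=> F FK; apply: contrapT => nFy; apply: noF; exists F.
have Qx : Q x by move=> F [].
have cQ : compact Q.
  apply: (subclosed_compact _ cK) => [|z]; last by apply.
  by apply: closed_bigI => F [_ _ cF _]; exact: compact_closed hausX cF.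
suff cnQ : connected Q.
  have : connected_component setT x y by exists Q.
  by rewrite boolean_totally_disconnected // => /= yx; exact: xy.
(* A relatively clopen part [A] of [Q] containing [x] is all of [Q]: some
   [F] in the family lies in [U `|` V] for separating [U] and [V], and then
   [F `&` U] is in the family. *)
have main (A B : set X) : compact A -> compact B -> A `|` B = Q ->
    A `&` B = set0 -> A x -> B = set0.
  move=> cA cB ABQ AB Ax.
  have [U [V [oU oV AU BV UV]]] := compact_disjoint_nbhs cA cB AB.
  have [F FK Fd] : exists2 F, split_nbhs K x F & F `&` (K `\` (U `|` V)) = set0.
    apply: split_nbhs_avoid => //.
      apply: (subclosed_compact _ cK) => [|z []//]; rewrite setDE; apply: closedI.
        exact: compact_closed hausX cK.
      by apply: open_closedC; exact: openU.
    move=> z [Kz nUV]; apply: contrapT => nF; apply: nUV.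
    have : Q z by move=> F FK; apply: contrapT => nFz; apply: nF; exists F.
    by rewrite -ABQ => -[/AU|/BV]; [left|right].
  have [FsK Fx cF cKF] := FK.
  have FUV z : F z -> U z \/ V z.
    move=> Fz; apply: contrapT => n; have : (F `&` (K `\` (U `|` V))) z.
      by do !split => //; exact: FsK.
    by rewrite Fd.
  have EU : F `&` U = F `\` V.
    apply/seteqP; split => z [Fz].
      by move=> Uz; split => // Vz; have : (U `&` V) z by []; rewrite UV.
    by move=> nVz; split => //; case: (FUV z Fz).
  have FUK : split_nbhs K x (F `&` U).
    split.
    - by move=> z [/FsK].
    - by split => //; exact: AU.
    - rewrite EU; apply: (subclosed_compact _ cF) => [|z []//]; rewrite setDE.
      by apply: closedI; [exact: compact_closed hausX cF|exact: open_closedC].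
    - rewrite setDIr; apply: compactU => //.
      apply: (subclosed_compact _ cK) => [|z []//]; rewrite setDE.
      by apply: closedI; [exact: compact_closed hausX cK|exact: open_closedC].
  apply/seteqP; split => // z Bz.
  have : Q z by rewrite -ABQ; right.
  move=> /(_ _ FUK)[_ Uz]; have : (U `&` V) z by split => //; exact: BV.
  by rewrite UV.
move=> A [a Aa] [W oO AO] [C cC AC].
have clQ : closed Q by exact: compact_closed hausX cQ.
have cA : compact A.
  by apply: (subclosed_compact _ cQ) => [|z]; rewrite AC; [exact: closedI|case].
have cB : compact (Q `\` A).
  apply: (subclosed_compact _ cQ) => [|z []//].
  rewrite AO setDIr setDv set0U setDE; apply: closedI => //; exact: open_closedC.
have AQ : A `<=` Q by rewrite AO => z [].
have [Ax|nAx] := pselect (A x).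
  have := main _ _ cA cB; rewrite setDUK // setDIK => /(_ erefl erefl Ax) e.
  apply/seteqP; split => // z Qz; apply: contrapT => nA.
  by have : (Q `\` A) z by []; rewrite e.
have := main _ _ cB cA; rewrite setUC setDUK // setIC setDIK => /(_ erefl erefl) e.
by move: Aa; rewrite e; by [].
Qed.

(** A relatively clopen part of a compact neighbourhood [B] need not be open in [X]; one contained
    in an open [W] inside [B] is open, being [W] minus a compact set. *)
Lemma compact_open_nbhs x U : nbhs x U ->
  exists V, [/\ compact_open V, V x & V `<=` U].
Proof.
move=> Ux; have [B] := @boolean_locally_compact X x I; rewrite withinET => Bx [cB clB].
have Kx : B x by exact: nbhs_singleton.
have KK : split_nbhs B x B by split => //; rewrite setDv; exact: compact0.
have : nbhs x (U `&` B) by exact: filterI.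
rewrite nbhsE => -[W [oO Ox] OUB].
have [F [FB Fx cF cKF] FO] : exists2 F, split_nbhs B x F & F `&` (B `\` W) = set0.
  apply: split_nbhs_avoid => //.
    apply: (subclosed_compact _ cB) => [|z []//]; rewrite setDE.
    by apply: closedI => //; exact: open_closedC.
  by move=> y [By nOy]; apply: split_nbhs_point => // xy; apply: nOy; rewrite -xy.
have FsO : F `<=` W.
  move=> z Fz; apply: contrapT => nO; have : (F `&` (B `\` W)) z.
    by do !split => //; exact: FB.
  by rewrite FO.
exists F; split => // [|z /FsO/OUB[]//]; split => //.
suff -> : F = W `\` (B `\` F).
  by rewrite setDE; apply: openI => //; apply: closed_openC; exact: compact_closed hausX cKF.
apply/seteqP; split => [z Fz|z [Oz nz]].
  by split; [exact: FsO|case].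
apply: contrapT => nF; apply: nz; split => //.
by have /OUB[] := Oz.
Qed.

Lemma compact_open_point x : exists2 V, compact_open V & V x.
Proof. by have [V []] := @compact_open_nbhs x setT filterT; exists V. Qed.

Lemma compact_open_sep x y : x <> y -> exists V, [/\ compact_open V, V x & ~ V y].
Proof.
move=> xy; have [|V [cV Vx VU]] := @compact_open_nbhs x (~` [set y]); last first.
  by exists V; split => // /VU; apply.
apply: open_nbhs_nbhs; split => //; apply: closed_openC.
by apply: compact_closed hausX _; exact: compact_set1.
Qed.

(** The filter is that of the properties of all large enough lists of admissible sets; with it,
    near-covering compactness returns a finite list whose members still satisfy [P]. *)
Lemma compact_open_cover K (P : set X -> Prop) : compact K ->
  (forall x, K x -> exists V, [/\ compact_open V, V x & P V]) ->
  exists s : seq (set X), (forall V, V \in s -> compact_open V /\ P V) /\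
    K `<=` \big[setU/set0]_(V <- s) V.
Proof.
move=> cK cov.
pose Phi : set_system (seq (set X)) := [set Q | exists s0 : seq (set X),
  (forall V, V \in s0 -> compact_open V /\ P V) /\
  forall s : seq (set X), (forall V, V \in s -> compact_open V /\ P V) ->
    {subset s0 <= s} -> Q s].
have PhiF : Filter Phi.
  split; first by exists [::]; split.
  - move=> Q Q' [s [sP sQ]] [s' [sP' sQ']]; exists (s ++ s'); split.
      by move=> V; rewrite mem_cat => /orP[/sP|/sP'].
    by move=> r rP ss; split; [apply: sQ|apply: sQ'] => // V Vs; apply: ss;
      rewrite mem_cat Vs ?orbT.
  - by move=> Q Q' QQ [s [sP sQ]]; exists s; split => // r rP sr; apply: QQ; exact: sQ.
have /compact_near_coveringP/(_ _ Phi (fun s x => exists2 V, V \in s & V x) PhiF) := cK.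
case=> [x /cov[V [[cV oV] Vx PV]]|s [sP /(_ s sP (fun _ => id)) sK]].
  exists (V, [set s : seq (set X) | V \in s]) => /=.
    split; first exact: open_nbhs_nbhs.
    by exists [:: V]; split => [W|r rP /(_ V)]; rewrite inE ?eqxx; [move/eqP->|apply].
  by move=> [y s] /= [Vy Vs]; exists V.
by exists s; split => // x /sK[V Vs Vx]; rewrite -bigcup_seq; exists V.
Qed.

(** A finite cover is made disjoint by set differences, so [P] has to pass only to smaller sets and
    to disjoint unions. This is all that a property with a uniform bound, such as [small_on],
    permits. *)
Lemma compact_open_ind (P : set X -> Prop) : P set0 ->
  (forall U V, compact_open U -> compact_open V -> V `<=` U -> P U -> P V) ->
  (forall U V, compact_open U -> compact_open V -> U `&` V = set0 ->
    P U -> P V -> P (U `|` V)) ->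
  (forall x, exists V, [/\ compact_open V, V x & P V]) ->
  forall K, compact_open K -> P K.
Proof.
move=> P0 PS PU Px K coK.
have [s [sP Ks]] := @compact_open_cover K P coK.1 (fun x _ => Px x).
suff [coU PsU] : compact_open (\big[setU/set0]_(V <- s) V) /\
    P (\big[setU/set0]_(V <- s) V) by exact: PS Ks PsU.
elim: s sP {Ks} => [|V s IH] sP.
  by rewrite big_nil; split => //; exact: compact_open0.
have [coV PV] := sP V (mem_head _ _).
have [W Ws|coU PsU] := IH; first by apply: sP; rewrite inE Ws orbT.
rewrite big_cons /=; set U := \big[setU/set0]_(_ <- _) _ in coU PsU *.
split; first exact: compact_openU.
have -> : V `|` U = V `|` (U `\` V).
  apply/seteqP; split => z [Vz|]; [by left| |by left|by case=> Uz _; right].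
  by have [|nV Uz] := pselect (V z); [left|right].
have coUV : compact_open (U `\` V) by exact: compact_openD.
apply: PU => //; first by rewrite setDIK.
by apply: (PS U) => // z [].
Qed.

Lemma compact_sub_compact_open K : compact K ->
  exists2 U, compact_open U & K `<=` U.
Proof.
move=> cK; have [//|x _|s [sP Ks]] := @compact_open_cover K (fun=> True).
  by have [V coV Vx] := compact_open_point x; exists V.
exists (\big[setU/set0]_(V <- s) V) => //.
rewrite big_seq; elim/big_ind: _ => [|U V|V /sP[]//]; first exact: compact_open0.
exact: compact_openU.
Qed.

End CompactOpen.

(** * Norms of complex normed modules as real numbers *)

Section RealNorm.
Variable R : realType.
Local Notation C := (Cplx R).

(** Norms take values in [Cplx R], whose order is only partial; estimates are carried out in [R],
    where [lra] and [nra] apply. *)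
Definition ofR (r : R) : C := (r%:C)%C.
Definition cabs (z : C) : R := complex.Re (`|z| : R[i]).

Lemma ofR_inj : injective ofR. Proof. exact: complexI. Qed.
Lemma ofR_le r s : (ofR r <= ofR s) = (r <= s). Proof. exact: lecR. Qed.
Lemma ofR_lt r s : (ofR r < ofR s) = (r < s). Proof. exact: ltcR. Qed.
Lemma ofRD r s : ofR (r + s) = ofR r + ofR s. Proof. exact: (rmorphD (real_complex R)). Qed.
Lemma ofRM r s : ofR (r * s) = ofR r * ofR s. Proof. exact: (rmorphM (real_complex R)). Qed.
Lemma ofR0 : ofR 0 = 0. Proof. by []. Qed.
Lemma ofR1 : ofR 1 = 1. Proof. by []. Qed.

Lemma ge0_ofR (z : C) : 0 <= z -> z = ofR (complex.Re (z : R[i])).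
Proof. by move=> z0; rewrite /ofR RRe_real // ger0_real. Qed.

Lemma gt0_ofR (z : C) : 0 < z -> exists2 e : R, 0 < e & z = ofR e.
Proof.
move=> z0; exists (complex.Re (z : R[i])); last exact/ge0_ofR/ltW.
by rewrite -ofR_lt -(ge0_ofR (ltW z0)).
Qed.

Lemma ofR_conj r : (ofR r)^* = ofR r.
Proof. by apply: conj_Creal; apply/complex_realP; exists r. Qed.

Lemma normE (z : C) : `|z| = ofR (cabs z).
Proof. exact/ge0_ofR/normr_ge0. Qed.

Lemma cabs_ofR r : cabs (ofR r) = `|r|.
Proof. by rewrite /cabs normc_def /= expr0n addr0 sqrtr_sqr. Qed.

Lemma cabs_ge0 z : 0 <= cabs z.
Proof. by rewrite -ofR_le -normE; exact: normr_ge0. Qed.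

Lemma cabsD z w : cabs (z + w) <= cabs z + cabs w.
Proof. by rewrite -ofR_le ofRD -!normE ler_normD. Qed.

Lemma cabsM z w : cabs (z * w) = cabs z * cabs w.
Proof. by apply: ofR_inj; rewrite ofRM -!normE normrM. Qed.

Lemma cabsN z : cabs (- z) = cabs z.
Proof. by rewrite /cabs normrN. Qed.

Lemma cabsJ z : cabs z^* = cabs z.
Proof. by rewrite /cabs norm_conjC. Qed.

Lemma cabs0 : cabs 0 = 0. Proof. by rewrite /cabs normr0. Qed.
Lemma cabs1 : cabs 1 = 1. Proof. by rewrite /cabs normr1. Qed.

Lemma cabs_eq0 z : cabs z = 0 -> z = 0.
Proof. by move=> z0; apply: normr0_eq0; rewrite normE z0. Qed.

Section Module.
Variable V : normedModType C.
Implicit Types v w : V.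

Lemma normvE v : `|v| = ofR (realnorm v).
Proof. exact/ge0_ofR/normr_ge0. Qed.

Lemma rn_ge0 v : 0 <= realnorm v. Proof. by rewrite -ofR_le -normvE; exact: normr_ge0. Qed.

Lemma rnD v w : realnorm (v + w) <= realnorm v + realnorm w.
Proof. by rewrite -ofR_le ofRD -!normvE ler_normD. Qed.

Lemma rnN v : realnorm (- v) = realnorm v.
Proof. by rewrite /realnorm normrN. Qed.

Lemma rnB v w : realnorm (v - w) = realnorm (w - v).
Proof. by rewrite -rnN opprB. Qed.

Lemma rn_dist u v w : realnorm (v - w) <= realnorm (v - u) + realnorm (u - w).
Proof. by apply: le_trans (rnD _ _); rewrite addrA subrK. Qed.

Lemma rnZ c v : realnorm (c *: v) = cabs c * realnorm v.
Proof. by apply: ofR_inj; rewrite ofRM -normE -!normvE normrZ. Qed.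

Lemma rn0 : realnorm (0 : V) = 0. Proof. by rewrite /realnorm normr0. Qed.

Lemma rn_eq0 v : realnorm v = 0 -> v = 0.
Proof. by move=> v0; apply: normr0_eq0; rewrite normvE v0. Qed.

Lemma rn_small v : (forall e : R, 0 < e -> realnorm v <= e) -> v = 0.
Proof.
move=> ve; apply: rn_eq0; apply/eqP; rewrite eq_le rn_ge0 andbT.
by apply/ler_addgt0Pl => e e0; rewrite addr0 ve.
Qed.

Lemma rn_sum n (F : 'I_n -> V) (b : 'I_n -> R) :
  (forall i, realnorm (F i) <= b i) -> realnorm (\sum_i F i) <= \sum_i b i.
Proof.
move=> Fb; elim/big_ind2: _ => [|v r w s vr ws|//]; first by rewrite rn0.
exact: le_trans (rnD _ _) (lerD vr ws).
Qed.

Lemma rn_cvgP T (F : set_system T) {FF : Filter F} (f : T -> V) (v : V) :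
  f @ F --> v <-> forall e : R, 0 < e -> \forall t \near F, realnorm (v - f t) < e.
Proof.
rewrite cvgrPdist_lt; split => [fv e e0|fv _ /gt0_ofR[e e0 ->]].
  have /fv : 0 < ofR e by rewrite ofR_lt.
  by apply: filterS => t; rewrite normvE ofR_lt.
by apply: filterS (fv e e0) => t; rewrite normvE ofR_lt.
Qed.

End Module.

(** The limit keeps the explicit rate [e], on which the later error estimates rely. *)
Lemma rn_seq_cvg (V : completeNormedModType C) (u : nat -> V) (e : nat -> R) :
  (forall n m, (n <= m)%N -> realnorm (u n - u m) <= e n) ->
  (forall d, 0 < d -> exists n, e n < d) ->
  exists l : V, forall n, realnorm (u n - l) <= e n.
Proof.
move=> ue e0.
have cu : cvg (u @ \oo).
  apply/cauchy_cvgP/cauchy_ballP => _ /gt0_ofR[d d0 ->].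
  have [N eN] := e0 (d / 2) (divr_gt0 d0 (ltr0Sn _ 1)).
  exists ([set v | realnorm (u N - v) <= e N], [set v | realnorm (u N - v) <= e N]).
    by split; exists N => // n /= Nn; exact: ue.
  move=> [v w] /= [Nv Nw]; rewrite -ball_normE /= normvE ofR_lt.
  by have := rn_dist (u N) v w; rewrite (rnB v (u N)); lra.
exists (lim (u @ \oo)) => n; apply/ler_addgt0Pl => d d0.
have /rn_cvgP/(_ d d0) [N _ uN] : u @ \oo --> lim (u @ \oo) by [].
have := uN (maxn N n) (leq_maxl _ _); have := ue n (maxn N n) (leq_maxr _ _).
have := rn_dist (u (maxn N n)) (u n) (lim (u @ \oo)).
by rewrite (rnB (u (maxn N n)) (lim _)) => /=; lra.
Qed.

Section CcvgP.
Variables (T : Type) (F : set_system T) (FF : Filter F).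

Lemma cabs_cvgP (f : T -> C) (z : C) :
  f @ F --> z <-> forall e : R, 0 < e -> \forall t \near F, cabs (z - f t) < e.
Proof.
rewrite cvgrPdist_lt; split => [fv e e0|fv _ /gt0_ofR[e e0 ->]].
  have /fv : 0 < ofR e by rewrite ofR_lt.
  by apply: filterS => t; rewrite normE ofR_lt.
by apply: filterS (fv e e0) => t; rewrite normE ofR_lt.
Qed.

Lemma ofR_cvg (f : T -> R) r : f @ F --> r -> (ofR \o f) @ F --> ofR r.
Proof.
move=> /cvgrPdist_lt fr; apply/cabs_cvgP => e /fr; apply: filterS => t /=.
by rewrite -cabs_ofR; congr (cabs _ < _); exact: (rmorphB (real_complex R)).
Qed.

Definition cRe (z : C) : R := complex.Re (z : R[i]).
Lemma cRe_le z : `|cRe z| <= cabs z.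
Proof. by rewrite -ofR_le -normE; exact: normc_ge_Re. Qed.

Lemma cReD z w : cRe (z + w) = cRe z + cRe w. Proof. by case: z w => [? ?] []. Qed.
Lemma cReN z : cRe (- z) = - cRe z. Proof. by case: z. Qed.

Lemma cRe_cvg (f : T -> C) z : f @ F --> z -> (cRe \o f) @ F --> cRe z.
Proof.
move=> /cabs_cvgP fr; apply/cvgrPdist_lt => e /fr; apply: filterS => t /=.
by apply: le_lt_trans; rewrite -cReN -cReD cRe_le.
Qed.

Lemma conjC_cvg (f : T -> C) z : f @ F --> z -> (fun t => (f t)^*) @ F --> z^*.
Proof.
move=> /cabs_cvgP fr; apply/cabs_cvgP => e /fr; apply: filterS => t /=.
by rewrite -rmorphB cabsJ.
Qed.

End CcvgP.

End RealNorm.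

(** * Functions with compact support and torus functions *)

Section Torus.
Variables (R : realType) (X : booleanSpaceType).
Local Notation C := (Cplx R).
Local Notation TF := (torus_fun R X).
Implicit Types (h k : TF) (x y : X) (U V K : set X) (b : X -> C).

Lemma suppP h x : supp h x <-> h x <> 0.
Proof. by split => /eqP. Qed.

Lemma torus_norm1 h x : h x <> 0 -> `|h x| = 1.
Proof. by move/suppP; exact: torus_fun_norm. Qed.

Lemma torus_mulJ h x : h x <> 0 -> h x * (h x)^* = 1.
Proof. by move=> /torus_norm1 h1; rewrite -normCK h1 expr1n. Qed.

Lemma compact_open_nbhs_out U x : compact_open U -> ~ U x -> nbhs x (~` U).
Proof.
move=> [cU oU] nU; apply: open_nbhs_nbhs; split => //; apply: closed_openC.
exact: compact_closed (@hausX X) cU.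
Qed.

(** A compact open set is closed, so [f] is locally constant off [U]. *)
Lemma continuous_on_compact_open (T : topologicalType) (f g : X -> T) U z :
  compact_open U -> {within U, continuous f} -> (forall x, ~ U x -> f x = z) ->
  continuous f.
Proof.
move=> coU fU f0 x; have [Ux|nUx] := pselect (U x).
  by move: fU; rewrite (continuous_open_subspace f coU.2); apply; exact: mem_set.
move=> A; rewrite /= (f0 _ nUx) => Az; have := compact_open_nbhs_out coU nUx.
by apply: filterS => y /f0 /= ->; exact: nbhs_singleton.
Qed.

Lemma torus_continuous h : continuous h.
Proof.
apply: (@continuous_on_compact_open _ h h (supp h) 0); [exact: torus_fun_supp|
  exact: torus_fun_continuous|].
by move=> x /suppP; apply: contra_notP.
Qed.

Lemma torus_cut b U : compact_open U -> continuous b -> (forall x, U x -> `|b x| = 1) ->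
  exists h, forall x, h x = if x \in U then b x else 0.
Proof.
move=> coU cb b1; pose f x : C := if x \in U then b x else 0.
have fU : supp f = U.
  apply/seteqP; split => x; rewrite /supp /f /=.
    by case: ifPn => [/set_mem|]; rewrite ?eqxx.
  by move=> Ux; rewrite mem_set // -normr_eq0 b1 // oner_eq0.
have f_supp : compact_open (supp f) by rewrite fU.
have f_cont : {within supp f, continuous f}.
  rewrite fU; apply: (@subspace_eq_continuous _ U C b); last exact: continuous_subspaceT.
  by move=> x xU; rewrite /f /= /from_subspace xU.
have f_norm x : supp f x -> `|f x| = 1.
  by rewrite fU => Ux; rewrite /f mem_set // b1.
by exists (TorusFun f_supp f_cont f_norm).
Qed.

Lemma torus_mulE h k x : torus_mul h k x = h x * k x.
Proof. by []. Qed.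

Lemma torus_indE U (coU : compact_open U) x : torus_ind R coU x = if x \in U then 1 else 0.
Proof. by rewrite /= /indic; case: (x \in U). Qed.

Lemma torus_indT U (coU : compact_open U) x : U x -> torus_ind R coU x = 1.
Proof. by move=> Ux; rewrite torus_indE mem_set. Qed.

Lemma torus_indF U (coU : compact_open U) x : ~ U x -> torus_ind R coU x = 0.
Proof. by move=> Ux; rewrite torus_indE memNset. Qed.

Lemma exists_torus_conj h : exists k, forall x, k x = (h x)^*.
Proof.
have [|x hx|k kE] := @torus_cut (fun x => (h x)^*) (supp h) (torus_fun_supp h).
- by move=> x; apply: conjC_cvg; exact: torus_continuous.
- by rewrite norm_conjC; exact: torus_fun_norm.
- exists k => x; rewrite kE; case: ifPn => // /negP xh.
  have [->|hx] := eqVneq (h x) 0; first by rewrite conjC0.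
  by case: xh; apply: mem_set.
Qed.

Definition torus_conj h : TF := projT1 (cid (exists_torus_conj h)).

Lemma torus_conjE h x : torus_conj h x = (h x)^*.
Proof. exact: (projT2 (cid (exists_torus_conj h))). Qed.

Lemma exists_torus_scale (c : C) U : compact_open U -> `|c| = 1 ->
  exists h, (forall x, U x -> h x = c) /\ (forall x, ~ U x -> h x = 0).
Proof.
move=> coU c1; have [||h hE] := @torus_cut (cst c) U coU; [exact: cst_continuous|by []|].
by exists h; split => x Ux; rewrite hE; [rewrite mem_set|rewrite memNset].
Qed.

Lemma CcX_torus h : CcX h.
Proof.
split; first exact: torus_continuous.
by exists (supp h); [case: (torus_fun_supp h)|move=> x /suppP; apply: contra_notP].
Qed.

Lemma CcX0 : CcX (fun _ : X => 0 : C).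
Proof. by split; [exact: cst_continuous|exists set0 => //; exact: compact0]. Qed.

Lemma CcXD b b' : CcX b -> CcX b' -> CcX (fun x => b x + b' x).
Proof.
move=> [cb [K cK bK]] [cb' [K' cK' bK']]; split.
  by move=> x; apply: cvgD; [exact: cb|exact: cb'].
exists (K `|` K'); first exact: compactU.
by move=> x nK; rewrite bK ?bK' ?addr0 // => Kx; apply: nK; [right|left].
Qed.

Lemma CcXMr b b' : CcX b -> continuous b' -> CcX (fun x => b x * b' x).
Proof.
move=> [cb [K cK bK]] cb'; split.
  by move=> x; apply: (@cvgM C); [exact: cb|exact: cb'].
by exists K => // x nK; rewrite bK ?mul0r.
Qed.

Lemma CcXZ c b : CcX b -> CcX (fun x => c * b x).
Proof.
move=> bC; have -> : (fun x => c * b x) = (fun x => b x * c).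
  by apply/funext => x; rewrite mulrC.
by apply: CcXMr => //; exact: cst_continuous.
Qed.

Lemma CcX_sum n (F : 'I_n -> X -> C) : (forall i, CcX (F i)) ->
  CcX (fun x => \sum_i F i x).
Proof.
elim: n F => [|n IH] F FC.
  by under eq_fun do rewrite big_ord0; exact: CcX0.
by under eq_fun do rewrite big_ord_recl; apply: CcXD => //; exact: IH.
Qed.

Lemma CcXJ b : CcX b -> CcX (fun x => (b x)^*).
Proof.
move=> [cb [K cK bK]]; split; first by move=> x; apply: conjC_cvg; exact: cb.
by exists K => // x nK; rewrite bK ?conjC0.
Qed.

Lemma CcX_support b : CcX b ->
  exists2 U, compact_open U & forall x, b x <> 0 -> U x.
Proof.
move=> [_ [K cK bK]]; have [U coU KU] := compact_sub_compact_open cK.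
by exists U => // x bx; apply: KU; apply: contrapT => /bK.
Qed.

(** Near-covering compactness is used along the integers tending to infinity: near each point, every
    large enough integer is a bound. *)
Lemma CcX_bounded b : CcX b -> exists2 M, 0 < M & forall x, cabs (b x) <= M.
Proof.
move=> [cb [K cK bK]].
have /compact_near_coveringP/(_ _ \oo (fun (n : nat) x => cabs (b x) < n%:R) _) := cK.
case=> [x _|N _ /(_ N (leqnn N)) bN]; last first.
  exists N.+1%:R => // x; have [/bN/ltW/le_trans|/bK ->] := pselect (K x).
    by apply; rewrite ler_nat.
  by rewrite cabs0.
have [N N1] : exists N : nat, cabs (b x) + 1 < N%:R.
  by exists (Num.bound (cabs (b x) + 1)); rewrite archi_boundP // addr_ge0 // cabs_ge0.
have /cabs_cvgP/(_ 1 ltr01) bx := cb x.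
exists ([set y | cabs (b x - b y) < 1], [set n | (N <= n)%N]) => /=.
  by split=> //; exists N.
move=> [y n] /= [by1 Nn]; apply: (lt_le_trans (y := N%:R)); last by rewrite ler_nat.
apply: lt_trans N1; apply: le_lt_trans (_ : cabs (b x - b y) + cabs (b x) < _); last lra.
by have := cabsD (b y - b x) (b x); rewrite subrK -(cabsN (b y - b x)) opprB.
Qed.

(* A function [r] with values in [[-1, 1]] is the real part of the unimodular
   [r + i sqrt (1 - r^2)]. *)
Lemma CcX_real_torus b (M : R) : CcX b -> 0 < M -> (forall x, cabs (b x) <= M) ->
  exists h, forall x, ofR (cRe (b x)) = ofR (M / 2) * (h x + (h x)^*).
Proof.
move=> bC M0 bM; have [U coU bU] := CcX_support bC.
pose r x := cRe (b x) / M.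
pose g x : C := ofR (r x) + 'i * ofR (Num.sqrt (1 - r x ^+ 2)).
have r1 x : r x ^+ 2 <= 1.
  rewrite -real_normK ?num_real // expr_le1 // /r normrM normfV (gtr0_norm M0).
  by rewrite ler_pdivrMr // mul1r (le_trans (cRe_le _)).
have cr : continuous r.
  move=> x; apply: cvgM; last exact: cvg_cst.
  by apply: cRe_cvg; exact: bC.1.
have cg : continuous g.
  move=> x; apply: (@cvgD C); first exact: ofR_cvg (cr x).
  apply: (@cvgM C); first exact: cvg_cst.
  apply: (@ofR_cvg R X (nbhs x) _ (fun x => Num.sqrt (1 - r x ^+ 2))).
  apply: (@continuous_comp _ _ _ (fun x => 1 - r x ^+ 2) Num.sqrt);
    last exact: sqrt_continuous.
  apply: cvgB; first exact: cvg_cst.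
  exact: (cvgM (cr x) (cr x)).
have gJ x : (g x)^* = ofR (r x) - 'i * ofR (Num.sqrt (1 - r x ^+ 2)).
  by rewrite /g rmorphD rmorphM /= !ofR_conj conjCi mulNr.
have g1 x : U x -> `|g x| = 1.
  move=> _; apply/eqP; rewrite -(@pexpr_eq1 _ _ 2) // normCK gJ /g.
  rewrite mulrC -subr_sqr exprMn sqrCi mulN1r opprK.
  have -> : ofR (Num.sqrt (1 - r x ^+ 2)) ^+ 2 = ofR (1 - r x ^+ 2).
    by rewrite expr2 -ofRM -expr2 sqr_sqrtr // subr_ge0.
  by rewrite expr2 -ofRM -ofRD -expr2 addrC subrK.
have [h hE] := torus_cut coU cg g1; exists h => x; rewrite hE.
case: ifPn => [_|/negP xU].
  rewrite gJ /g addrACA subrr addr0 -!ofRD -ofRM; congr ofR.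
  by rewrite /r -mulrDl -mulr2n -mulr_natr; field; rewrite gt_eqF.
have -> : b x = 0 by apply: contrapT => /bU /mem_set.
by rewrite conjC0 addr0 mulr0.
Qed.

(** The imaginary part is written as minus the real part of ['i * z], so that the result on real
    parts also serves for it, applied to ['i * b]. *)
Lemma cReIm (z : C) : z = ofR (cRe z) - 'i * ofR (cRe ('i * z)).
Proof.
have iE : 'i = (Complex 0 1 : C) by [].
case: z => a b; rewrite iE; apply/eqP; rewrite eq_complex /=; apply/andP.
by split; apply/eqP; rewrite /cRe /=; ring.
Qed.

Lemma CcX_torus_span b (M : R) : CcX b -> 0 < M -> (forall x, cabs (b x) <= M) ->
  exists h k, forall x, b x =
    ofR (M / 2) * (h x + (h x)^*) - 'i * (ofR (M / 2) * (k x + (k x)^*)).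
Proof.
move=> bC M0 bM; have [h hE] := CcX_real_torus bC M0 bM.
have [x|k kE] := @CcX_real_torus _ M (CcXZ 'i bC) M0.
  by rewrite cabsM /cabs normCi /= mul1r; exact: bM.
by exists h, k => x; rewrite -hE -kE -cReIm.
Qed.

Lemma closed_norm_ge (f : X -> C) (e : R) : continuous f ->
  closed [set x | ofR e <= `|f x|].
Proof.
move=> cf; rewrite -openC openE => x /= /negP; rewrite normE ofR_le -ltNge => fx.
have cfx : f @ x --> f x := cf x.
have /cabs_cvgP/(_ (e - cabs (f x))) := cfx; rewrite subr_gt0 => /(_ fx).
apply: filterS => y /= fxy; apply/negP; rewrite normE ofR_le -ltNge.
have := cabsD (f x) (f y - f x); rewrite addrCA subrr addr0 -(cabsN (f y - f x)) opprB.
lra.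
Qed.

Lemma CcX_C0X b : CcX b -> sa_set (s := C0X R X) b.
Proof.
move=> [cb [K cK bK]]; split=> // _ /gt0_ofR[e e0 ->].
apply: (subclosed_compact _ cK) => [|x /= eb]; first exact: closed_norm_ge.
apply: contrapT => /bK b0; move: eb.
by rewrite b0 normr0 -ofR0 ofR_le leNgt e0.
Qed.

Lemma indE (V : set X) x : (\1_V : X -> C) x = if x \in V then 1 else 0.
Proof. by rewrite /indic; case: (x \in V). Qed.

Lemma CcX_ind V : compact_open V -> CcX (\1_V : X -> C).
Proof. by move=> coV; exact: (CcX_torus (torus_ind R coV)). Qed.

End Torus.

(** * Inverse semigroups and the partial homeomorphisms of the extension *)

Section InverseSemigroupTheory.
Variable S : invSemigroupType.
Implicit Types s t u e f g : S.
Local Open Scope group_scope.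

Lemma istarK s : istar (istar s) = s.
Proof. by symmetry; apply: istar_uniq; [exact: istar_mulK|exact: mul_istarK]. Qed.

Lemma istar_idem e : idem e -> istar e = e.
Proof. by move=> ee; symmetry; apply: istar_uniq; rewrite !ee. Qed.

(** With [x] the inverse of [e * f], the element [f * x * e] satisfies the same two equations and so
    equals [x]; this form makes [x] idempotent, hence its own inverse. *)
Lemma idemM e f : idem e -> idem f -> idem (e * f).
Proof.
move=> ee ff; pose x := istar (e * f).
have x1 : e * f * x * (e * f) = e * f by exact: mul_istarK.
have x2 : x * (e * f) * x = x by exact: istar_mulK.
have fxe : f * x * e = x.
  apply: istar_uniq.
    by rewrite !mulgA -(mulgA e f f) ff -(mulgA _ e e) ee -!mulgA !mulgA in x1 *.
  rewrite !mulgA -(mulgA _ e e) ee -(mulgA _ f f) ff.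
  by rewrite -[RHS]/(f * x * e) -{3}x2 !mulgA.
have xx : idem x.
  by rewrite /idem -{1}fxe -{2}fxe -[RHS]fxe -{3}x2 !mulgA.
have -> : e * f = x by rewrite -[LHS]istarK -/x istar_idem.
by [].
Qed.

Lemma idemC e f : idem e -> idem f -> e * f = f * e.
Proof.
move=> ee ff; have efi := idemM ee ff; have fei := idemM ff ee.
rewrite -[LHS]istar_idem //; symmetry; apply: istar_uniq.
  by rewrite !mulgA -(mulgA e f f) ff -(mulgA _ e e) ee -mulgA.
by rewrite !mulgA -(mulgA f e e) ee -(mulgA _ f f) ff -mulgA.
Qed.

Lemma dproj_idem s : idem (istar s * s).
Proof. by rewrite /idem mulgA istar_mulK. Qed.

Lemma rproj_idem s : idem (s * istar s).
Proof. by rewrite /idem mulgA mul_istarK. Qed.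

Lemma istarM s t : istar (s * t) = istar t * istar s.
Proof.
have c := idemC (dproj_idem s) (rproj_idem t).
symmetry; apply: istar_uniq.
  have -> : s * t * (istar t * istar s) * (s * t) =
      s * (t * istar t * (istar s * s)) * t by rewrite !mulgA.
  by rewrite -c !mulgA mul_istarK -!mulgA [t * (_ * _)]mulgA mul_istarK.
have -> : istar t * istar s * (s * t) * (istar t * istar s) =
  istar t * (istar s * s * (t * istar t)) * istar s by rewrite !mulgA.
by rewrite c !mulgA istar_mulK -!mulgA [istar s * (_ * _)]mulgA istar_mulK.
Qed.

Lemma idem_izero : idem (izero : S).
Proof. exact: mul_izero. Qed.

End InverseSemigroupTheory.

(** * Torus functions, domains and the maps [phi] in a twisted extension *)

Section TwistedBoolean.
Variables (R : realType) (X : booleanSpaceType) (G S : invSemigroupType).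
Variable E : twisted_boolean R X G S.
Local Notation C := (Cplx R).
Local Notation TF := (torus_fun R X).
Local Notation j := (tbis_inj E).
Local Notation p := (tbis_proj E).
Local Notation phi := (phi E).
Local Notation sdom := (sdom E).
Local Notation sran := (sran E).
Local Notation one s := (torus_ind R (sdom_compact_open E s)).
Implicit Types (s t e : S) (x y : X) (h k : TF).
Local Open Scope group_scope.

Lemma proj_istar s : p (istar s) = istar (p s).
Proof. by apply: istar_uniq; rewrite -!tbis_projM ?mul_istarK ?istar_mulK. Qed.

Lemma proj0 : p izero = izero.
Proof.
have [z zE] := tbis_proj_surj E izero.
by rewrite -[RHS](izero_mul (p izero)) -zE -tbis_projM mul_izero.
Qed.

Lemma sran_istar s : sran s = sdom (istar s).
Proof. by rewrite /Defs.sran /Defs.sdom proj_istar /rproj /dproj istarK. Qed.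

Lemma proj_idem s : idem s -> idem (p s).
Proof. by rewrite /idem -tbis_projM => ->. Qed.

Lemma sdom_inj h : sdom (j h) = supp h.
Proof.
rewrite /Defs.sdom /dproj; have pj : idem (p (j h)) by apply/tbis_exact; exists h.
by rewrite (istar_idem pj) pj tbis_domE.
Qed.

Lemma istar_inj h : istar (j h) = j (torus_conj h).
Proof.
symmetry; apply: istar_uniq; rewrite -!tbis_injM; congr (j _);
  apply: torus_fun_eq => x /=; rewrite torus_conjE.
  have [->|/eqP hx] := eqVneq (h x) 0; first by rewrite !mul0r.
  by rewrite torus_mulJ ?mul1r.
have [->|/eqP hx] := eqVneq (h x) 0; first by rewrite conjC0 !mul0r.
by rewrite -mulrA torus_mulJ ?mulr1.
Qed.

(** By exactness [e] comes from a torus function [h], and [h * h = h] leaves only the values 0 and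
    1. *)
Lemma idem_indicator e : idem e -> forall co : compact_open (sdom e),
  e = j (torus_ind R co).
Proof.
move=> ee co; have /tbis_exact[h he] := proj_idem ee.
rewrite -[LHS]he; congr (j _).
have hh : torus_mul h h = h by apply: (tbis_inj_inj (t := E)); rewrite tbis_injM he.
apply: torus_fun_eq => x; rewrite torus_indE -he sdom_inj.
have [hx|hx] := eqVneq (h x) 0; first by rewrite hx memNset // => /suppP.
rewrite mem_set //; have := congr1 (fun f : TF => f x) hh => /= hhx.
by apply: (mulfI hx); rewrite hhx mulr1.
Qed.

Lemma sdom_idem e x : idem e -> sdom e x = tbis_dom E (p e) x.
Proof. by move=> /proj_idem pe; rewrite /Defs.sdom /dproj (istar_idem pe) pe. Qed.

Lemma sdom_dproj s : sdom (istar s * s) = sdom s.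
Proof.
apply/funext => x; rewrite sdom_idem; last exact: dproj_idem.
by rewrite tbis_projM proj_istar.
Qed.

Lemma dprojE s : istar s * s = j (one s).
Proof.
rewrite [LHS](idem_indicator (dproj_idem s) (sdom_compact_open E _)).
by congr (j _); apply: torus_fun_eq => x; rewrite !torus_indE sdom_dproj.
Qed.

Lemma rprojE s : s * istar s = j (one (istar s)).
Proof. by rewrite -dprojE istarK. Qed.

Lemma mul_one s : s * j (one s) = s.
Proof. by rewrite -dprojE mulgA mul_istarK. Qed.

Lemma one_mul s : j (one (istar s)) * s = s.
Proof. by rewrite -rprojE mul_istarK. Qed.

Lemma sdom0 x : ~ sdom izero x.
Proof.
rewrite sdom_idem; last exact: idem_izero.
rewrite proj0; have [_ DU Dle] := tbis_stone E.
have [e ee De] := DU _ (@compact_open0 X); have : ile izero e.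
  by exists izero; [exact: idem_izero|rewrite izero_mul].
by move/Dle => /(_ (idem_izero _) ee); rewrite De; apply.
Qed.

Lemma conj_torus s h : exists k, [/\ s * j h * istar s = j k,
  forall x, sdom s x -> k (phi s x) = h x & forall y, k y <> 0 -> sran s y].
Proof.
have [k [kE ks kphi]] := tbis_conj E s h; exists k; split => // y /suppP; exact: ks.
Qed.

(** [phi] is defined by choice with a default value. The conjugation axiom for the indicator of the
    domain excludes the default: the conjugate is supported in the range and equals 1 at
    [phi s x]. *)
Lemma phi_ran s x : sdom s x -> sran s (phi s x).
Proof.
move=> sx; have [k [_ kphi kran]] := conj_torus s (one s).
by apply: kran; rewrite kphi // torus_indT //; apply/eqP; exact: oner_neq0.
Qed.

Lemma phi_dom s x : sdom s x -> sdom (istar s) (phi s x).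
Proof. by rewrite -sran_istar; exact: phi_ran. Qed.

(** Torus functions are what the conjugation axiom evaluates along [phi], so identities between
    values of [phi] are proved by testing against them. *)
Lemma torus_sep x y : (forall h, h x = h y) -> x = y.
Proof.
move=> hxy; apply: contrapT => /compact_open_sep[V [coV Vx nVy]].
have := hxy (torus_ind R coV); rewrite torus_indT // torus_indF // => /eqP.
by rewrite oner_eq0.
Qed.

Lemma phiK s x : sdom s x -> phi (istar s) (phi s x) = x.
Proof.
move=> sx; have rx := phi_dom sx.
have dz : sdom s (phi (istar s) (phi s x)) by have := phi_dom rx; rewrite istarK.
apply: torus_sep => h.
have [k [kE kphi _]] := conj_torus s h.
have [l [lE lphi _]] := conj_torus (istar s) k.
have <- : l (phi (istar s) (phi s x)) = h x by rewrite lphi // kphi.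
(* Conjugating by [s] and then by [istar s] is conjugating by [istar s * s], which only cuts [h]
   down to the domain of [s]. *)
have -> : l = torus_mul (one s) (torus_mul h (one s)).
  apply: (tbis_inj_inj (t := E)); rewrite -lE !tbis_injM -kE -dprojE istarK.
  by rewrite !mulgA.
by rewrite !torus_mulE !torus_indT // mul1r mulr1.
Qed.

Lemma phi_inj s x y : sdom s x -> sdom s y -> phi s x = phi s y -> x = y.
Proof. by move=> sx sy xy; rewrite -(phiK sx) xy phiK. Qed.

Lemma phiVK s y : sdom (istar s) y -> phi s (phi (istar s) y) = y.
Proof. by move=> /phiK; rewrite istarK. Qed.

(** Here [h] is the conjugate of [k] by [istar s]. The rule carries torus factors through [s] from
    left to right, which is how products and inverses of germs are computed. *)
Lemma torus_mul_comm s k : exists h, j k * s = s * j h /\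
  forall x, sdom s x -> h x = k (phi s x).
Proof.
have [h [hE hphi _]] := conj_torus (istar s) k; exists h; split; last first.
  by move=> x sx; rewrite -{1}(phiK sx) hphi //; exact: phi_dom.
by rewrite -hE istarK !mulgA rprojE (tbis_inj_comm E _ k) -mulgA one_mul.
Qed.

(** The idempotent [istar (s * t) * (s * t)] is the conjugate by [istar t] of the indicator of the
    domain of [s]. *)
Lemma sdomM s t x : sdom (s * t) x <-> sdom t x /\ sdom s (phi t x).
Proof.
have [l [lE lphi lran]] := conj_torus (istar t) (one s).
have lst : one (s * t) = l.
  apply: (tbis_inj_inj (t := E)).
  by rewrite -lE istarK -!dprojE istarM !mulgA.
have lx : sdom t x -> l x = one s (phi t x).
  by move=> tx; rewrite -{1}(phiK tx) lphi //; exact: phi_dom.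
have n10 : (1%R : C) <> 0 by apply/eqP; exact: oner_neq0.
split=> [stx|[tx sx]].
  have l1 : l x <> 0 by rewrite -lst torus_indT.
  have tx : sdom t x by have := lran _ l1; rewrite sran_istar istarK.
  split => //; apply: contrapT => nsx; apply: l1; rewrite lx // torus_indF //.
apply: contrapT => nst; apply: n10.
by rewrite -(torus_indT R (sdom_compact_open E s) sx) -lx // -lst torus_indF.
Qed.

Lemma phiM s t x : sdom (s * t) x -> phi (s * t) x = phi s (phi t x).
Proof.
move=> stx; have [tx sx] := (sdomM s t x).1 stx; apply: torus_sep => g.
have l2 h l : s * t * j h * istar (s * t) = j l -> l (phi s (phi t x)) = h x.
  move=> lE.
  have [k [kE kphi _]] := conj_torus t h.
  have [l' [l'E l'phi _]] := conj_torus s k.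
  have -> : l = l'.
    by apply: (tbis_inj_inj (t := E)); rewrite -lE -l'E -kE istarM !mulgA.
  by rewrite l'phi // kphi.
(* Both points can be compared only through conjugates by [s * t]. So [g] is replaced by [l], its
   restriction to the range of [s * t], which is the conjugate of [h]. *)
have [h [hE hphi _]] := conj_torus (istar (s * t)) g.
have [l [lE lphi lran]] := conj_torus (s * t) h.
have lg y : sran (s * t) y -> l y = g y.
  rewrite sran_istar => sty.
  have -> : l = torus_mul (one (istar (s * t))) (torus_mul g (one (istar (s * t)))).
    apply: (tbis_inj_inj (t := E)); rewrite -lE !tbis_injM -hE -rprojE istarK.
    by rewrite !mulgA.
  by rewrite !torus_mulE !torus_indT // mul1r mulr1.
have r2 : sran (s * t) (phi s (phi t x)).
  have [k [kE _ kran]] := conj_torus (s * t) (one (s * t)); apply: kran.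
  by rewrite (l2 _ _ kE) torus_indT //; apply/eqP; exact: oner_neq0.
have := l2 _ _ lE; rewrite lg // => ->.
by rewrite -lg ?lphi //; exact: phi_ran.
Qed.

(** Torus functions commute, so conjugation by [j h] multiplies by the squared modulus of [h], which
    is 1 on its support. *)
Lemma phi_torus h x : h x <> 0 -> phi (j h) x = x.
Proof.
move=> hx; have jx : sdom (j h) x by rewrite sdom_inj; apply/suppP.
apply: torus_sep => g; have [l [lE lphi lran]] := conj_torus (j h) g.
have l1 y : h y <> 0 -> l y = g y.
  move=> hy; have -> : l = torus_mul (torus_mul h g) (torus_conj h).
    by apply: (tbis_inj_inj (t := E)); rewrite -lE istar_inj !tbis_injM.
  by rewrite !torus_mulE torus_conjE mulrAC torus_mulJ // mul1r.
rewrite -l1 ?lphi //; apply/suppP; rewrite -sdom_inj.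
by have := phi_dom jx; rewrite istar_inj !sdom_inj => /suppP; rewrite torus_conjE =>
  /eqP; rewrite conjC_eq0 => /eqP/suppP.
Qed.

Lemma sdom_mul_torus s h x : sdom (s * j h) x <-> sdom s x /\ h x <> 0.
Proof.
split=> [/sdomM[]|[sx hx]].
  by rewrite sdom_inj => /suppP hx; rewrite phi_torus.
by apply/sdomM; rewrite phi_torus // sdom_inj; split => //; exact/suppP.
Qed.

Lemma phi_mul_torus s h x : sdom s x -> h x <> 0 -> phi (s * j h) x = phi s x.
Proof.
by move=> sx hx; rewrite phiM ?phi_torus //; apply/sdom_mul_torus.
Qed.

End TwistedBoolean.

(** * Germs and the functions [Delta s] *)

Section GermTheory.
Variables (R : realType) (X : booleanSpaceType) (G S : invSemigroupType).
Variable E : twisted_boolean R X G S.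
Local Notation C := (Cplx R).
Local Notation TF := (torus_fun R X).
Local Notation j := (tbis_inj E).
Local Notation phi := (phi E).
Local Notation sdom := (sdom E).
Local Notation one s := (torus_ind R (sdom_compact_open E s)).
Implicit Types (s t e : S) (x y : X) (h k a b : TF) (sigma tau rho : twist E).

Lemma germ_ex s x : sdom s x -> exists sigma, is_germ s x sigma.
Proof. by move=> sx; have sx' := asboolT sx; eexists; exists sx'. Qed.

Lemma germ_any sigma : exists s x, is_germ s x sigma.
Proof.
rewrite -[sigma]reprK; case: (repr sigma) => -[s x] sx; exists s, x; by exists sx.
Qed.

Lemma germ_dom s x sigma : is_germ s x sigma -> sdom s x.
Proof. by case=> sx _; exact/asboolP. Qed.

Lemma germ_eq s x t y sigma tau : is_germ s x sigma -> is_germ t y tau ->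
  sigma = tau <-> x = y /\ exists a b, [/\ (s * j a)%g = (t * j b)%g, a x = 1 & b x = 1].
Proof.
move=> [sx ->] [ty ->].
split=> [/eqP|xy]; first by rewrite eqmodE => /asboolP.
by apply/eqP; rewrite eqmodE; apply/asboolP.
Qed.

Lemma germ_src s x sigma : is_germ s x sigma -> src sigma = x.
Proof.
have := erefl sigma; rewrite -{1}[sigma]reprK /src.
case: (repr sigma) => -[t y] ty /= e xs.
have ys : is_germ t y sigma by exists ty.
by have [->] := (germ_eq ys xs).1 erefl.
Qed.

Lemma germ_unique s x sigma tau : is_germ s x sigma -> is_germ s x tau -> sigma = tau.
Proof.
move=> sx tx; apply/(germ_eq sx tx); split=> //; exists (one s), (one s).
by rewrite !torus_indT //; exact: germ_dom sx.
Qed.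

Lemma germ_change s x t sigma a b : is_germ s x sigma ->
  (s * j a)%g = (t * j b)%g -> a x = 1 -> b x = 1 -> is_germ t x sigma.
Proof.
move=> sx st a1 b1.
have tx : sdom t x.
  have : sdom (t * j b)%g x.
    rewrite -st; apply/sdom_mul_torus; rewrite a1; split; first exact: germ_dom sx.
    by apply/eqP; exact: oner_neq0.
  by case/sdom_mul_torus.
have [tau txg] := germ_ex tx.
suff -> : sigma = tau by [].
by apply/(germ_eq sx txg); split => //; exists a, b.
Qed.

(** This brings a germ into the form [[s h, x]], from which its position relative to the bisection
    of [s] is read off as the scalar [h x]. *)
Lemma germ_of_eq t x sigma s a h : is_germ t x sigma -> (t * j a)%g = (s * j h)%g ->
  a x = 1 -> is_germ (s * j h)%g x sigma.
Proof.
move=> tx ts a1.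
have n10 : (1 : C) <> 0 by apply/eqP; exact: oner_neq0.
have hx : h x <> 0.
  have : sdom (s * j h)%g x.
    by rewrite -ts; apply/sdom_mul_torus; rewrite a1; split => //; exact: germ_dom tx.
  by case/sdom_mul_torus.
pose e := torus_ind R (torus_fun_supp h).
apply: (germ_change (b := e) tx _ a1); last by apply: torus_indT; apply/suppP.
rewrite ts -mulgA -tbis_injM; congr (_ * j _)%g; apply: torus_fun_eq => y.
rewrite torus_mulE torus_indE; case: ifPn => [_|/negP yh]; first by rewrite mulr1.
by rewrite mulr0; apply: contrapT => /suppP /mem_set.
Qed.

Lemma torus_cancel s x h k : (s * j h)%g = (s * j k)%g -> sdom s x -> h x = k x.
Proof.
move=> shk sx; have : torus_mul (one s) h = torus_mul (one s) k.
  by apply: (tbis_inj_inj (t := E)); rewrite !tbis_injM -dprojE -!mulgA shk.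
by move=> /(congr1 (fun f : TF => f x)); rewrite !torus_mulE torus_indT // !mul1r.
Qed.

(** This is the freeness of the circle action. *)
Lemma germ_torus_value s x sigma h k : is_germ (s * j h)%g x sigma ->
  is_germ (s * j k)%g x sigma -> h x = k x.
Proof.
move=> sh sk; have [_ [a [b [hk a1 b1]]]] := (germ_eq sh sk).1 erefl.
rewrite -!mulgA -!tbis_injM in hk; have [sx _] := (sdom_mul_torus _ _ _ _).1 (germ_dom sh).
by have := torus_cancel hk sx; rewrite !torus_mulE a1 b1 !mulr1.
Qed.

Lemma germ_tgt s x sigma : is_germ s x sigma -> tgt sigma = phi s x.
Proof.
have := erefl sigma; rewrite -{1}[sigma]reprK /tgt.
case: (repr sigma) => -[t y] ty /= e sx.
have tys : is_germ t y sigma by exists ty.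
have [xy [a [b [st a1 b1]]]] := (germ_eq tys sx).1 erefl.
rewrite xy in tys a1 b1 *; have n10 : (1 : C) <> 0 by apply/eqP; exact: oner_neq0.
rewrite -(phi_mul_torus (h := a)) ?a1 //; last exact: germ_dom tys.
by rewrite st phi_mul_torus ?b1 //; exact: germ_dom sx.
Qed.

Lemma circle_actP s x tau h : is_germ s x tau -> h x <> 0 ->
  is_germ (s * j h)%g x (circle_act (h x) tau).
Proof.
move=> sx hx; rewrite /circle_act; case: xgetP => [rho -> /= [t [y [c [ty cy cs tc]]]]|].
  have xy : x = y by rewrite -(germ_src sx) (germ_src ty).
  rewrite -{y}xy in ty cy cs tc.
  have [_ [a [b [st a1 b1]]]] := (germ_eq ty sx).1 erefl.
  (* The two products are completed to a common one. The added factors are 1 at [x], because [a] and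
     [b] are and because [c x = h x] has modulus 1. *)
  have teq : (t * j c * j (torus_mul a (torus_mul h (torus_conj c))))%g =
      (s * j h * j (torus_mul b (torus_mul c (torus_conj c))))%g.
    rewrite -!mulgA -!tbis_injM.
    have -> : torus_mul c (torus_mul a (torus_mul h (torus_conj c))) =
        torus_mul a (torus_mul h (torus_mul c (torus_conj c))).
      by apply: torus_fun_eq => z /=; ring.
    have -> : torus_mul h (torus_mul b (torus_mul c (torus_conj c))) =
        torus_mul b (torus_mul h (torus_mul c (torus_conj c))).
      by apply: torus_fun_eq => z /=; ring.
    by rewrite !(tbis_injM E a) !(tbis_injM E b) !mulgA st.
  have cc : c x * (c x)^* = 1 by apply: torus_mulJ; apply/suppP.
  apply: (germ_change tc teq); rewrite !torus_mulE torus_conjE ?a1 ?b1 ?mul1r //.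
  by rewrite -cy.
move=> none; have shx : sdom (s * j h)%g x.
  by apply/sdom_mul_torus; split => //; exact: germ_dom sx.
have [rho rhoP] := germ_ex shx.
by case: (none rho); exists s, x, h; split => //; exact/suppP.
Qed.

(** The germ of [s * j h] is that of [s] acted on by [h x]. With the converse [Delta_neq0], this
    replaces the definition of [Delta] by choice in all computations. *)
Lemma Delta_germ s h x sigma : is_germ (s * j h)%g x sigma -> Delta E s sigma = (h x)^*.
Proof.
move=> sh; have [sx hx] := (sdom_mul_torus E s h x).1 (germ_dom sh).
have [tau txs] := germ_ex sx.
rewrite /Delta; case: xgetP => [z -> /= [theta [tau' [th1 [y ty] sE ->]]]|].
  have th0 : theta <> 0 by move=> t0; move/eqP: th1; rewrite t0 normr0 eq_sym oner_eq0.
  have [c [cU _]] := exists_torus_scale (sdom_compact_open E s) th1.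
  have cy : c y = theta by apply: cU; exact: germ_dom ty.
  have := @circle_actP s y tau' c ty; rewrite cy -sE => /(_ th0) scs.
  have xy : x = y by rewrite -(germ_src sh) (germ_src scs).
  rewrite -{y}xy in ty cy scs.
  by rewrite -cy (germ_torus_value sh scs).
move=> none; case: (none (h x)^*); exists (h x), tau; split => //.
- exact: torus_norm1.
- by exists x.
- exact: germ_unique sh (circle_actP txs hx).
Qed.

Lemma Delta_neq0 s sigma : Delta E s sigma <> 0 ->
  exists h, is_germ (s * j h)%g (src sigma) sigma.
Proof.
rewrite /Delta; case: xgetP => // z -> /= [theta [tau [th1 [y ty] sE _]]] _.
have th0 : theta <> 0 by move=> t0; move/eqP: th1; rewrite t0 normr0 eq_sym oner_eq0.
have [c [cU _]] := exists_torus_scale (sdom_compact_open E s) th1.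
have cy : c y = theta by apply: cU; exact: germ_dom ty.
have := @circle_actP s y tau c ty; rewrite cy -sE => /(_ th0) scs.
by exists c; rewrite (germ_src scs).
Qed.

Lemma Delta_eq t x sigma s a h : is_germ t x sigma -> (t * j a)%g = (s * j h)%g ->
  a x = 1 -> Delta E s sigma = (h x)^*.
Proof. by move=> tx ts a1; apply: Delta_germ; exact: germ_of_eq tx ts a1. Qed.

(** On the support of [h], the germ of [s * j k] is that of [s * j h] scaled by [k] times the
    conjugate of [h]. The conjugate built into [Delta] turns this back into the factor [h] itself,
    so the dependence on [h] is linear. *)
Lemma Delta_mul_torus s h sigma :
  Delta E (s * j h)%g sigma = Delta E s sigma * h (src sigma).
Proof.
have [s0|/eqP/Delta_neq0[k sk]] := eqVneq (Delta E s sigma) 0.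
  rewrite s0 mul0r; apply: contrapT => /Delta_neq0[k].
  rewrite -mulgA -tbis_injM => shk; have := Delta_germ shk.
  have [_ hk] := (sdom_mul_torus _ _ _ _).1 (germ_dom shk).
  by rewrite s0 => /esym/eqP; rewrite conjC_eq0 => /eqP.
set x := src sigma in sk *; rewrite (Delta_germ sk).
have [h0|/eqP hx] := eqVneq (h x) 0.
  rewrite h0 mulr0; apply: contrapT => /Delta_neq0[k'].
  rewrite -mulgA -tbis_injM => /germ_dom/sdom_mul_torus[_].
  by rewrite torus_mulE -/x h0 mul0r.
have hh := torus_mulJ hx.
rewrite (Delta_eq (a := torus_mul h (torus_conj h)) (h := torus_mul k (torus_conj h)) sk) //.
- by rewrite torus_mulE torus_conjE rmorphM /= conjCK.
- rewrite -!mulgA -!tbis_injM; congr (_ * j _)%g; apply: torus_fun_eq => y /=; ring.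
- by rewrite torus_mulE torus_conjE.
Qed.

Lemma Delta_src s sigma : Delta E s sigma <> 0 -> sdom s (src sigma).
Proof. by move=> /Delta_neq0[h /germ_dom/sdom_mul_torus[]]. Qed.

Lemma Delta_izero : Delta E izero = fun=> 0.
Proof.
by apply/funext => sigma; apply: contrapT => /Delta_src; exact: sdom0.
Qed.

End GermTheory.

(** * Convolution and involution on the functions [Delta s] *)

Section DeltaAlgebra.
Variables (R : realType) (X : booleanSpaceType) (G S : invSemigroupType).
Variable E : twisted_boolean R X G S.
Local Notation C := (Cplx R).
Local Notation TF := (torus_fun R X).
Local Notation j := (tbis_inj E).
Local Notation phi := (phi E).
Local Notation sdom := (sdom E).
Local Notation Delta := (Delta E).
Local Notation glift := (@Defs.lift _ _ _ _ E).
Local Notation one s := (torus_ind R (sdom_compact_open E s)).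
Implicit Types (s t u e : S) (x y : X) (h k a b : TF) (sigma tau rho : twist E).
Implicit Types (gamma : germ_groupoid E).

(** The chosen value does not depend on the representative: adjoints put the torus factors of a germ
    relation on the left, and [torus_mul_comm] returns them to the right, where they are 1 at
    [phi s x]. *)
Lemma twist_invP s x sigma : is_germ s x sigma ->
  is_germ (istar s) (phi s x) (twist_inv sigma).
Proof.
move=> sx; rewrite /twist_inv; case: xgetP => [rho -> /= [t [y [ty tr]]]|none].
  have [yx [a [b [ts a1 b1]]]] := (germ_eq ty sx).1 erefl; rewrite yx in ty tr a1 b1.
  rewrite -(germ_tgt ty) (germ_tgt sx) in tr.
  have phist : phi t x = phi s x by rewrite -(germ_tgt ty) (germ_tgt sx).
  have [a' [a'E a'phi]] := torus_mul_comm E (istar t) (torus_conj a).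
  have [b' [b'E b'phi]] := torus_mul_comm E (istar s) (torus_conj b).
  apply: (germ_change (a := a') (b := b') tr).
  - by rewrite -a'E -b'E -!istar_inj -!istarM ts.
  - rewrite a'phi; last exact: germ_dom tr.
    by rewrite -phist phiK ?torus_conjE ?a1 ?conjC1 //; exact: germ_dom ty.
  - rewrite b'phi; last by apply: phi_dom; exact: germ_dom sx.
    by rewrite phiK ?torus_conjE ?b1 ?conjC1 //; exact: germ_dom sx.
have [rho srho] := germ_ex (phi_dom (germ_dom sx)).
by case: (none rho); exists s, x.
Qed.

Lemma twist_mulP s t x sigma tau : is_germ s (phi t x) sigma -> is_germ t x tau ->
  is_germ (s * t)%g x (twist_mul sigma tau).
Proof.
move=> sx tx; rewrite /twist_mul; case: xgetP => [rho -> /= [s' [t' [y [sy ty sty]]]]|none].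
  have yx : y = x by rewrite -(germ_src ty) (germ_src tx).
  rewrite {}yx in sy ty sty.
  have [xx [a [b [ss a1 b1]]]] := (germ_eq sx sy).1 erefl.
  have [_ [c [e [tt c1 e1]]]] := (germ_eq tx ty).1 erefl.
  rewrite xx in b1 a1.
  have [a' [a'E a'phi]] := torus_mul_comm E t a.
  have [b' [b'E b'phi]] := torus_mul_comm E t' b.
  apply: (germ_change (a := torus_mul b' e) (b := torus_mul a' c) sty).
  - rewrite !tbis_injM !mulgA -(mulgA s') -b'E -(mulgA s) -a'E !mulgA ss.
    by rewrite -!mulgA tt.
  - by rewrite torus_mulE e1 mulr1 b'phi //; exact: germ_dom ty.
  - by rewrite torus_mulE c1 mulr1 a'phi ?xx //; exact: germ_dom tx.
have [rho srho] : exists rho, is_germ (s * t)%g x rho.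
  by apply: (@germ_ex _ _ _ _ E); apply/sdomM; split; [exact: germ_dom tx|exact: germ_dom sx].
by case: (none rho); exists s, t, x.
Qed.

Lemma twist_invK sigma : twist_inv (twist_inv sigma) = sigma.
Proof.
have [s [x sx]] := germ_any sigma; have := twist_invP (twist_invP sx).
rewrite istarK phiK; last exact: germ_dom sx.
by move=> sx'; exact: germ_unique sx' sx.
Qed.

Lemma twist_star_Delta s : twist_star E (Delta s) = Delta (istar s).
Proof.
(* It is enough to compare values where the right-hand side is nonzero; where it is zero, the same
   statement is used for [istar s] at the inverse germ. *)
have star1 t sigma : Delta (istar t) sigma <> 0 ->
    (Delta t (twist_inv sigma))^* = Delta (istar t) sigma.
  move=> /Delta_neq0[h th]; set x := src sigma in th.
  have [tx hx] := (sdom_mul_torus _ _ _ _).1 (germ_dom th).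
  have := twist_invP th; rewrite istarM istarK istar_inj phi_mul_torus //.
  have [k [-> kphi]] := torus_mul_comm E t (torus_conj h) => /Delta_germ ->.
  have ty : sdom t (phi (istar t) x) by have := phi_dom tx; rewrite istarK.
  by rewrite conjCK kphi // phiVK // torus_conjE (Delta_germ th).
apply/funext => sigma; rewrite /twist_star.
have [s0|/eqP/star1//] := eqVneq (Delta (istar s) sigma) 0.
rewrite s0; apply/eqP; rewrite conjC_eq0; apply/eqP; apply: contrapT => ns.
have := @star1 (istar s) (twist_inv sigma).
by rewrite istarK twist_invK s0 conjC0 => /(_ ns)/esym.
Qed.

Lemma germ_lift gamma :
  is_germ (val (repr gamma)).1 (val (repr gamma)).2 (glift gamma).
Proof.
by rewrite /Defs.lift; case: (repr gamma) => -[s x] sx; exists sx.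
Qed.

Lemma groupoid_tgtE gamma : groupoid_tgt gamma = tgt (glift gamma).
Proof. by rewrite (germ_tgt (germ_lift gamma)). Qed.

Lemma lift_inj s x h k gamma gamma' : is_germ (s * j h)%g x (glift gamma) ->
  is_germ (s * j k)%g x (glift gamma') -> gamma = gamma'.
Proof.
move=> sh sk.
have [_ hx] := (sdom_mul_torus _ _ _ _).1 (germ_dom sh).
have [_ kx] := (sdom_mul_torus _ _ _ _).1 (germ_dom sk).
have [e1 [a [b [ab a1 b1]]]] := (germ_eq (germ_lift gamma) sh).1 erefl.
have [e2 [a' [b' [ab' a'1 b'1]]]] := (germ_eq (germ_lift gamma') sk).1 erefl.
rewrite -[gamma]reprK -[gamma']reprK; apply/eqP; rewrite eqmodE; apply/asboolP.
rewrite e1 in a1 b1 *; rewrite e2 in a'1 b'1 *.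
split=> //; exists (torus_mul a (torus_mul k b')), (torus_mul a' (torus_mul h b)).
rewrite /supp /= a1 a'1 b1 b'1 !mul1r !mulr1; split; [|exact/eqP..].
rewrite !tbis_injM !mulgA ab ab' -!mulgA -!tbis_injM; congr (_ * j _)%g.
by apply: torus_fun_eq => y /=; ring.
Qed.

(** The lift of [[[s, x]]] is a choice, hence known only up to a scalar, which [h] records. *)
Lemma lift_ex s x : sdom s x -> exists gamma h, is_germ (s * j h)%g x (glift gamma).
Proof.
move=> sx; have sx' := asboolT sx.
pose q : germ_pair E := exist _ (s, x) sx'.
pose gamma := (\pi_(germ_groupoid E) q)%qT; exists gamma.
have : gamma == (\pi_(germ_groupoid E) q)%qT by [].
rewrite -{1}[gamma]reprK eqmodE => /asboolP /= [ex [a [b [ab ax bx]]]].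
have := germ_lift gamma; rewrite ex in ax bx *.
move=> gx; exists (torus_mul b (torus_conj a)).
apply: (germ_of_eq (a := torus_mul a (torus_conj a)) gx).
  by rewrite !tbis_injM !mulgA ab.
by rewrite torus_mulE torus_conjE torus_mulJ //; apply/suppP.
Qed.

Lemma convolution_term s t sigma gamma : groupoid_tgt gamma = tgt sigma ->
  Delta s (glift gamma) * Delta t (twist_mul (twist_inv (glift gamma)) sigma) <> 0 ->
  Delta s (glift gamma) * Delta t (twist_mul (twist_inv (glift gamma)) sigma) =
  Delta (s * t)%g sigma.
Proof.
rewrite groupoid_tgtE; set tau := glift gamma => tgteq.
move=> /eqP; rewrite mulf_eq0 negb_or => /andP[/eqP ns /eqP nt].
have [h sh] := Delta_neq0 ns; set x := src tau in sh.
have [k tk] := Delta_neq0 nt.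
have [sx hx] := (sdom_mul_torus _ _ _ _).1 (germ_dom sh).
have [w [y wy]] := germ_any sigma.
have ex : phi (s * j h)%g x = phi w y by rewrite -(germ_tgt sh) tgteq (germ_tgt wy).
have tsw := twist_invP sh; rewrite ex in tsw.
have iw := twist_mulP tsw wy.
rewrite (germ_src iw) in tk.
have [_ [a [b [ab a1 b1]]]] := (germ_eq iw tk).1 erefl.
have [ty ky] := (sdom_mul_torus _ _ _ _).1 (germ_dom tk).
have tyx : phi t y = x.
  rewrite -(phi_mul_torus ty ky) -(germ_tgt tk) (germ_tgt iw) phiM; last exact: germ_dom iw.
  by rewrite -ex phiK //; exact: germ_dom sh.
have [h' [h'E h'phi]] := torus_mul_comm E t h.
have h'y : h' y = h x by rewrite h'phi // tyx.
have [c [cE cphi]] := torus_mul_comm E w (one (istar (s * j h)%g)).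
(* In the semigroup, this is the cancellation of [tau] with its inverse in front of [sigma]: [c] is
   the range projection of [s * j h] carried through [w], and [h'] is [h] carried through [t]. *)
have key : (w * j (torus_mul c a) = s * t * j (torus_mul h' (torus_mul k b)))%g.
  rewrite !tbis_injM.
  have -> : (w * (j c * j a) = s * j h * (istar (s * j h) * w * j a))%g.
    by rewrite mulgA -cE -rprojE !mulgA.
  by rewrite ab !mulgA -(mulgA s _ t) h'E !mulgA.
rewrite (Delta_germ sh) (Delta_germ tk) (Delta_eq (a := torus_mul c a) wy key).
  by rewrite !torus_mulE b1 mulr1 h'y rmorphM.
rewrite torus_mulE a1 mulr1 cphi ?torus_indT //; last exact: germ_dom wy.
by rewrite -ex; apply: phi_dom; exact: germ_dom sh.
Qed.

(** Since [phi s] is injective, a bisection meets the arrows with a given target at most once. A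
    convolution with [Delta s] on the left thus has at most one nonzero term. *)
Lemma convolution_point s sigma gamma gamma' : Delta s (glift gamma) <> 0 ->
  Delta s (glift gamma') <> 0 -> groupoid_tgt gamma = tgt sigma ->
  groupoid_tgt gamma' = tgt sigma -> gamma = gamma'.
Proof.
rewrite !groupoid_tgtE => /Delta_neq0[h sh] /Delta_neq0[k sk] e e'.
have [sx hx] := (sdom_mul_torus _ _ _ _).1 (germ_dom sh).
have [sy ky] := (sdom_mul_torus _ _ _ _).1 (germ_dom sk).
have xy : src (glift gamma) = src (glift gamma').
  apply: (phi_inj sx sy).
  by rewrite -(phi_mul_torus sx hx) -(phi_mul_torus sy ky) -(germ_tgt sh) e -(germ_tgt sk).
by rewrite xy in sh; exact: lift_inj sh sk.
Qed.

Lemma convolution_Delta s t : convolution E (Delta s) (Delta t) = Delta (s * t)%g.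
Proof.
apply/funext => sigma; rewrite /convolution.
pose F gamma := Delta s (glift gamma) * Delta t (twist_mul (twist_inv (glift gamma)) sigma).
have [[gamma0 g0 F0]|none] := pselect (exists2 gamma,
    groupoid_tgt gamma = tgt sigma & F gamma <> 0).
  rewrite -(@fsbig_widen _ _ _ _ [set gamma0]) ?fsbig_set1.
  - exact: convolution_term.
  - by move=> _ ->.
  - move=> gamma /= [gt ng]; apply: contrapT => nF; apply: ng.
    have ns gam : F gam <> 0 -> Delta s (glift gam) <> 0.
      by apply: contra_not => e; rewrite /F e mul0r.
    exact: convolution_point (ns _ nF) (ns _ F0) gt g0.
rewrite fsbig1; last first.
  by move=> gamma gt; apply: contrapT => nF; apply: none; exists gamma.
(* With no contributing arrow, the right-hand side must vanish: otherwise the arrow [[[s, phi t y]]]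
   would have a nonzero term. *)
apply/esym; apply: contrapT => /Delta_neq0[g stg]; apply: none.
set y := src sigma in stg.
have [sty gy] := (sdom_mul_torus _ _ _ _).1 (germ_dom stg).
have [ty sty'] := (sdomM _ _ _ _).1 sty.
have [gamma [h sh]] := lift_ex sty'; exists gamma.
  rewrite groupoid_tgtE (germ_tgt sh) (germ_tgt stg).
  have [_ hx] := (sdom_mul_torus _ _ _ _).1 (germ_dom sh).
  by rewrite !phi_mul_torus // phiM.
have [_ hx] := (sdom_mul_torus _ _ _ _).1 (germ_dom sh).
rewrite /F (Delta_germ sh).
have := twist_invP sh; rewrite phi_mul_torus // -phiM // -(phi_mul_torus sty gy).
move=> /twist_mulP/(_ stg); rewrite istarM istar_inj.
have [h' [h'E h'phi]] := torus_mul_comm E (istar s * s * t)%g (torus_conj h).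
have [l [lE lphi]] := torus_mul_comm E t (one s).
have -> : (j (torus_conj h) * istar s * (s * t * j g) =
    t * j (torus_mul l (torus_mul h' g)))%g.
  rewrite !tbis_injM !mulgA -lE -dprojE -h'E !mulgA.
  by [].
move=> tt; rewrite (Delta_germ tt) -rmorphM => /eqP; rewrite conjC_eq0 mulf_eq0.
have [_ lx] := (sdom_mul_torus _ _ _ _).1 (germ_dom tt).
by move=> /orP[]/eqP.
Qed.

(** Lists serve as elements of the semigroup algebra of [S], with [lincomb_mul] and [lincomb_star]
    as its operations. The same lists are evaluated in [B(K)] by [rep_lincomb]. *)
Definition lincomb (l : seq (C * S)) : twist E -> C :=
  fun sigma => \sum_(q <- l) q.1 * Delta q.2 sigma.

Definition lincomb_mul (l l' : seq (C * S)) : seq (C * S) :=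
  [seq (q.1 * q'.1, (q.2 * q'.2)%g) | q <- l, q' <- l'].

Definition lincomb_star (l : seq (C * S)) : seq (C * S) :=
  [seq (q.1^*, istar q.2) | q <- l].

(** Sums over an infinite set can be split only when the supports are finite. One finite list [r]
    common to all terms of [l] makes the convolution bilinear on combinations. *)
Lemma convolution_support (l : seq (C * S)) sigma :
  exists r : seq (germ_groupoid E), [/\ uniq r,
    forall gamma, gamma \in r -> groupoid_tgt gamma = tgt sigma &
    forall gamma q, groupoid_tgt gamma = tgt sigma -> gamma \notin r ->
      q \in l -> Delta q.2 (glift gamma) = 0].
Proof.
elim: l => [|[c s] l [r [ur rt rD]]]; first by exists [::].
have [[gamma0 g0 F0]|none] := pselect (exists2 gamma,
    groupoid_tgt gamma = tgt sigma & Delta s (glift gamma) <> 0).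
  exists (undup (gamma0 :: r)); split; first exact: undup_uniq.
    by move=> gamma; rewrite mem_undup inE => /orP[/eqP->|/rt].
  move=> gamma q gt; rewrite mem_undup !inE negb_or => /andP[g0' gr] /orP[/eqP->|ql] /=.
    apply: contrapT => nD; move/eqP: g0'; apply.
    exact: convolution_point nD F0 gt g0.
  exact: rD ql.
exists r; split=> // gamma q gt gr; rewrite inE => /orP[/eqP->|] /=; last exact: rD.
by apply: contrapT => nD; apply: none; exists gamma.
Qed.

Lemma convolution_lincomb l l' :
  convolution E (lincomb l) (lincomb l') = lincomb (lincomb_mul l l').
Proof.
apply/funext => sigma; have [r [ur rt rD]] := convolution_support l sigma.
have conv f g : (forall gamma, groupoid_tgt gamma = tgt sigma ->
      gamma \notin r -> f (glift gamma) = 0) ->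
    convolution E f g sigma = \sum_(gamma <- r)
      f (glift gamma) * g (twist_mul (twist_inv (glift gamma)) sigma).
  move=> f0; rewrite /convolution (fsbigE r) //.
  - rewrite big_seq_cond [RHS]big_seq; apply: eq_bigl => gamma.
    by case: (boolP (_ \in r)) => //= /rt gt; rewrite mem_set.
  - by move=> gamma gr gnr; rewrite f0 ?mul0r.
rewrite conv; last first.
  move=> gamma gt gr; rewrite /lincomb big_seq big1 // => q ql.
  by rewrite (rD gamma q) ?mulr0.
rewrite /lincomb_mul /lincomb big_allpairs_dep /=.
under eq_bigr do rewrite mulr_suml.
rewrite exchange_big /= big_seq [RHS]big_seq; apply: eq_bigr => q ql.
under eq_bigr do rewrite mulr_sumr.
rewrite exchange_big /=; apply: eq_bigr => q' _.
rewrite -convolution_Delta conv => [|gamma gt gr]; last exact: rD.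
by rewrite mulr_sumr; apply: eq_bigr => gamma _; rewrite mulrACA.
Qed.

Lemma twist_star_lincomb l : twist_star E (lincomb l) = lincomb (lincomb_star l).
Proof.
apply/funext => sigma; rewrite /twist_star /lincomb rmorph_sum /lincomb_star big_map /=.
by apply: eq_bigr => q _; rewrite rmorphM /= -twist_star_Delta.
Qed.

Lemma lincomb_cat l l' : lincomb (l ++ l') = (fun sigma => lincomb l sigma + lincomb l' sigma).
Proof. by apply/funext => sigma; rewrite /lincomb big_cat. Qed.

Definition lincomb_scale (c : C) (l : seq (C * S)) := [seq (c * q.1, q.2) | q <- l].

Lemma lincomb_scaleE c l : lincomb (lincomb_scale c l) = (fun sigma => c * lincomb l sigma).
Proof.
apply/funext => sigma; rewrite /lincomb /lincomb_scale big_map mulr_sumr.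
by apply: eq_bigr => q _; rewrite mulrA.
Qed.

Lemma lincomb1 c s : lincomb [:: (c, s)] = (fun sigma => c * Delta s sigma).
Proof. by apply/funext => sigma; rewrite /lincomb big_seq1. Qed.

Lemma Delta_one s sigma : Delta s sigma * one s (src sigma) = Delta s sigma.
Proof. by rewrite -Delta_mul_torus mul_one. Qed.

Lemma CcGS_lincomb l : CcGS E (lincomb l).
Proof.
(* A constant is not compactly supported; it is multiplied by the indicator of the domain, which
   [Delta] absorbs. *)
exists (size l), (fun i => (tnth (in_tuple l) i).2),
  (fun i x => (tnth (in_tuple l) i).1 * one (tnth (in_tuple l) i).2 x); split.
  by move=> i; apply: CcXZ; exact: CcX_torus.
apply/funext => sigma; rewrite /lincomb big_tnth; apply: eq_bigr => i _.
by rewrite -[in LHS]Delta_one mulrCA mulrA [in RHS]mulrC -mulrA mulrC -!mulrA.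
Qed.

Lemma lincomb_CcGS f : CcGS E f -> exists l, f = lincomb l.
Proof.
move=> [n [s [b [bC ->]]]].
pose P (g : twist E -> C) := exists l, g = lincomb l.
have : forall i, P (fun sigma => Delta (s i) sigma * b i (src sigma)).
  move=> i; have [M M0 bM] := CcX_bounded (bC i).
  have [h [k hk]] := CcX_torus_span (bC i) M0 bM.
  pose c := ofR (M / 2).
  exists [:: (c, (s i * j h)%g); (c, (s i * j (torus_conj h))%g);
             (- 'i * c, (s i * j k)%g); (- 'i * c, (s i * j (torus_conj k))%g)].
  apply/funext => sigma; rewrite /lincomb !big_cons big_nil /= !Delta_mul_torus.
  by rewrite hk !torus_conjE -/c; ring.
elim: n s b {bC} => [|n IH] s b Pi.
  exists [::]; apply/funext => sigma.
  by rewrite big_ord0 /lincomb big_nil.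
have [l lE] := IH (fun i => s (lift ord0 i)) (fun i => b (lift ord0 i)) (fun i => Pi _).
have [l' l'E] := Pi ord0; exists (l' ++ l); rewrite lincomb_cat -lE -l'E.
by apply/funext => sigma; rewrite big_ord_recl.
Qed.

Lemma Delta_join s t u : orthogonal_pair s t -> is_join s t u ->
  Delta u = (fun sigma => Delta s sigma + Delta t sigma).
Proof.
move=> [_ st0] [su tu least].
have disj x : sdom s x -> sdom t x -> False.
  move=> sx tx.
  have : (j (one s) * j (one t))%g = izero.
    by rewrite -!dprojE mulgA -(mulgA (istar s)) st0 izero_mul mul_izero.
  rewrite -tbis_injM => st0'; apply: (@sdom0 _ _ _ _ E x).
  rewrite -st0' sdom_inj; apply/suppP; rewrite torus_mulE !torus_indT // mulr1.
  by apply/eqP; exact: oner_neq0.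
have le_dom v w x : ile v w -> sdom v x -> sdom w x.
  move=> [e ee ->]; rewrite (idem_indicator ee (sdom_compact_open E e)).
  by move=> /sdom_mul_torus[].
have le_one v w : ile v w -> v = (w * j (one v))%g.
  move=> vw; have [e ee vE] := vw; rewrite -[LHS](mul_one E) {1}vE.
  rewrite (idem_indicator ee (sdom_compact_open E e)) -mulgA -tbis_injM.
  congr (_ * j _)%g; apply: torus_fun_eq => x; rewrite torus_mulE.
  have [vx|vx] := pselect (sdom v x); last first.
    by rewrite (torus_indF R (sdom_compact_open E v) vx) mulr0.
  rewrite !torus_indT ?mulr1 //; by move: vx; rewrite vE => /sdomM[].
have Ds v sigma : ile v u -> Delta v sigma = Delta u sigma * one v (src sigma).
  by move=> /le_one {1}->; rewrite Delta_mul_torus.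
have coU := compact_openU (sdom_compact_open E s) (sdom_compact_open E t).
(* The join [u] is given only as a least upper bound. Its restriction [v] to the union of the two
   domains is again an upper bound, so minimality confines the domain of [u] to that union. *)
pose v := (u * j (torus_ind R coU))%g.
have le_v w : ile w u -> (forall x, sdom w x -> sdom s x \/ sdom t x) -> ile w v.
  move=> wu wst; exists (j (one w)).
    by rewrite /idem -dprojE; exact: dproj_idem.
  rewrite {1}(le_one _ _ wu) /v -mulgA -tbis_injM; congr (_ * j _)%g.
  apply: torus_fun_eq => x; rewrite torus_mulE.
  have [wx|wx] := pselect (sdom w x); last first.
    by rewrite (torus_indF R (sdom_compact_open E w) wx) mulr0.
  by rewrite !torus_indT ?mulr1 //; exact: wst.
have uv : ile u v by apply: least; apply: le_v => //; auto.
have udom x : sdom u x -> sdom s x \/ sdom t x.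
  move=> /(le_dom _ _ _ uv)/sdom_mul_torus[_ vx].
  by apply: contrapT => n; apply: vx; rewrite torus_indF.
apply/funext => sigma; rewrite (Ds s) // (Ds t) // -mulrDr.
have [->|/eqP/Delta_src/udom uD] := eqVneq (Delta u sigma) 0; first by rewrite mul0r.
rewrite -[LHS]mulr1; congr (_ * _); case: uD => x1.
  by rewrite torus_indT // torus_indF ?addr0 // => x2; exact: disj x1 x2.
by rewrite addrC torus_indT // torus_indF ?addr0 // => x2; exact: disj x2 x1.
Qed.

End DeltaAlgebra.

(** * Operators on a Hilbert space and homomorphisms of C*-algebras *)

Section LinearOperators.
Variable R : realType.
Local Notation C := (Cplx R).

Section Linear.
Variables (V W : lmodType C) (T : V -> W).
Hypothesis lT : linear T.

Lemma lin0 : T 0 = 0.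
Proof. by have := lT (-1) 0 0; rewrite scaler0 addr0 scaleN1r addNr. Qed.

Lemma linD x y : T (x + y) = T x + T y.
Proof. by have := lT 1 x y; rewrite !scale1r. Qed.

Lemma linZ c x : T (c *: x) = c *: T x.
Proof. by have := lT c x 0; rewrite !addr0 lin0 addr0. Qed.

Lemma linN x : T (- x) = - T x.
Proof. by rewrite -scaleN1r linZ scaleN1r. Qed.

Lemma linB x y : T (x - y) = T x - T y.
Proof. by rewrite linD linN. Qed.

End Linear.

Section Bounded.
Variables V W : normedModType C.
Implicit Types T U : V -> W.

Lemma linear_bound T : linear T -> continuous T ->
  exists2 M, 0 < M & forall v, realnorm (T v) <= M * realnorm v.
Proof.
move=> lT /(_ 0); rewrite /continuous_at (lin0 lT) => /rn_cvgP/(_ 1 ltr01).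
move=> /nbhs_ballP[_ /= /gt0_ofR[d d0 ->]] dT.
exists (2 / d); first by rewrite divr_gt0.
move=> v; have [v0|v0] := eqVneq (realnorm v) 0.
  by rewrite (rn_eq0 v0) (lin0 lT) !rn0 mulr0.
have vp : 0 < realnorm v by rewrite lt_def v0 rn_ge0.
pose c := d / (2 * realnorm v); have c0 : 0 < c by rewrite divr_gt0 // mulr_gt0.
have : ball 0 (ofR d) (ofR c *: v).
  rewrite -ball_normE /= sub0r normrN normvE ofR_lt rnZ cabs_ofR gtr0_norm //.
  by rewrite /c invfM mulrA mulfVK // ltr_pdivrMr // ltr_pMr // ltr1n.
move=> /dT /=; rewrite sub0r rnN (linZ lT) rnZ cabs_ofR gtr0_norm // => cT.
have -> : 2 / d * realnorm v = c^-1 by rewrite /c; field; rewrite v0 gt_eqF.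
by rewrite -div1r ler_pdivlMr // mulrC ltW.
Qed.

Lemma bound_continuous T M : linear T -> (forall v, realnorm (T v) <= M * realnorm v) ->
  continuous T.
Proof.
move=> lT TM x; apply/rn_cvgP => e e0.
have M1 : 0 < `|M| + 1 by rewrite ltr_pwDr.
have : x @[x --> x] --> x by [].
move=> /rn_cvgP/(_ (e / (`|M| + 1))); rewrite divr_gt0 // => /(_ isT).
apply: filterS => y /=; rewrite ltr_pdivlMr // => xy.
rewrite -(linB lT); apply: le_lt_trans (TM _) _; apply: le_lt_trans xy.
rewrite mulrC; apply: ler_wpM2l; first exact: rn_ge0.
by rewrite (le_trans (ler_norm _)) // lerDl.
Qed.

End Bounded.
End LinearOperators.

Section Hilbert.
Variables (R : realType) (K : hilbert R).
Local Notation C := (Cplx R).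
Implicit Types (x y v w : K) (T U : K -> K).

Definition bop T := linear T /\ continuous T.
Definition is_adjoint T U := forall x y, hdot K (T x) y = hdot K x (U y).

Lemma hdot_conj x y : (hdot K x y)^* = hdot K y x.
Proof. by rewrite [RHS]hermC expr0 mul1r. Qed.

Lemma hdot_le_rn v w : hdot K v v <= hdot K w w -> realnorm v <= realnorm w.
Proof. by rewrite !hdotE ler_pXn2r ?nnegrE ?normr_ge0 // !normvE ofR_le. Qed.

Lemma hdot_ge0 v : 0 <= hdot K v v.
Proof. by rewrite hdotE exprn_ge0 // normr_ge0. Qed.

Lemma hdot_subE T x : is_adjoint T T ->
  hdot K (x - T x) (x - T x) = hdot K x x - hdot K x (T x) *+ 2 + hdot K x (T (T x)).
Proof.
move=> TT; rewrite linearBl !linearBr /= !TT mulr2n !opprD !addrA.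
by rewrite opprK addrAC.
Qed.

(** Pythagoras: the squared norm of [x - T x] is the difference of those of [x] and [T x]. *)
Lemma projection_contract T x : is_adjoint T T -> T \o T = T -> realnorm (T x) <= realnorm x.
Proof.
move=> TT T2; have TTx : T (T x) = T x by rewrite -[in RHS]T2.
apply: hdot_le_rn; rewrite TT TTx -subr_ge0.
by have := hdot_ge0 (x - T x); rewrite (hdot_subE _ TT) TTx mulr2n opprD addrA subrK.
Qed.

Lemma partial_isometry_contract T U x : is_adjoint T U -> is_adjoint (U \o T) (U \o T) ->
  (U \o T) \o (U \o T) = U \o T -> realnorm (T x) <= realnorm x.
Proof.
move=> TU PP P2; have := projection_contract x PP P2.
apply: le_trans; apply: hdot_le_rn; rewrite TU.
have -> : hdot K x (U (T x)) = hdot K ((U \o T) x) ((U \o T) x).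
  by rewrite PP -[in RHS]/(((U \o T) \o (U \o T)) x) P2.
by [].
Qed.

Lemma bop0 : bop (fun=> 0).
Proof. by split; [move=> c x y; rewrite scaler0 addr0|exact: cst_continuous]. Qed.

Lemma bopD T U : bop T -> bop U -> bop (T + U).
Proof.
move=> [lT cT] [lU cU]; split.
  move=> c x y; rewrite /GRing.add /= (linD lT) (linD lU) (linZ lT) (linZ lU).
  by rewrite scalerDr addrACA.
by move=> x; apply: cvgD; [exact: cT|exact: cU].
Qed.

Lemma bopZ c T : bop T -> bop (c *: T).
Proof.
move=> [lT cT]; split.
  move=> d x y; rewrite -[LHS]/(c *: T (d *: x + y)) (linD lT) (linZ lT).
  by rewrite scalerDr scalerA mulrC -scalerA.
by move=> x; apply: cvgZr; exact: cT.
Qed.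

Lemma opnorm_le T v : bop T -> realnorm (T v) <= opnorm T * realnorm v.
Proof.
move=> [lT cT]; have [M M0 TM] := linear_bound lT cT.
have ub : has_ubound [set r | exists2 x : K, realnorm x <= 1 & r = realnorm (T x)].
  exists M => _ /= [x x1 ->]; apply: le_trans (TM x) _.
  by rewrite -[leRHS]mulr1 ler_wpM2l // ltW.
have [v0|v0] := eqVneq (realnorm v) 0.
  by rewrite (rn_eq0 v0) (lin0 lT) !rn0 mulr0.
have vp : 0 < realnorm v by rewrite lt_def v0 rn_ge0.
have : realnorm (T (ofR (realnorm v)^-1 *: v)) <= opnorm T.
  apply: ub_le_sup => //; exists (ofR (realnorm v)^-1 *: v) => //.
  by rewrite rnZ cabs_ofR gtr0_norm ?invr_gt0 // mulVf.
by rewrite (linZ lT) rnZ cabs_ofR gtr0_norm ?invr_gt0 // mulrC ler_pdivrMr.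
Qed.

End Hilbert.

(** * Norm identities in a C*-algebra and contractivity of homomorphisms *)

Section CStar.
Variables (R : realType) (A : cstar_alg R).
Local Notation C := (Cplx R).
Implicit Types a b h k : A.
Local Notation "a ** b" := (cs_mul A a b) (at level 40).
Local Notation star := (@cs_star R A).

Lemma cs_mulBl a b k : (a - b) ** k = a ** k - b ** k.
Proof. exact: linearBl. Qed.
Lemma cs_mulBr a b k : k ** (a - b) = k ** a - k ** b.
Proof. exact: linearBr. Qed.

Lemma cs_rnM a b : realnorm (a ** b) <= realnorm a * realnorm b.
Proof. by rewrite -ofR_le ofRM -!normvE cs_normM. Qed.

Lemma cs_rnE a : realnorm (star a ** a) = realnorm a ^+ 2.
Proof. by apply: ofR_inj; rewrite expr2 ofRM -!normvE cs_normE expr2. Qed.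

Lemma cs_rn_star a : realnorm (star a) = realnorm a.
Proof.
have le b : realnorm b <= realnorm (star b).
  have [->|b0] := eqVneq (realnorm b) 0; first exact: rn_ge0.
  have bp : 0 < realnorm b by rewrite lt_def b0 rn_ge0.
  by rewrite -(ler_pM2r bp) -expr2 -cs_rnE cs_rnM.
by apply/eqP; rewrite eq_le le andbT -{2}[a]cs_starK le.
Qed.

Lemma cs_starN a : star (- a) = - star a.
Proof. by rewrite -scaleN1r cs_starZ rmorphN rmorph1 scaleN1r. Qed.

Lemma cs_starB a b : star (a - b) = star a - star b.
Proof. by rewrite cs_starD cs_starN. Qed.

(* [k = 1 - sqrt (1 - h)], obtained without a unit as the fixed point of the
   contraction [k |-> (h + k^2) / 2]. *)
Lemma cs_sqrt_fixpoint h (r : R) : r < 1 -> realnorm h <= r -> star h = h ->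
  exists2 k, star k = k & h = k + k - k ** k.
Proof.
move=> r1 hr hh; have r0 : 0 <= r := le_trans (rn_ge0 h) hr.
pose half : C := ofR 2^-1; have half2 a : half *: (a + a) = a.
  rewrite -mulr2n -scaler_nat scalerA mulr_natr mulr2n -ofRD.
  by rewrite (_ : 2^-1 + 2^-1 = 1) ?ofR1 ?scale1r //; lra.
have rnhalf a : realnorm (half *: a) = 2^-1 * realnorm a.
  by rewrite rnZ cabs_ofR gtr0_norm // invr_gt0.
pose F k := half *: (h + k ** k); pose u n := iter n F 0.
have uS n : u n.+1 = F (u n) by [].
have ur n : realnorm (u n) <= r.
  elim: n => [|n IH]; first by rewrite rn0.
  rewrite uS rnhalf; have := rnD h (u n ** u n); have := cs_rnM (u n) (u n).
  have := rn_ge0 (u n); nra.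
have ustar n : star (u n) = u n.
  (* Zero is written as [h - h] so that its self-adjointness follows from that of [h]. *)
  have u0 : u 0%N = h - h by rewrite subrr.
  elim: n => [|n IH]; first by rewrite u0 cs_starB hh.
  by rewrite uS cs_starZ ofR_conj cs_starD hh cs_starM IH.
have Flip k l : realnorm k <= r -> realnorm l <= r ->
    realnorm (F k - F l) <= r * realnorm (k - l).
  move=> kr lr; rewrite -scalerBr rnhalf opprD addrACA subrr add0r.
  have -> : k ** k - l ** l = k ** (k - l) + (k - l) ** l.
    by rewrite cs_mulBl cs_mulBr addrA subrK.
  have := rnD (k ** (k - l)) ((k - l) ** l).
  have := cs_rnM k (k - l); have := cs_rnM (k - l) l; have := rn_ge0 (k - l).
  nra.
have u1 n : realnorm (u n - u n.+1) <= r ^+ n.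
  elim: n => [|n IH].
    by rewrite sub0r rnN expr0; exact: le_trans (ur 1%N) (ltW r1).
  rewrite exprS !(uS n.+1) {1}uS; apply: le_trans (Flip _ _ _ _) _ => //.
  exact: ler_wpM2l.
have q0 : 0 < 1 - r by rewrite subr_gt0.
(* The tail of the geometric series that bounds the successive differences. *)
pose e n := r ^+ n / (1 - r).
have um n m : realnorm (u n - u (n + m)%N) <= (r ^+ n - r ^+ (n + m)) / (1 - r).
  elim: m => [|m IH]; first by rewrite addn0 !subrr rn0 mul0r.
  rewrite addnS; apply: le_trans (rn_dist (u (n + m)%N) _ _) _.
  apply: le_trans (lerD IH (u1 _)) _; rewrite exprS.
  by rewrite -[X in _ + X](mulfK (negbT (gt_eqF q0))) -mulrDl ler_pM2r ?invr_gt0 //; lra.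
have ue n m : (n <= m)%N -> realnorm (u n - u m) <= e n.
  move=> nm; rewrite -(subnKC nm); apply: le_trans (um _ _) _.
  by rewrite ler_pM2r ?invr_gt0 // lerBlDr lerDl exprn_ge0.
have e0 d : 0 < d -> exists n, e n < d.
  move=> d0; have /cvg_expr : `|r| < 1 by rewrite ger0_norm.
  move=> /cvgrPdist_lt/(_ (d * (1 - r))); rewrite mulr_gt0 //.
  move=> /(_ isT)[N _ /(_ N (leqnn N))].
  rewrite sub0r normrN ger0_norm ?exprn_ge0 // => rN; exists N.
  by rewrite /e ltr_pdivrMr.
have [k ku] := rn_seq_cvg ue e0.
exists k.
  apply/subr0_eq/rn_small => d d0; have [n nd] := e0 (d / 2) (divr_gt0 d0 (ltr0Sn _ 1)).
  apply: le_trans (rn_dist (u n) _ _) _; rewrite -{1}ustar -cs_starB cs_rn_star.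
  by have := ku n; rewrite (rnB k); lra.
apply/esym/subr0_eq/rn_small => d d0.
have kb : realnorm k <= r.
  apply/ler_addgt0Pl => d' d'0; have [n nd] := e0 d' d'0.
  by have := rnD (k - u n) (u n); rewrite subrK rnB; have := ku n; have := ur n; lra.
(* The norm of [k - F k] is at most [2 * e n], and the defect of the equation is twice [k - F k]. *)
have [n nd] := e0 (d / 4) (divr_gt0 d0 (ltr0Sn _ 3)).
have kF : realnorm (k - F k) <= 2 * e n.
  apply: le_trans (rn_dist (u n.+1) _ _) _.
  have := Flip (u n) k (ur n) kb; rewrite -uS.
  have : e n.+1 <= e n.
    rewrite /e exprS ler_pM2r ?invr_gt0 //; have := exprn_ge0 n r0; nra.
  have := ku n; have := ku n.+1; rewrite (rnB k); have := rn_ge0 (u n - k); nra.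
have -> : k + k - k ** k - h = (k - F k) + (k - F k).
  rewrite addrACA -opprD; have -> : F k + F k = h + k ** k.
    by rewrite /F -scalerDr half2.
  by rewrite opprD addrA addrAC.
by apply: le_trans (rnD _ _) _; lra.
Qed.

Lemma star_hom_contract (K : hilbert R) (rho : A -> bounded_operators K) :
  star_hom rho -> forall a (v : K), realnorm (rho a v) <= realnorm a * realnorm v.
Proof.
move=> hom.
have rD a b w : rho (a + b) w = rho a w + rho b w.
  by rewrite (star_homD hom).
have rZ c a w : rho (c *: a) w = c *: rho a w by rewrite (star_homZ hom).
have rM a b w : rho (a ** b) w = rho a (rho b w).
  by have /= -> := @star_homM _ _ _ _ hom a b I I.
have rS a x y : hdot K (rho a x) y = hdot K x (rho (star a) y).
  exact: (@star_hom_star _ _ _ _ hom a (star a) I I).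
have unit b (v : K) : realnorm b < 1 -> realnorm (rho b v) <= realnorm v.
  move=> b1; apply: hdot_le_rn; rewrite rS -rM.
  have hr : realnorm (star b ** b) <= realnorm b ^+ 2 by rewrite cs_rnE.
  have [||k kk ->] := cs_sqrt_fixpoint _ hr.
  - by rewrite expr_lt1 // rn_ge0.
  - by rewrite cs_starM cs_starK.
  have TT : is_adjoint (rho k) (rho k) by move=> x y; rewrite rS kk.
  rewrite -scaleN1r !rD rZ rM scaleN1r -subr_ge0.
  have := hdot_ge0 (v - rho k v); rewrite hdot_subE //.
  by rewrite linearBr /= linearDr /= opprB mulr2n addrA addrAC.
move=> a v; apply/ler_addgt0Pl => d d0.
(* Dividing [a] by [realnorm a + e] makes the norm strictly less than 1, also for [a = 0]; the cost
   [e * realnorm v] is at most [d]. *)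
pose e := d / (realnorm v + 1).
have vp : 0 < realnorm v + 1 by rewrite ltr_wpDl // rn_ge0.
have e0 : 0 < e by rewrite divr_gt0.
have ae : 0 < realnorm a + e by rewrite ltr_wpDl // rn_ge0.
have := unit (ofR (realnorm a + e)^-1 *: a) v.
rewrite rZ !rnZ cabs_ofR gtr0_norm ?invr_gt0 // mulrC ltr_pdivrMr // mul1r ltrDl.
move=> /(_ e0); rewrite mulrC ler_pdivrMr // => /le_trans; apply.
have : e * (realnorm v + 1) = d by rewrite /e divfK // gt_eqF.
by have := rn_ge0 v; nra.
Qed.

End CStar.

(** * Linear relations between the [Delta s] *)

Section LocalCancellation.
Variables (R : realType) (X : booleanSpaceType) (G S : invSemigroupType).
Variable E : twisted_boolean R X G S.
Local Notation C := (Cplx R).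
Local Notation TF := (torus_fun R X).
Local Notation j := (tbis_inj E).
Local Notation sdom := (sdom E).
Local Notation Delta := (Delta E).
Local Notation one s := (torus_ind R (sdom_compact_open E s)).

(* A linear combination of the [Delta (s i)] that vanishes at [x] does so
   separately on each class of indices with the same germ at [x]; [r] selects
   a representative of each class. *)
Lemma Delta_local_cancellation n (c : 'I_n -> C) (s : 'I_n -> S) :
  (forall sigma, \sum_i c i * Delta (s i) sigma = 0) -> forall x : X,
  exists (r : 'I_n -> 'I_n) (g : 'I_n -> X -> C),
  [/\ forall i, CcX (g i),
      forall k, \sum_(i | r i == k) c i * g i x = 0 &
      forall i, ((forall y, g i y = 0) /\ ~ sdom (s i) x) \/
        exists a b : TF, [/\ (s i * j a = s (r i) * j b)%g, a x <> 0 &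
          forall y, g i y = b y * (a y)^*]].
Proof.
move=> cD x.
(* The class of an index is the arrow [[[s i, x]]]; [None] collects the indices whose domain misses
   [x]. *)
pose cl i : option (germ_groupoid E) := if pselect (sdom (s i) x) is left H
  then Some (\pi_(germ_groupoid E) (exist _ (s i, x) (asboolT H) : germ_pair E))%qT else None.
have clP i k : sdom (s i) x -> cl i = cl k ->
    exists a b : TF, [/\ (s i * j a = s k * j b)%g, a x <> 0 & b x <> 0].
  rewrite /cl; case: pselect => // Hi _; case: pselect => // Hk [] /eqP.
  rewrite eqmodE => /asboolP /= [_ [a [b [ab /suppP ax /suppP bx]]]].
  by exists a, b.
have clE i k : sdom (s i) x -> sdom (s k) x ->
    (exists a b : TF, [/\ (s i * j a = s k * j b)%g, a x <> 0 & b x <> 0]) -> cl i = cl k.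
  move=> si sk [a [b [ab ax bx]]]; rewrite /cl.
  case: pselect => // Hi; case: pselect => // Hk; congr Some.
  apply/eqP; rewrite eqmodE; apply/asboolP; split => //; exists a, b.
  by split => //; exact/suppP.
have clN i k : ~ sdom (s i) x -> cl i = cl k -> ~ sdom (s k) x.
  by rewrite /cl; case: pselect => // _ _; case: pselect.
pose r i := odflt i [pick k | cl k == cl i].
have clr i : cl (r i) = cl i.
  by rewrite /r; case: pickP => [k /eqP //|/(_ i)] /=.
have rE i k : cl i = cl k -> r i = r k.
  move=> ik; rewrite /r ik; case: pickP => [//|/(_ k)]; by rewrite eqxx.
have ex i : exists g : X -> C, CcX g /\ (((forall y, g y = 0) /\ ~ sdom (s i) x) \/
    sdom (s i) x /\ exists a b : TF,
      [/\ (s i * j a = s (r i) * j b)%g, a x <> 0, b x <> 0 &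
      forall y, g y = b y * (a y)^*]).
  have [si|nsi] := pselect (sdom (s i) x); last first.
    by exists (fun=> 0); split; [exact: CcX0|left].
  have [a [b [ab ax bx]]] := clP _ _ si (esym (clr i)).
  (* Multiplying the germ relation by the conjugate of [a] expresses [s i], on the support of [a],
     as [s (r i)] times this function. *)
  exists (fun y => b y * (a y)^*); split; last by right; split => //; exists a, b.
  apply: CcXMr; first exact: CcX_torus.
  by move=> y; apply: conjC_cvg; exact: torus_continuous.
have [g gP] := choice ex; exists r, g; split; [by move=> i; case: (gP i)| |]; last first.
  move=> i; have [_ [|[_ [a [b [? ? ? ?]]]]]] := gP i; first by left.
  by right; exists a, b.
move=> k.
have g0 i : ~ sdom (s i) x -> g i x = 0.
  by move=> nsi; have [_ [[]|[]]] := gP i.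
have [sk|nsk] := pselect (sdom (s k) x); last first.
  rewrite big1 // => i /eqP ri; rewrite g0 ?mulr0 //.
  by apply: (clN _ _ nsk); rewrite -ri clr.
have [rk|rk] := eqVneq (r k) k; last first.
  rewrite big_pred0 // => i; apply: contra_neqF rk => /eqP <-.
  by apply: rE; exact: clr.
(* At the germ of [s k], the value of [Delta (s i)] is [g i x] for [i] in the class of [k] and 0
   otherwise, so the hypothesis at this germ is the claim. *)
have [sigma sks] := germ_ex sk.
rewrite -[RHS](cD sigma) big_mkcond; apply: eq_bigr => i _.
case: ifPn => [/eqP ri|nri].
  congr (_ * _); have [_ [[_ nsi]|[_ [a [b [ab ax bx ->]]]]]] := gP i.
    have := clN _ _ nsi (esym (clr i)); rewrite ri; by [].
  rewrite ri in ab.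
  rewrite (@Delta_eq _ _ _ _ _ (s k) x sigma (s i) (torus_mul b (torus_conj b))
    (torus_mul a (torus_conj b))) //.
  - by rewrite torus_mulE torus_conjE rmorphM /= conjCK mulrC.
  - by rewrite !tbis_injM !mulgA ab.
  - by rewrite torus_mulE torus_conjE torus_mulJ.
apply/esym/eqP; rewrite mulf_eq0; apply/orP; right; apply/eqP.
apply: contrapT => /Delta_neq0[h]; rewrite (germ_src sks) => sih.
have [_ [a [b [ab a1 b1]]]] := (germ_eq sih sks).1 erefl.
have [si hx] := (sdom_mul_torus _ _ _ _).1 (germ_dom sih).
move/eqP: nri; apply; rewrite -rk; apply: rE; apply: clE => //.
have n10 : (1 : C) <> 0 by apply/eqP; exact: oner_neq0.
exists (torus_mul h a), b; rewrite tbis_injM mulgA torus_mulE a1 b1 mulr1.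
by split.
Qed.

End LocalCancellation.

(** * Norm bounds in a representation and vanishing of null combinations *)

Section Representation.
Variables (R : realType) (X : booleanSpaceType) (G S : invSemigroupType).
Variable E : twisted_boolean R X G S.
Local Notation C := (Cplx R).
Local Notation TF := (torus_fun R X).
Local Notation j := (tbis_inj E).
Local Notation sdom := (sdom E).
Local Notation one s := (torus_ind R (sdom_compact_open E s)).
Local Notation ind V := (\1_V : X -> C).

Variables (K : hilbert R) (pi : S -> bounded_operators K).
Hypothesis rep : is_representation E pi.
Implicit Types (v w : K).

Lemma rep_bop s : bop (pi s).
Proof. exact: (rep_in rep s). Qed.

Lemma rep_mul s t v : pi (s * t)%g v = pi s (pi t v).
Proof. by rewrite (repM rep). Qed.

Lemma rep_adj s : is_adjoint (pi s) (pi (istar s)).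
Proof. exact: (rep_star rep s). Qed.

(** [pi (istar s * s)] is a self-adjoint projection, so [pi s] is a partial isometry. *)
Lemma rep_contract s v : realnorm (pi s v) <= realnorm v.
Proof.
have PE : pi (istar s) \o pi s = pi (istar s * s)%g by rewrite (repM rep).
apply: (partial_isometry_contract (U := pi (istar s)) v (rep_adj s)).
  have := rep_adj (istar s * s)%g; rewrite (istar_idem (dproj_idem s)) => PP.
  by move=> x y; have := PP x y; rewrite -PE.
by rewrite PE; apply/funext => w /=; rewrite -rep_mul dproj_idem.
Qed.

Variable pi0 : C0X R X -> bounded_operators K.
Hypothesis pi0_hom : star_hom pi0.
Hypothesis pi0_torus : forall h, pi (j h) = pi0 (h : X -> C).

Lemma pi0D b b' v : CcX b -> CcX b' -> pi0 (fun x => b x + b' x) v = pi0 b v + pi0 b' v.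
Proof.
move=> /CcX_C0X bC /CcX_C0X b'C.
by have := star_homD pi0_hom bC b'C => /(congr1 (fun T : K -> K => T v)).
Qed.

Lemma pi0Z c b v : CcX b -> pi0 (fun x => c * b x) v = c *: pi0 b v.
Proof.
move=> /CcX_C0X bC.
by have := star_homZ pi0_hom c bC => /(congr1 (fun T : K -> K => T v)).
Qed.

Lemma pi0M b b' v : CcX b -> CcX b' -> pi0 (fun x => b x * b' x) v = pi0 b (pi0 b' v).
Proof.
move=> /CcX_C0X bC /CcX_C0X b'C.
by have := star_homM pi0_hom bC b'C => /(congr1 (fun T : K -> K => T v)).
Qed.

Lemma pi0_0 v : pi0 (fun=> 0) v = 0.
Proof.
have -> : (fun=> 0) = (fun x : X => 0 * (0 : C)) by apply/funext => x; rewrite mul0r.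
by rewrite pi0Z ?scale0r //; exact: CcX0.
Qed.

Lemma pi0_sum n (P : pred 'I_n) (F : 'I_n -> X -> C) v : (forall i, CcX (F i)) ->
  pi0 (fun x => \sum_(i | P i) F i x) v = \sum_(i | P i) pi0 (F i) v.
Proof.
move=> FC; rewrite -[in RHS]big_filter; under eq_fun do rewrite -big_filter.
elim: [seq i <- index_enum 'I_n | P i] => [|i r IH].
  by rewrite big_nil; under eq_fun do rewrite big_nil; exact: pi0_0.
rewrite big_cons -IH; under eq_fun do rewrite big_cons.
rewrite pi0D //; elim: r {IH} => [|i' r IH].
  by under eq_fun do rewrite big_nil; exact: CcX0.
by under eq_fun do rewrite big_cons; exact: CcXD.
Qed.

(** Four torus functions, each sent to a contraction, enter with coefficients of modulus [M / 2];
    hence [2 * M]. *)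
Lemma pi0_bound b (M : R) v : CcX b -> 0 < M -> (forall x, cabs (b x) <= M) ->
  realnorm (pi0 b v) <= 2 * M * realnorm v.
Proof.
move=> bC M0 bM; have [h [k hk]] := CcX_torus_span bC M0 bM.
pose c : C := ofR (M / 2); pose tc := @torus_conj R X.
have -> : b = fun x => (c * (h x + tc h x)) + (- 'i) * (c * (k x + tc k x)).
  by apply/funext => x; rewrite hk !torus_conjE mulNr.
have cT (k1 : TF) : CcX k1 by exact: CcX_torus.
rewrite !(pi0D, pi0Z); try by do ?[apply: CcXD|apply: CcXZ|apply: cT].
rewrite -!pi0_torus.
have half (k1 k2 : TF) : realnorm (c *: (pi (j k1) v + pi (j k2) v)) <= M * realnorm v.
  rewrite rnZ cabs_ofR gtr0_norm ?divr_gt0 //.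
  have := rnD (pi (j k1) v) (pi (j k2) v).
  have := rep_contract (j k1) v; have := rep_contract (j k2) v.
  nra.
apply: le_trans (rnD _ _) _; rewrite (rnZ (- 'i)) cabsN.
have -> : cabs 'i = 1 :> R by rewrite /cabs normCi.
have := half h (tc h); have := half k (tc k); lra.
Qed.

Section WellDefined.
Variables (n : nat) (c : 'I_n -> C) (s : 'I_n -> S).
Hypothesis cD : forall sigma, \sum_i c i * Delta E (s i) sigma = 0.

(* On a compact open [V], the operator is rewritten with coefficients [b i]
   bounded by [e] and supported in [V]. Such coefficients over disjoint sets add
   up without increasing the bound, so no estimate on the number of pieces of a
   covering is needed. *)
Definition small_on (e : R) (V : set X) := exists b : 'I_n -> X -> C,
  [/\ forall i, CcX (b i), forall i x, cabs (b i x) <= e,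
      forall i x, ~ V x -> b i x = 0 &
      forall v, \sum_i c i *: pi (s i) (pi0 (ind V) v) = \sum_i pi (s i) (pi0 (b i) v)].

Lemma small_on0 e : 0 < e -> small_on e set0.
Proof.
move=> e0; exists (fun _ _ => 0); split => //.
- by move=> i; exact: CcX0.
- by move=> i x; rewrite cabs0 ltW.
- move=> v; apply: eq_bigr => i _.
  have -> : ind set0 = fun=> 0 by apply/funext => x; rewrite indE memNset.
  by rewrite pi0_0 (lin0 (rep_bop _).1) scaler0.
Qed.

Lemma small_onS e U V : compact_open U -> compact_open V -> V `<=` U ->
  small_on e U -> small_on e V.
Proof.
move=> coU coV VU [b [bC be bU bE]]; exists (fun i x => b i x * ind V x); split.
- by move=> i; apply: CcXMr => //; exact: (CcX_ind R coV).1.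
- move=> i x; rewrite cabsM indE; case: ifP => _; first by rewrite cabs1 mulr1.
  by rewrite cabs0 mulr0 (le_trans (cabs_ge0 _) (be i x)).
- by move=> i x nV; rewrite indE memNset // mulr0.
- move=> v; have UV : ind V = fun x => ind U x * ind V x.
    apply/funext => x; rewrite !indE; case: ifPn => [/set_mem/VU Ux|]; last by rewrite mulr0.
    by rewrite mem_set // mulr1.
  have indC := (CcX_ind R coU, CcX_ind R coV).
  rewrite [in LHS]UV; under eq_bigr do rewrite (pi0M _ indC.1 indC.2).
  by rewrite bE; apply: eq_bigr => i _; rewrite (pi0M _ (bC i) indC.2).
Qed.

Lemma small_onU e U V : compact_open U -> compact_open V -> U `&` V = set0 ->
  small_on e U -> small_on e V -> small_on e (U `|` V).
Proof.
move=> coU coV UV [b [bC be bU bE]] [b' [b'C b'e b'V b'E]].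
have b0 i x : b i x = 0 \/ b' i x = 0.
  have [Ux|nUx] := pselect (U x); last by left; exact: bU.
  right; apply: b'V => Vx; have : (U `&` V) x by [].
  by rewrite UV.
exists (fun i x => b i x + b' i x); split.
- by move=> i; exact: CcXD.
- by move=> i x; have [->|->] := b0 i x; rewrite ?add0r ?addr0.
- by move=> i x nUV; rewrite bU ?b'V ?addr0 // => ?; apply: nUV; [right|left].
- move=> v; have -> : ind (U `|` V) = fun x => ind U x + ind V x.
    apply/funext => x; rewrite !indE in_setU.
    case: (boolP (x \in U)) => Ux; case: (boolP (x \in V)) => Vx;
      rewrite ?addr0 ?add0r //.
    have : (U `&` V) x by split; exact: set_mem.
    by rewrite UV.
  have iU := CcX_ind R coU; have iV := CcX_ind R coV.
  under eq_bigr do rewrite (pi0D _ iU iV) (linD (rep_bop _).1) scalerDr.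
  rewrite big_split bE b'E -big_split; apply: eq_bigr => i _ /=.
  by rewrite pi0D // (linD (rep_bop _).1).
Qed.

Lemma small_on_local e x : 0 < e -> exists V, [/\ compact_open V, V x & small_on e V].
Proof.
move=> e0; have [r [g [gC gx gE]]] := Delta_local_cancellation cD x.
pose B k y := \sum_(i | r i == k) c i * g i y.
have BC k : CcX (B k).
  rewrite /B; under eq_fun do rewrite big_mkcond.
  apply: CcX_sum => i; case: (r i == k); first exact: CcXZ.
  exact: CcX0.
have nbB : nbhs x [set y | forall k, cabs (B k y) < e].
  apply: filter_forall => k; have Bx : B k @ x --> B k x := (BC k).1 x.
  have /cabs_cvgP/(_ e e0) := Bx.
  by rewrite /B gx; apply: filterS => y; rewrite sub0r cabsN.
(* The germ relation as an identity of operators: on small [V], [s i] acts as [s (r i)] after [g i],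
   and both sides vanish if [x] is outside the domain of [s i]. *)
have /choice[W WP] : forall i, exists W, nbhs x W /\
    forall V, compact_open V -> V `<=` W -> forall v,
    pi (s i) (pi0 (ind V) v) = pi (s (r i)) (pi0 (fun y => g i y * ind V y) v).
  move=> i.
  have [[g0 nsx]|[a [b [ab ax gab]]]] := gE i.
    exists (~` sdom (s i)); split.
      exact: compact_open_nbhs_out (sdom_compact_open E (s i)) nsx.
    move=> V coV VW v.
    have -> : (fun y => g i y * ind V y) = fun=> 0 by apply/funext => y; rewrite g0 mul0r.
    rewrite pi0_0 (lin0 (rep_bop _).1) -(pi0_torus (torus_ind R coV)) -(mul_one E (s i)).
    rewrite -rep_mul -mulgA -tbis_injM rep_mul pi0_torus.
    have -> : (torus_mul (one (s i)) (torus_ind R coV) : X -> C) = fun=> 0.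
      apply/funext => y; rewrite torus_mulE [X in _ * X]torus_indE.
      case: ifPn => [/set_mem/VW nsy|_]; last by rewrite mulr0.
      by rewrite (torus_indF R (sdom_compact_open E (s i)) nsy) mul0r.
    by rewrite pi0_0 (lin0 (rep_bop _).1).
  exists (supp a); split.
    apply: open_nbhs_nbhs; split; last exact/suppP.
    by case: (torus_fun_supp a).
  move=> V coV VW v; rewrite -(pi0_torus (torus_ind R coV)) -rep_mul.
  (* [a] times its conjugate is 1 on [V], so the indicator of [V] factors as [a] times [tV], and the
     relation of [s i] with [s (r i)] applies to the factor [a]. *)
  pose tV := torus_mul (torus_conj a) (torus_ind R coV).
  have -> : torus_ind R coV = torus_mul a tV.
    apply: torus_fun_eq => y; rewrite !torus_mulE torus_conjE torus_indE mulrA.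
    by case: ifPn => [/set_mem/VW/suppP/torus_mulJ ->|_]; rewrite ?mulr1 ?mulr0.
  rewrite tbis_injM mulgA ab -mulgA -tbis_injM rep_mul pi0_torus.
  congr (pi _ (pi0 _ v)); apply/funext => y.
  by rewrite !torus_mulE torus_conjE gab mulrA.
have nbW : nbhs x [set y | forall i, W i y].
  by apply: filter_forall => i; case: (WP i).
have [V [coV Vx VB]] := compact_open_nbhs (filterI nbB nbW).
exists V; split=> //; exists (fun k y => B k y * ind V y); split.
- by move=> k; apply: CcXMr => //; exact: (CcX_ind R coV).1.
- move=> k y; rewrite cabsM indE; case: ifPn => [/set_mem/VB[/(_ k) /ltW Be _]|_].
    by rewrite cabs1 mulr1.
  by rewrite cabs0 mulr0 ltW.
- by move=> k y nV; rewrite indE memNset // mulr0.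
move=> v.
have step i : pi (s i) (pi0 (ind V) v) = pi (s (r i)) (pi0 (fun y => g i y * ind V y) v).
  by apply: (WP i).2 => // y /VB[_]; apply.
under eq_bigr do rewrite step.
rewrite (partition_big r xpredT) //=; apply: eq_bigr => k _.
have -> : (fun y => B k y * ind V y) = fun y => \sum_(i | r i == k) c i * (g i y * ind V y).
  by apply/funext => y; rewrite /B mulr_suml; apply: eq_bigr => i _; rewrite mulrA.
have gCV i : CcX (fun y => g i y * ind V y).
  by apply: CcXMr => //; exact: (CcX_ind R coV).1.
rewrite pi0_sum; last by move=> i; exact: CcXZ.
rewrite (_ : pi (s k) _ =
  \sum_(i | r i == k) pi (s k) (pi0 (fun y => c i * (g i y * ind V y)) v)).
  apply: eq_bigr => i /eqP <-; by rewrite pi0Z // (linZ (rep_bop _).1).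
apply: (big_morph (pi (s k))); first exact: linD (rep_bop _).1.
exact: lin0 (rep_bop _).1.
Qed.

Lemma rep_lincomb_eq0 v : \sum_i c i *: pi (s i) v = 0.
Proof.
apply: rn_small => d d0.
(* Each of the [n] terms is bounded by [2 * e * realnorm v] with [e = d / m]; the last [1] keeps [m]
   positive when [n = 0]. *)
pose m : R := 2 * (n%:R * (realnorm v + 1)) + 1.
have nv : 0 <= n%:R * (realnorm v + 1) by rewrite mulr_ge0 // addr_ge0 // rn_ge0.
have m0 : 0 < m by rewrite /m; lra.
pose e := d / m; have e0 : 0 < e by rewrite divr_gt0.
pose U := \big[setU/set0]_(i < n) sdom (s i).
have coU : compact_open U.
  rewrite /U; elim/big_ind: _ => [|V W|i _]; first exact: compact_open0.
    exact: compact_openU.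
  exact: sdom_compact_open.
have : small_on e U.
  apply: compact_open_ind coU; first exact: small_on0.
  - exact: small_onS.
  - exact: small_onU.
  - by move=> x; exact: small_on_local.
move=> [b [bC be bU bE]].
(* [U] contains all the domains, so [pi0 (ind U)] is a right unit for every [pi (s i)] and smallness
   on [U] concerns the whole operator. *)
have full i : pi (s i) (pi0 (ind U) v) = pi (s i) v.
  rewrite -(pi0_torus (torus_ind R coU)) -rep_mul -[in LHS](mul_one E (s i)) -mulgA -tbis_injM.
  have -> : torus_mul (one (s i)) (torus_ind R coU) = one (s i).
    apply: torus_fun_eq => y; rewrite torus_mulE.
    have [sy|nsy] := pselect (sdom (s i) y); last first.
      by rewrite (torus_indF R (sdom_compact_open E (s i)) nsy) mul0r.
    rewrite (torus_indT R coU) ?mulr1 //.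
    by rewrite /U (bigD1 i) //=; left.
  by rewrite mul_one.
have := bE v; under eq_bigr do rewrite full.
move=> ->; apply: le_trans (rn_sum (b := fun=> 2 * e * realnorm v) _) _.
  move=> i; apply: le_trans (rep_contract _ _) _.
  by apply: pi0_bound => //; exact: be.
rewrite sumr_const card_ord -mulr_natl.
have em : e * m = d by rewrite /e divfK // gt_eqF.
rewrite -em [leLHS](_ : _ = e * (2 * (n%:R * realnorm v))); last by ring.
by rewrite ler_pM2l // /m; have := rn_ge0 v; have : 0 <= n%:R :> R by []; nra.
Qed.
End WellDefined.
End Representation.

(** * The *-homomorphism associated with a representation *)

Section Extension.
Variable R : realType.
Local Notation C := (Cplx R).

(** Errors need only be bounded by a multiple of [e]; the restriction [e <= 1] lets quadratic errors
    be absorbed, as for products in [C0_mapM]. *)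
Lemma rn_small_scaled (V : normedModType C) (v : V) (M : R) :
  (forall e : R, 0 < e -> e <= 1 -> realnorm v <= M * e) -> v = 0.
Proof.
move=> vM; apply: rn_small => d d0.
pose m := `|M| + 1; have m0 : 0 < m by rewrite ltr_wpDl.
pose e := Num.min 1 (d / m).
have e0 : 0 < e by rewrite lt_min ltr01 divr_gt0.
have e1 : e <= 1 by rewrite ge_min lexx.
have ed : e <= d / m by rewrite ge_min lexx orbT.
rewrite ler_pdivlMr // in ed; apply: le_trans (vM e e0 e1) _; apply: le_trans ed.
by rewrite mulrC ler_pM2l // (le_trans (ler_norm M)) // lerDl.
Qed.

(* [near e t] reads: [t] is an approximation, with error at most [e], of the
   point at which the map [l] is to be extended. *)
Lemma extend_dense (T : Type) (V : completeNormedModType C) (near : R -> T -> Prop)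
    (l : T -> V) (M : R) :
  (forall e, 0 < e -> exists t, near e t) ->
  (forall e d t t', 0 < e -> 0 < d -> near e t -> near d t' ->
    realnorm (l t - l t') <= M * (e + d)) -> 0 <= M ->
  exists w, forall e t, 0 < e -> near e t -> realnorm (w - l t) <= M * e.
Proof.
move=> ex lM M0; have pos n : 0 < (n.+1%:R : R)^-1 by rewrite invr_gt0 ltr0n.
have /choice[t tn] : forall n, exists t, near (n.+1%:R)^-1 t by move=> n; exact: ex.
have [n m nm|d d0|w wl] := @rn_seq_cvg R V (l \o t) (fun n => M * ((n.+1%:R)^-1 * 2)).
- apply: le_trans (lM _ _ _ _ (pos n) (pos m) (tn n) (tn m)) _.
  apply: ler_wpM2l => //.
  have : (m.+1%:R : R)^-1 <= (n.+1%:R)^-1 by rewrite lef_pV2 ?posrE ?ltr0n // ler_nat.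
  by rewrite mulr_natr mulr2n lerD2l.
- exists (Num.bound (M * 2 / d)).
  rewrite mulrCA mulrC ltr_pdivrMr ?ltr0n // -ltr_pdivrMl // mulrC.
  apply: lt_le_trans (archi_boundP _) _; first by rewrite divr_ge0 ?mulr_ge0 // ltW.
  by rewrite ler_nat.
exists w => e u e0 ne; apply/ler_addgt0Pl => d d0.
(* With index [n], the limit contributes two units of [M / (n + 1)] and the comparison of [t n] with
   [u] a third; the [1] keeps [m] positive. *)
pose m := M * 3 + 1; have m0 : 0 < m by rewrite /m; lra.
have [n nd] : exists n, m / d < n.+1%:R.
  exists (Num.bound (m / d)); apply: lt_le_trans (archi_boundP _) _.
    by rewrite divr_ge0 // ltW.
  by rewrite ler_nat.
have {nd} : m * (n.+1%:R)^-1 < d.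
  by move: nd; rewrite ltr_pdivrMr // mulrC -ltr_pdivrMr ?ltr0n.
have := rn_dist (l (t n)) w (l u); have := wl n; rewrite /= (rnB (l (t n)) w).
have := lM _ _ _ _ (pos n) e0 (tn n) ne; have := pos n.
by rewrite /m; move: (n.+1%:R^-1) => p; lra.
Qed.

End Extension.

Section WeakCauchySchwarz.
Variables (R : realType) (K : hilbert R).

Lemma hdotZl (c : Cplx R) (u v : K) : hdot K (c *: u) v = c * hdot K u v.
Proof. exact: linearZl_LR. Qed.

Lemma hdotZr (c : Cplx R) (u v : K) : hdot K u (c *: v) = c^* * hdot K u v.
Proof. by rewrite -hdot_conj hdotZl rmorphM /= hdot_conj. Qed.

(** Scaling [u] by the inverse of [e] and turning [v] by a phase, positivity of the squared norm of
    the difference bounds twice the modulus of the product by the sum of the squares. This weak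
    Cauchy-Schwarz inequality is enough to pass to limits in adjoint relations. *)
Lemma hdot_small (u v : K) (e : R) : 0 < e -> realnorm u <= e ->
  cabs (hdot K u v) <= e * (1 + realnorm v ^+ 2).
Proof.
move=> e0 ue; have [->|h0] := eqVneq (hdot K u v) 0.
  rewrite cabs0; apply: mulr_ge0; first exact: ltW.
  by rewrite addr_ge0 // exprn_ge0 // rn_ge0.
pose u' := ofR e^-1 *: u; pose z := hdot K u' v.
have zE : z = ofR e^-1 * hdot K u v by rewrite /z hdotZl.
have cz : cabs z = e^-1 * cabs (hdot K u v) by rewrite zE cabsM cabs_ofR gtr0_norm ?invr_gt0.
have z0 : cabs z != 0.
  have hc : cabs (hdot K u v) != 0 by apply/eqP => /cabs_eq0/eqP; exact/negP.
  by rewrite cz mulf_neq0 // invr_neq0 // gt_eqF.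
have zz : ofR (cabs z)^-1 * z * z^* = ofR (cabs z).
  rewrite -mulrA -normCK normE expr2 -!ofRM; congr ofR.
  by rewrite mulKf.
pose w := (ofR (cabs z)^-1 * z) *: v.
have uw : hdot K u' w = ofR (cabs z).
  rewrite hdotZr -/z rmorphM /= ofR_conj -zz -!mulrA; congr (_ * _).
  by rewrite mulrC.
have rw : realnorm w = realnorm v.
  by rewrite rnZ cabsM cabs_ofR normfV ger0_norm ?cabs_ge0 // mulVf // mul1r.
have ru : realnorm u' <= 1.
  by rewrite rnZ cabs_ofR gtr0_norm ?invr_gt0 // mulrC ler_pdivrMr // mul1r.
have := hdot_ge0 (u' - w).
rewrite linearBl !linearBr /= -(hdot_conj u' w) uw ofR_conj !hdotE !normvE rw.
rewrite !expr2 -!ofRM -!(rmorphB (real_complex R)) => H.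
have {H} : 0 <= realnorm u' * realnorm u' - cabs z - (cabs z - realnorm v * realnorm v).
  by rewrite -ofR_le.
move=> H; rewrite -ler_pdivrMl // -cz.
have := rn_ge0 u'; have := rn_ge0 v; nra.
Qed.

End WeakCauchySchwarz.

(** * The integrated homomorphism, its extension and its uniqueness *)

Section Integration.
Variables (R : realType) (X : booleanSpaceType) (G S : invSemigroupType).
Variables (E : twisted_boolean R X G S) (A : full_cstar E).
Local Notation C := (Cplx R).
Local Notation TF := (torus_fun R X).
Local Notation j := (tbis_inj E).
Local Notation iota := (full_inj A).
Local Notation lcomb := (@lincomb R X G S E).
Implicit Types (f g : twist E -> C) (l : seq (C * S)) (s t : S).

Lemma CcGSP f : CcGS E f <-> exists l, f = lcomb l.
Proof. by split=> [/lincomb_CcGS //|[l ->]]; exact: CcGS_lincomb. Qed.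

Lemma CcGSD f g : CcGS E f -> CcGS E g -> CcGS E (f + g).
Proof.
by move=> /CcGSP[l ->] /CcGSP[l' ->]; apply/CcGSP; exists (l ++ l'); rewrite lincomb_cat.
Qed.

Lemma CcGSZ (c : C) f : CcGS E f -> CcGS E (c *: f).
Proof.
by move=> /CcGSP[l ->]; apply/CcGSP; exists (lincomb_scale c l); rewrite lincomb_scaleE.
Qed.

Lemma CcGSB f g : CcGS E f -> CcGS E g -> CcGS E (f - g).
Proof. by move=> fC gC; rewrite -scaleN1r; apply: CcGSD => //; exact: CcGSZ. Qed.

Lemma CcGS_Delta s : CcGS E (Delta E s).
Proof.
apply/CcGSP; exists [:: (1, s)]; rewrite lincomb1.
by apply/funext => sigma; rewrite mul1r.
Qed.

Lemma CcGSM f g : CcGS E f -> CcGS E g -> CcGS E (convolution E f g).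
Proof.
move=> /CcGSP[l ->] /CcGSP[l' ->]; apply/CcGSP.
by exists (lincomb_mul l l'); rewrite convolution_lincomb.
Qed.

Lemma CcGS_star f : CcGS E f -> CcGS E (twist_star E f).
Proof.
by move=> /CcGSP[l ->]; apply/CcGSP; exists (lincomb_star l); rewrite twist_star_lincomb.
Qed.

Lemma iotaD f g : CcGS E f -> CcGS E g -> iota (f + g) = iota f + iota g.
Proof. exact: (star_homD (full_inj_hom A)). Qed.

Lemma iotaZ c f : CcGS E f -> iota (c *: f) = c *: iota f.
Proof. exact: (star_homZ (full_inj_hom A)). Qed.

Lemma iotaB f g : CcGS E f -> CcGS E g -> iota (f - g) = iota f - iota g.
Proof.
move=> fC gC; rewrite -[in LHS]scaleN1r (iotaD fC (CcGSZ _ gC)).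
by rewrite (iotaZ _ gC) scaleN1r.
Qed.

Lemma iotaM f g : CcGS E f -> CcGS E g ->
  iota (convolution E f g) = cs_mul A (iota f) (iota g).
Proof. exact: (star_homM (full_inj_hom A)). Qed.

Lemma iota_star f : CcGS E f -> iota (twist_star E f) = cs_star (iota f).
Proof. by move=> fC; apply: (star_hom_star (full_inj_hom A) fC) => //; exact: CcGS_star. Qed.

Lemma iota_lincomb l : iota (lcomb l) = \sum_(q <- l) q.1 *: iota (Delta E q.2).
Proof.
elim: l => [|q l IH].
  have -> : lcomb [::] = 0 *: (Delta E izero : twist E -> C).
    by rewrite scale0r; apply/funext => sigma; rewrite /lincomb big_nil.
  by rewrite big_nil iotaZ ?scale0r //; exact: CcGS_Delta.
rewrite big_cons -IH -iotaZ; last exact: CcGS_Delta.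
rewrite -iotaD; [|by apply: CcGSZ; exact: CcGS_Delta|by apply/CcGSP; exists l].
by congr iota; apply/funext => sigma; rewrite /lincomb big_cons.
Qed.

Lemma iota_dense (a : A) (e : R) : 0 < e ->
  exists f, CcGS E f /\ realnorm (a - iota f) <= e.
Proof.
move=> e0; have : closure (iota @` CcGS E) a by rewrite full_inj_dense.
have nb : nbhs a (ball a (ofR e)) by apply: nbhsx_ballx; rewrite ofR_lt.
move=> /(_ _ nb)[_ [[f fC <-]]]; rewrite -ball_normE /= normvE ofR_lt => /ltW af.
by exists f.
Qed.

Section Representation.
Variables (K : hilbert R) (pi : S -> bounded_operators K).
Hypothesis rep : is_representation E pi.
Implicit Types (v w : K).

Definition rep_lincomb l : bounded_operators K :=
  fun v => \sum_(q <- l) q.1 *: pi q.2 v.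

Lemma rep_lincomb_bop l : bop (rep_lincomb l).
Proof.
elim: l => [|q l IH].
  have -> : rep_lincomb [::] = fun=> 0 by apply/funext => v; rewrite /rep_lincomb big_nil.
  exact: bop0.
have -> : rep_lincomb (q :: l) = (q.1 *: (pi q.2 : K -> K)) + (rep_lincomb l : K -> K).
  by apply/funext => v; rewrite /rep_lincomb big_cons.
by apply: bopD => //; apply: bopZ; exact: rep_bop rep _.
Qed.

Lemma rep_lincomb_cat l l' v :
  rep_lincomb (l ++ l') v = rep_lincomb l v + rep_lincomb l' v.
Proof. by rewrite /rep_lincomb big_cat. Qed.

Lemma rep_lincomb_scale c l v :
  rep_lincomb (lincomb_scale c l) v = c *: rep_lincomb l v.
Proof.
rewrite /rep_lincomb /lincomb_scale big_map scaler_sumr.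
by apply: eq_bigr => q _; rewrite scalerA.
Qed.

Lemma rep_lincomb_mul l l' v :
  rep_lincomb (lincomb_mul l l') v = rep_lincomb l (rep_lincomb l' v).
Proof.
rewrite /rep_lincomb /lincomb_mul big_allpairs_dep /=; apply: eq_bigr => q _.
rewrite (big_morph (pi q.2) (linD (rep_bop rep _).1) (lin0 (rep_bop rep _).1)).
rewrite scaler_sumr; apply: eq_bigr => q' _.
by rewrite (rep_mul rep) (linZ (rep_bop rep _).1) scalerA.
Qed.

Lemma rep_lincomb_star l : is_adjoint (rep_lincomb l) (rep_lincomb (lincomb_star l)).
Proof.
move=> x y; rewrite /rep_lincomb /lincomb_star big_map.
rewrite (big_morph (fun u => hdot K u y) (id1 := 0) (op1 := +%R)); last first.
- exact: linear0l.
- by move=> u v; exact: linearDl.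
rewrite [RHS](big_morph (hdot K x) (id1 := 0) (op1 := +%R)); last first.
- exact: linear0r.
- by move=> u v; exact: linearDr.
by apply: eq_bigr => q _ /=; rewrite hdotZl hdotZr conjCK (rep_adj rep).
Qed.

Lemma rep_lincomb_wd l l' : lcomb l = lcomb l' -> rep_lincomb l = rep_lincomb l'.
Proof.
move=> ll; have [pi0 [pi0_hom _ pi0_torus]] := rep_torus rep.
pose m := l ++ lincomb_scale (-1) l'.
have m0 sigma : lcomb m sigma = 0.
  by rewrite lincomb_cat lincomb_scaleE ll mulN1r subrr.
apply/funext => v; apply/subr0_eq.
have <- : rep_lincomb m v = rep_lincomb l v - rep_lincomb l' v.
  by rewrite rep_lincomb_cat rep_lincomb_scale scaleN1r.
rewrite /rep_lincomb big_tnth.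
apply: (rep_lincomb_eq0 rep pi0_hom pi0_torus (c := fun i => (tnth (in_tuple m) i).1)
  (s := fun i => (tnth (in_tuple m) i).2)).
by move=> sigma; rewrite -[RHS](m0 sigma) /lincomb [RHS]big_tnth.
Qed.

(** By [rep_lincomb_wd] the chosen list does not matter; outside [CcGS] the empty list gives the
    zero operator. *)
Definition integrated f : bounded_operators K :=
  rep_lincomb (xget [::] [set l | f = lcomb l]).

Lemma integrated_lincomb l : integrated (lcomb l) = rep_lincomb l.
Proof.
rewrite /integrated; case: xgetP => [l' -> /= /esym/rep_lincomb_wd //|/(_ l)].
by case.
Qed.

Lemma integrated_hom :
  @star_hom R (convolution_alg E) (bounded_operators K) integrated.
Proof.
split.
- by move=> f /CcGSP[l ->]; rewrite integrated_lincomb; exact: rep_lincomb_bop.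
- move=> f g /CcGSP[l ->] /CcGSP[l' ->].
  rewrite -[X in integrated X]/(fun sigma => lcomb l sigma + lcomb l' sigma).
  rewrite -lincomb_cat !integrated_lincomb; apply/funext => v.
  exact: rep_lincomb_cat.
- move=> c f /CcGSP[l ->].
  rewrite -[X in integrated X]/(fun sigma => c * lcomb l sigma).
  rewrite -lincomb_scaleE !integrated_lincomb; apply/funext => v.
  exact: rep_lincomb_scale.
- move=> f g /CcGSP[l ->] /CcGSP[l' ->] /=.
  rewrite convolution_lincomb !integrated_lincomb; apply/funext => v.
  exact: rep_lincomb_mul.
- move=> f g /CcGSP[l ->] _ /= ->; rewrite twist_star_lincomb !integrated_lincomb.
  exact: rep_lincomb_star.
Qed.

Lemma integrated_bop f : CcGS E f -> bop (integrated f).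
Proof. exact: (star_hom_in integrated_hom). Qed.

Lemma integratedB f g v : CcGS E f -> CcGS E g ->
  integrated (f - g) v = integrated f v - integrated g v.
Proof.
move=> fC gC; rewrite -[in LHS]scaleN1r (star_homD integrated_hom fC (CcGSZ _ gC)).
rewrite (star_homZ integrated_hom _ gC).
by rewrite -[LHS]/(integrated f v + -1 *: integrated g v) scaleN1r.
Qed.

Lemma integrated_bound f v : CcGS E f ->
  realnorm (integrated f v) <= realnorm (iota f) * realnorm v.
Proof.
move=> fC; apply: le_trans (opnorm_le v (integrated_bop fC)) _.
apply: ler_wpM2r; first exact: rn_ge0.
rewrite -lee_fin (full_injE A fC) /full_norm; apply: ereal_sup_ubound.
by exists K, integrated; split => //; exact: integrated_hom.
Qed.

Definition approx (a : A) (e : R) f := CcGS E f /\ realnorm (a - iota f) <= e.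

(** The extension is made one vector at a time, so that completeness is asked of [K] and not of the
    space of operators. *)
Lemma extension_ex (a : A) v : exists w, forall e f, 0 < e -> approx a e f ->
  realnorm (w - integrated f v) <= realnorm v * e.
Proof.
apply: extend_dense; [exact: iota_dense| |exact: rn_ge0].
move=> e d f g e0 d0 [fC fe] [gC gd].
rewrite -integratedB // mulrC; apply: le_trans (integrated_bound _ _) _; first exact: CcGSB.
apply: ler_wpM2r; first exact: rn_ge0.
rewrite iotaB //; apply: le_trans (rn_dist a _ _) _.
by rewrite rnB; exact: lerD.
Qed.

Definition extension (a : A) : bounded_operators K :=
  fun v => projT1 (cid (extension_ex a v)).

Lemma extensionP (a : A) e f v : 0 < e -> approx a e f ->
  realnorm (extension a v - integrated f v) <= realnorm v * e.
Proof. by rewrite /extension; case: cid => w wP /=; exact: wP. Qed.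

Lemma extension_iota f : CcGS E f -> extension (iota f) = integrated f.
Proof.
move=> fC; apply/funext => v; apply/subr0_eq.
apply: (rn_small_scaled (M := realnorm v)) => e e0 _.
by apply: extensionP => //; split => //; rewrite subrr rn0 ltW.
Qed.

Lemma extension_bound a v : realnorm (extension a v) <= realnorm a * realnorm v.
Proof.
apply/ler_addgt0Pl => d d0; have v1 : 0 < 2 * realnorm v + 1 by have := rn_ge0 v; lra.
(* The error [e] occurs twice with weight [realnorm v]: once in [extensionP], once in the norm of
   [iota f]. *)
pose e := d / (2 * realnorm v + 1); have e0 : 0 < e by rewrite divr_gt0.
have ed : e * (2 * realnorm v + 1) = d by rewrite /e divfK // gt_eqF.
have [f [fC fa]] := iota_dense a e0.
have := extensionP v e0 (conj fC fa); have := integrated_bound v fC.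
have := rnD (extension a v - integrated f v) (integrated f v); rewrite subrK.
have := rnD (iota f - a) a; rewrite subrK (rnB _ a); have := rn_ge0 v; nra.
Qed.

Lemma extensionD a b v : extension (a + b) v = extension a v + extension b v.
Proof.
apply/subr0_eq; apply: (rn_small_scaled (M := 4 * realnorm v)) => e e0 _.
have [f [fC fa]] := iota_dense a e0; have [g [gC gb]] := iota_dense b e0.
have e2 : 0 < 2 * e by rewrite mulr_gt0.
have fg : approx (a + b) (2 * e) (f + g).
  split; first exact: CcGSD.
  by rewrite iotaD // opprD addrACA; have := rnD (a - iota f) (b - iota g); lra.
have := extensionP v e2 fg; rewrite (star_homD integrated_hom) //.
have := extensionP v e0 (conj fC fa); have := extensionP v e0 (conj gC gb).
set x := extension a v; set y := extension b v; set z := extension (a + b) v.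
set x' := integrated f v; set y' := integrated g v => yy xx zz.
have -> : z - (x + y) = (z - (x' + y')) - ((x - x') + (y - y')).
  by rewrite addrACA -opprD opprB addrA subrK.
have := rnD (z - (x' + y')) (- ((x - x') + (y - y'))); rewrite rnN.
have := rnD (x - x') (y - y'); move: zz.
rewrite -[(integrated f + integrated g) v]/(x' + y'); lra.
Qed.

Lemma extensionZ c a v : extension (c *: a) v = c *: extension a v.
Proof.
apply/subr0_eq; apply: (rn_small_scaled (M := (2 * cabs c + 1) * realnorm v)) => e e0 _.
have [f [fC fa]] := iota_dense a e0; have c0 := cabs_ge0 c.
have e2 : 0 < (cabs c + 1) * e by rewrite mulr_gt0 // ltr_wpDl.
have fg : approx (c *: a) ((cabs c + 1) * e) (c *: f).
  split; first exact: CcGSZ.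
  by rewrite iotaZ // -scalerBr rnZ ler_pM // ?rn_ge0 // lerDl.
have := extensionP v e2 fg; rewrite (star_homZ integrated_hom) //.
have := extensionP v e0 (conj fC fa).
set x := extension a v; set z := extension (c *: a) v.
set x' := integrated f v => xx zz.
have := rn_dist (c *: x') z (c *: x); rewrite -(scalerBr c x') rnZ (rnB x').
move: zz; rewrite -[(c *: integrated f) v]/(c *: x'); have := rn_ge0 v; nra.
Qed.

Lemma extensionB a b v : extension (a - b) v = extension a v - extension b v.
Proof. by rewrite -scaleN1r extensionD extensionZ scaleN1r. Qed.

Lemma extension_bop a : bop (extension a).
Proof.
have lin : linear (extension a).
  move=> c v w; apply/subr0_eq.
  pose M := realnorm (c *: v + w) + cabs c * realnorm v + realnorm w.
  apply: (rn_small_scaled (M := M)) => e e0 _; rewrite /M.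
  have [f [fC fa]] := iota_dense a e0; have [fl _] := integrated_bop fC.
  have := extensionP (c *: v + w) e0 (conj fC fa).
  have := extensionP v e0 (conj fC fa); have := extensionP w e0 (conj fC fa).
  rewrite (linD fl) (linZ fl).
  set x := extension a v; set y := extension a w; set z := extension a (c *: v + w).
  set x' := integrated f v; set y' := integrated f w => yy xx zz.
  have -> : z - (c *: x + y) = (z - (c *: x' + y')) - (c *: (x - x') + (y - y')).
    by rewrite scalerBr addrACA -opprD opprB addrA subrK.
  have := rnD (z - (c *: x' + y')) (- (c *: (x - x') + (y - y'))); rewrite rnN.
  have := rnD (c *: (x - x')) (y - y'); rewrite rnZ; have := cabs_ge0 c; nra.
by split => //; apply: (bound_continuous (M := realnorm a)) => // v; exact: extension_bound.
Qed.

(** One factor is approximated at a time, [b] with [f] fixed and then [a] with [b] fixed, so that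
    errors are never multiplied together. *)
Lemma extensionM a b v : extension (cs_mul A a b) v = extension a (extension b v).
Proof.
have ext1 f : CcGS E f -> extension (cs_mul A (iota f) b) v = integrated f (extension b v).
  move=> fC; apply/subr0_eq.
  apply: (rn_small_scaled (M := 2 * realnorm (iota f) * realnorm v)) => e e0 _.
  have [g [gC gb]] := iota_dense b e0; have [fl _] := integrated_bop fC.
  have MM : extension (cs_mul A (iota f) (iota g)) v = integrated f (integrated g v).
    rewrite -iotaM // extension_iota; last exact: CcGSM.
    by rewrite (star_homM integrated_hom fC gC).
  apply: le_trans (rn_dist (integrated f (integrated g v)) _ _) _.
  rewrite -{1}MM -extensionB -cs_mulBr -(linB fl).
  have := integrated_bound (integrated g v - extension b v) fC.
  have := extensionP v e0 (conj gC gb); rewrite (rnB (integrated g v)).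
  have := extension_bound (cs_mul A (iota f) (b - iota g)) v.
  have := cs_rnM (iota f) (b - iota g); have := rn_ge0 v; have := rn_ge0 (iota f).
  have := rn_ge0 (b - iota g); move=> p1 p2 p3 q1 q2 q3 q4.
  have : realnorm (cs_mul A (iota f) (b - iota g)) * realnorm v <=
      realnorm (iota f) * e * realnorm v.
    by apply: ler_wpM2r => //; apply: le_trans q1 _; exact: ler_wpM2l.
  have : realnorm (iota f) * realnorm (extension b v - integrated g v) <=
      realnorm (iota f) * (realnorm v * e).
    exact: ler_wpM2l.
  lra.
apply/subr0_eq.
apply: (rn_small_scaled (M := realnorm b * realnorm v + realnorm (extension b v))) => e e0 _.
have [f [fC fa]] := iota_dense a e0.
apply: le_trans (rn_dist (integrated f (extension b v)) _ _) _.
rewrite -{1}ext1 // -extensionB -cs_mulBl (rnB (integrated f _)).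
have := extensionP (extension b v) e0 (conj fC fa).
have := extension_bound (cs_mul A (a - iota f) b) v.
have := cs_rnM (a - iota f) b; have := rn_ge0 v; have := rn_ge0 b => p1 p2 q1 q2 q3.
have : realnorm (cs_mul A (a - iota f) b) * realnorm v <= e * realnorm b * realnorm v.
  by apply: ler_wpM2r => //; apply: le_trans q1 _; exact: ler_wpM2r.
lra.
Qed.

Lemma extension_star a : is_adjoint (extension a) (extension (cs_star a)).
Proof.
move=> x y; apply/subr0_eq/cabs_eq0/eqP; rewrite eq_le cabs_ge0 andbT.
apply/ler_addgt0Pl => d d0; rewrite addr0.
pose m := (1 + realnorm x) * (1 + realnorm y ^+ 2) + (1 + realnorm y) * (1 + realnorm x ^+ 2).
have rx := rn_ge0 x; have ry := rn_ge0 y.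
have m0 : 0 < m by rewrite /m; nra.
pose e := d / m; have e0 : 0 < e by rewrite divr_gt0.
have em : e * m = d by rewrite /e divfK // gt_eqF.
have [f [fC fa]] := iota_dense a e0.
have fa' : approx (cs_star a) e (twist_star E f).
  by split; [exact: CcGS_star|rewrite iota_star // -cs_starB cs_rn_star].
have adj : is_adjoint (integrated f) (integrated (twist_star E f)).
  by apply: (star_hom_star integrated_hom fC) => //; exact: CcGS_star.
have := extensionP x e0 (conj fC fa); have := extensionP y e0 fa'.
set u := extension a x; set w := extension (cs_star a) y.
set u' := integrated f x; set w' := integrated (twist_star E f) y => ww uu.
have -> : hdot K u y - hdot K x w = hdot K (u - u') y - (hdot K (w - w') x)^*.
  by rewrite hdot_conj linearBl linearBr /= adj opprB addrA subrK.
have := cabsD (hdot K (u - u') y) (- (hdot K (w - w') x)^*); rewrite cabsN cabsJ.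
(* The added [1] keeps the error positive, as [hdot_small] requires, when the vector is 0. *)
have e1 : 0 < (1 + realnorm x) * e by rewrite mulr_gt0 // ltr_wpDr.
have e2 : 0 < (1 + realnorm y) * e by rewrite mulr_gt0 // ltr_wpDr.
have u1 : realnorm (u - u') <= (1 + realnorm x) * e by lra.
have w1 : realnorm (w - w') <= (1 + realnorm y) * e by lra.
have := hdot_small y e1 u1; have := hdot_small x e2 w1.
rewrite -em /m; lra.
Qed.

Lemma extension_hom : star_hom extension.
Proof.
split.
- by move=> a _; exact: extension_bop.
- by move=> a b _ _; apply/funext => v; exact: extensionD.
- by move=> c a _; apply/funext => v; exact: extensionZ.
- by move=> a b _ _; apply/funext => v; exact: extensionM.
- by move=> a _ _ _ ->; exact: extension_star.
Qed.

Lemma extension_Delta s : extension (iota (Delta E s)) = pi s.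
Proof.
rewrite extension_iota; last exact: CcGS_Delta.
have -> : Delta E s = lcomb [:: (1, s)].
  by rewrite lincomb1; apply/funext => sigma; rewrite mul1r.
rewrite integrated_lincomb; apply/funext => v.
by rewrite /rep_lincomb big_seq1 scale1r.
Qed.

End Representation.

Lemma star_hom_determined (K : hilbert R) (rho rho' : A -> bounded_operators K) :
  star_hom rho -> star_hom rho' ->
  (forall s, rho (iota (Delta E s)) = rho' (iota (Delta E s))) -> rho = rho'.
Proof.
move=> hom hom' eqD.
have linE (r : A -> bounded_operators K) : star_hom r -> forall l v,
    r (iota (lcomb l)) v = \sum_(q <- l) q.1 *: r (iota (Delta E q.2)) v.
  move=> rh l v; rewrite iota_lincomb.
  have r0 : r 0 v = 0.
    have -> : (0 : A) = 0 *: 0 by rewrite scale0r.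
    by rewrite (star_homZ rh) // -[LHS]/(0 *: r 0 v) scale0r.
  elim: l => [|q l IH]; first by rewrite !big_nil.
  rewrite !big_cons (star_homD rh) // (star_homZ rh) // -IH.
  by [].
have rB (r : A -> bounded_operators K) : star_hom r ->
    forall a b v, r (a - b) v = r a v - r b v.
  move=> rh a b v; rewrite -scaleN1r (star_homD rh) // (star_homZ rh) //.
  by rewrite -[LHS]/(r a v + -1 *: r b v) scaleN1r.
apply/funext => a; apply/funext => v; apply/subr0_eq.
apply: (rn_small_scaled (M := 2 * realnorm v)) => e e0 _.
have [f [/CcGSP[l ->] fa]] := iota_dense a e0.
apply: le_trans (rn_dist (rho (iota (lcomb l)) v) _ _) _.
rewrite -(rB _ hom) (linE _ hom); under eq_bigr do rewrite eqD.
rewrite -(linE _ hom') -(rB _ hom').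
have := star_hom_contract hom (a - iota (lcomb l)) v.
have := star_hom_contract hom' (iota (lcomb l) - a) v.
rewrite (rnB (iota _)); have := rn_ge0 v; nra.
Qed.

End Integration.

(** * The representation [s |-> Delta s] *)

Section UniversalRepresentation.
Variables (R : realType) (X : booleanSpaceType) (G S : invSemigroupType).
Variables (E : twisted_boolean R X G S) (A : full_cstar E).
Local Notation C := (Cplx R).
Local Notation TF := (torus_fun R X).
Local Notation j := (tbis_inj E).
Local Notation iota := (full_inj A).
Local Notation Delta := (Delta E).
Local Notation lcomb := (@lincomb R X G S E).
Local Notation ind V := (\1_V : X -> C).
Implicit Types (f g b : X -> C) (m : seq (C * TF)) (s t : S) (h k : TF).

(* [unit_Delta] is the value of [Delta e] at [sigma] for any idempotent [e] whose
   domain contains the source of [sigma]; it plays the role of the unit, and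
   [diagonal b] is the function on [Sigma] defined by [b] on the unit space. *)
Definition unit_Delta (sigma : twist E) : C := xget 0 [set z |
  exists V (coV : compact_open V), V (src sigma) /\ z = Delta (j (torus_ind R coV)) sigma].

Definition diagonal b : twist E -> C := fun sigma => unit_Delta sigma * b (src sigma).

Lemma diagonal_torus h : diagonal h = Delta (j h).
Proof.
apply/funext => sigma.
have ext V (coV : compact_open V) : V (src sigma) ->
    Delta (j h) sigma = Delta (j (torus_ind R coV)) sigma * h (src sigma).
  move=> Vx; rewrite -Delta_mul_torus tbis_inj_comm Delta_mul_torus.
  by rewrite torus_indT // mulr1.
rewrite /diagonal /unit_Delta; case: xgetP => [z -> /= [V [coV [Vx ->]]]|none].
  by rewrite -ext.
have [V coV Vx] := compact_open_point (src sigma).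
by case: (none (Delta (j (torus_ind R coV)) sigma)); exists V, coV.
Qed.

Definition torus_comb m : seq (C * S) := [seq (q.1, j q.2) | q <- m].

Definition span_fun m : X -> C := fun x => \sum_(q <- m) q.1 * q.2 x.

Lemma diagonal_span m : diagonal (span_fun m) = lcomb (torus_comb m).
Proof.
apply/funext => sigma; rewrite /diagonal /span_fun /lincomb big_map mulr_sumr.
by apply: eq_bigr => q _; rewrite -diagonal_torus mulrCA.
Qed.

Lemma CcX_span b : CcX b -> exists m, b = span_fun m.
Proof.
move=> bC; have [M M0 bM] := CcX_bounded bC.
have [h [k hk]] := CcX_torus_span bC M0 bM; pose c := ofR (M / 2).
exists [:: (c, h); (c, torus_conj h); (- 'i * c, k); (- 'i * c, torus_conj k)].
apply/funext => x; rewrite /span_fun !big_cons big_nil /= hk !torus_conjE -/c.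
ring.
Qed.

Lemma CcGS_diagonal b : CcX b -> CcGS E (diagonal b).
Proof. by move=> /CcX_span[m ->]; rewrite diagonal_span; exact: CcGS_lincomb. Qed.

Lemma diagonalD b b' : diagonal (fun x => b x + b' x) = diagonal b + diagonal b'.
Proof. by apply/funext => sigma; rewrite /diagonal mulrDr. Qed.

Lemma diagonalZ c b : diagonal (fun x => c * b x) = c *: diagonal b.
Proof. by apply/funext => sigma; rewrite /diagonal mulrCA. Qed.

Lemma diagonalM b b' : CcX b -> CcX b' ->
  convolution E (diagonal b) (diagonal b') = diagonal (fun x => b x * b' x).
Proof.
move=> /CcX_span[m ->] /CcX_span[m' ->].
rewrite !diagonal_span convolution_lincomb; apply/funext => sigma.
rewrite /lincomb /lincomb_mul /torus_comb big_allpairs_dep /diagonal /span_fun.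
rewrite big_map mulr_suml mulr_sumr; apply: eq_bigr => q _ /=.
rewrite big_map mulr_sumr mulr_sumr; apply: eq_bigr => q' _ /=.
rewrite -tbis_injM -diagonal_torus /diagonal torus_mulE; ring.
Qed.

Lemma diagonal_star b : CcX b -> twist_star E (diagonal b) = diagonal (fun x => (b x)^*).
Proof.
move=> /CcX_span[m ->]; rewrite diagonal_span twist_star_lincomb; apply/funext => sigma.
rewrite /lincomb /lincomb_star /torus_comb /diagonal /span_fun !big_map rmorph_sum mulr_sumr.
apply: eq_bigr => q _ /=; rewrite istar_inj -diagonal_torus /diagonal torus_conjE.
by rewrite rmorphM /= mulrCA.
Qed.

Lemma iota_Delta_star s : iota (Delta (istar s)) = cs_star (iota (Delta s)).
Proof. by rewrite -twist_star_Delta iota_star //; exact: CcGS_Delta. Qed.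

Lemma iota_Delta_mul s t : iota (Delta (s * t)%g) = cs_mul A (iota (Delta s)) (iota (Delta t)).
Proof. by rewrite -convolution_Delta iotaM //; exact: CcGS_Delta. Qed.

(** The image of an idempotent is a projection, whose norm equals its square; the general case is
    the C*-identity applied to [istar s * s]. *)
Lemma iota_Delta_le1 s : realnorm (iota (Delta s)) <= 1.
Proof.
have sq1 (r : R) : 0 <= r -> r ^+ 2 <= r -> r <= 1 by nra.
have proj e : idem e -> realnorm (iota (Delta e)) <= 1.
  move=> ee; apply: sq1; first exact: rn_ge0.
  by rewrite -cs_rnE -iota_Delta_star -iota_Delta_mul istar_idem // ee.
have := proj _ (dproj_idem s); rewrite iota_Delta_mul iota_Delta_star cs_rnE.
by have := rn_ge0 (iota (Delta s)); nra.
Qed.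

Definition iota_diagonal b : A := iota (diagonal b).
Local Notation idiag := iota_diagonal.

Lemma idiagD b b' : CcX b -> CcX b' -> idiag (fun x => b x + b' x) = idiag b + idiag b'.
Proof. by move=> bC b'C; rewrite /idiag diagonalD iotaD //; exact: CcGS_diagonal. Qed.

Lemma idiagZ c b : CcX b -> idiag (fun x => c * b x) = c *: idiag b.
Proof. by move=> bC; rewrite /idiag diagonalZ iotaZ //; exact: CcGS_diagonal. Qed.

Lemma idiagB b b' : CcX b -> CcX b' -> idiag (fun x => b x - b' x) = idiag b - idiag b'.
Proof.
move=> bC b'C; have -> : (fun x => b x - b' x) = (fun x => b x + (-1) * b' x).
  by apply/funext => x; rewrite mulN1r.
by rewrite idiagD ?idiagZ ?scaleN1r //; exact: CcXZ.
Qed.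

Lemma idiagM b b' : CcX b -> CcX b' ->
  idiag (fun x => b x * b' x) = cs_mul A (idiag b) (idiag b').
Proof. by move=> bC b'C; rewrite /idiag -diagonalM // iotaM //; exact: CcGS_diagonal. Qed.

Lemma idiag_star b : CcX b -> idiag (fun x => (b x)^*) = cs_star (idiag b).
Proof. by move=> bC; rewrite /idiag -diagonal_star // iota_star //; exact: CcGS_diagonal. Qed.

(** The counterpart of [pi0_bound] in [A]: it makes [idiag] continuous for the sup norm, whence the
    extension to C_0(X). *)
Lemma idiag_bound b (M : R) : CcX b -> 0 < M -> (forall x, cabs (b x) <= M) ->
  realnorm (idiag b) <= 2 * M.
Proof.
move=> bC M0 bM; have [h [k hk]] := CcX_torus_span bC M0 bM.
pose c : C := ofR (M / 2); pose tc := @torus_conj R X.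
have -> : b = fun x => (c * (h x + tc h x)) + (- 'i) * (c * (k x + tc k x)).
  by apply/funext => x; rewrite hk !torus_conjE mulNr.
have cT (k1 : TF) : CcX k1 by exact: CcX_torus.
rewrite !(idiagD, idiagZ); try by do ?[apply: CcXD|apply: CcXZ|apply: cT].
have le1 (k1 : TF) : realnorm (idiag k1) <= 1.
  by rewrite /idiag diagonal_torus; exact: iota_Delta_le1.
have half (k1 k2 : TF) : realnorm (c *: (idiag k1 + idiag k2)) <= M.
  rewrite rnZ cabs_ofR gtr0_norm ?divr_gt0 //.
  have := rnD (idiag k1) (idiag k2); have := le1 k1; have := le1 k2; nra.
apply: le_trans (rnD _ _) _; rewrite (rnZ (- 'i)) cabsN.
have -> : cabs 'i = 1 :> R by rewrite /cabs normCi.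
have := half h (tc h); have := half k (tc k); lra.
Qed.

Definition C0 f := sa_set (s := C0X R X) f.
Definition near_C0 f (e : R) b := CcX b /\ forall x, cabs (f x - b x) <= e.

(** The cut-off is the indicator of a compact open set containing the points where the modulus of
    [f] is at least [e]; total disconnectedness makes it continuous. *)
Lemma near_C0_ex f e : C0 f -> 0 < e -> exists b, near_C0 f e b.
Proof.
move=> [cf f0] e0; have eC : (0 : C) < ofR e by rewrite -ofR0 ofR_lt.
have [V coV KV] := compact_sub_compact_open (f0 _ eC).
exists (fun x => ind V x * f x); split; first exact: CcXMr (CcX_ind R coV) cf.
move=> x; rewrite indE; case: ifPn => [_|/negP nV].
  by rewrite mul1r subrr cabs0 ltW.
rewrite mul0r subr0 leNgt; apply/negP => fe; apply: nV; apply/mem_set/KV => /=.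
by rewrite normE ofR_le ltW.
Qed.

(** The hypothesis [C0 f] stands inside the existential, so that choice yields a total map. *)
Lemma C0_ex f : exists w : A, C0 f -> forall e b, 0 < e -> near_C0 f e b ->
  realnorm (w - idiag b) <= 2 * e.
Proof.
have [fC|nf] := pselect (C0 f); last by exists 0.
have [e e0|e d b b' e0 d0 [bC fb] [b'C fb']||w wP] :=
  @extend_dense R (X -> C) A (near_C0 f) idiag 2.
- exact: near_C0_ex.
- rewrite -idiagB //; apply: idiag_bound; last 1 first.
  + move=> x; have := cabsD (f x - b' x) (- (f x - b x)); rewrite cabsN.
    rewrite opprB addrC addrA subrK; have := fb x; have := fb' x; lra.
  + have -> : (fun x => b x - b' x) = (fun x => b x + (-1) * b' x).
      by apply/funext => x; rewrite mulN1r.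
    by apply: CcXD => //; exact: CcXZ.
  + exact: addr_gt0.
- by [].
by exists w => _.
Qed.

Definition C0_map f : A := projT1 (cid (C0_ex f)).

Lemma C0_mapP f e b : C0 f -> 0 < e -> near_C0 f e b ->
  realnorm (C0_map f - idiag b) <= 2 * e.
Proof. by rewrite /C0_map; case: cid => w wP /= fC; exact: wP. Qed.

Lemma C0_map_CcX b : CcX b -> C0_map b = idiag b.
Proof.
move=> bC; apply/subr0_eq; apply: (rn_small_scaled (M := 2)) => e e0 _.
apply: C0_mapP => //; first exact: CcX_C0X.
by split=> // x; rewrite subrr cabs0 ltW.
Qed.

Lemma C0_bounded f : C0 f -> exists2 M, 0 < M & forall x, cabs (f x) <= M.
Proof.
move=> fC; have [b [bC fb]] := near_C0_ex fC ltr01.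
have [M M0 bM] := CcX_bounded bC; exists (M + 1); first by rewrite addr_gt0.
by move=> x; have := cabsD (f x - b x) (b x); rewrite subrK; have := fb x; have := bM x; lra.
Qed.

Lemma C0_continuous f : C0 f -> continuous f. Proof. by case. Qed.

(** Stability of C_0(X) under the algebra operations is obtained from that of [CcX] through this
    criterion. *)
Lemma C0_intro f : continuous f ->
  (forall e : R, 0 < e -> exists b, near_C0 f e b) -> C0 f.
Proof.
move=> cf ex; split=> // _ /gt0_ofR[e e0 ->].
have e2 : 0 < e / 2 by rewrite divr_gt0.
have [b [[cb [K cK bK]] fb]] := ex _ e2.
apply: (subclosed_compact _ cK) => [|x /= ef]; first exact: closed_norm_ge.
apply: contrapT => /bK b0; move: ef; rewrite normE ofR_le; have := fb x.
by rewrite b0 subr0; lra.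
Qed.

Lemma near_C0D f g e b b' : near_C0 f e b -> near_C0 g e b' ->
  near_C0 (f + g) (2 * e) (fun x => b x + b' x).
Proof.
move=> [bC fb] [b'C gb']; split; first exact: CcXD.
move=> x; rewrite -[(f + g) x]/(f x + g x) opprD addrACA.
by have := cabsD (f x - b x) (g x - b' x); have := fb x; have := gb' x; lra.
Qed.

Lemma C0D f g : C0 f -> C0 g -> C0 (f + g).
Proof.
move=> fC gC; apply: C0_intro.
  by move=> x; apply: (@cvgD C); [exact: C0_continuous fC x|exact: C0_continuous gC x].
move=> e e0; have e2 : 0 < e / 2 by rewrite divr_gt0.
have [b fb] := near_C0_ex fC e2; have [b' gb] := near_C0_ex gC e2.
by have := near_C0D fb gb; rewrite mulrC divfK //; exists (fun x => b x + b' x).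
Qed.

Lemma near_C0Z c f e b : near_C0 f e b -> 0 < e ->
  near_C0 (c *: f) ((cabs c + 1) * e) (fun x => c * b x).
Proof.
move=> [bC fb] e0; split; first exact: CcXZ.
move=> x; rewrite -[(c *: f) x]/(c * f x) -mulrBr cabsM.
by apply: ler_pM => //; rewrite ?cabs_ge0 // lerDl.
Qed.

Lemma C0Z c f : C0 f -> C0 (c *: f).
Proof.
move=> fC; apply: C0_intro.
  by move=> x; apply: (@cvgM C); [exact: cvg_cst|exact: C0_continuous fC x].
move=> e e0; have c1 : 0 < cabs c + 1 by rewrite ltr_wpDl // cabs_ge0.
have ec : 0 < e / (cabs c + 1) by rewrite divr_gt0.
have [b fb] := near_C0_ex fC ec.
have := near_C0Z c fb ec; rewrite mulrC divfK ?gt_eqF //; by exists (fun x => c * b x).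
Qed.

Lemma near_C0M f g (M N : R) e b b' : (forall x, cabs (f x) <= M) ->
  (forall x, cabs (g x) <= N) -> 0 < e -> e <= 1 ->
  near_C0 f e b -> near_C0 g e b' ->
  near_C0 (fun x => f x * g x) ((M + N + 1) * e) (fun x => b x * b' x).
Proof.
move=> fM gN e0 e1 [bC fb] [b'C gb']; split; first by apply: CcXMr => //; case: b'C.
move=> x; have -> : f x * g x - b x * b' x = f x * (g x - b' x) + (f x - b x) * b' x.
  by ring.
have := cabsD (f x * (g x - b' x)) ((f x - b x) * b' x); rewrite !cabsM.
have b'N : cabs (b' x) <= N + 1.
  by have := cabsD (g x) (- (g x - b' x)); rewrite cabsN opprB addrC subrK;
    have := gN x; have := gb' x; lra.
have h1 : cabs (f x) * cabs (g x - b' x) <= M * e.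
  by apply: ler_pM => //; exact: cabs_ge0.
have h2 : cabs (f x - b x) * cabs (b' x) <= e * (N + 1).
  by apply: ler_pM => //; exact: cabs_ge0.
lra.
Qed.

Lemma C0M f g : C0 f -> C0 g -> C0 (fun x => f x * g x).
Proof.
move=> fC gC; apply: C0_intro.
  by move=> x; apply: (@cvgM C); [exact: C0_continuous fC x|exact: C0_continuous gC x].
move=> e e0; have [M M0 fM] := C0_bounded fC; have [N N0 gN] := C0_bounded gC.
have m0 : 0 < M + N + 1 by lra.
pose d := Num.min 1 (e / (M + N + 1)).
have d0 : 0 < d by rewrite lt_min ltr01 divr_gt0.
have d1 : d <= 1 by rewrite ge_min lexx.
have de : d <= e / (M + N + 1) by rewrite ge_min lexx orbT.
have [b fb] := near_C0_ex fC d0; have [b' gb] := near_C0_ex gC d0.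
have [bb fgb] := near_C0M fM gN d0 d1 fb gb; exists (fun x => b x * b' x); split => // x.
by apply: le_trans (fgb x) _; rewrite mulrC -ler_pdivlMr.
Qed.

Lemma near_C0J f e b : near_C0 f e b -> near_C0 (fun x => (f x)^*) e (fun x => (b x)^*).
Proof.
by move=> [bC fb]; split=> [|x]; [exact: CcXJ|rewrite -rmorphB cabsJ].
Qed.

Lemma C0J f : C0 f -> C0 (fun x => (f x)^*).
Proof.
move=> fC; apply: C0_intro.
  by move=> x; apply: conjC_cvg; exact: C0_continuous fC x.
move=> e e0; have [b fb] := near_C0_ex fC e0.
by exists (fun x => (b x)^*); exact: near_C0J.
Qed.

Lemma C0_mapD f g : C0 f -> C0 g -> C0_map (f + g) = C0_map f + C0_map g.
Proof.
move=> fC gC; apply/subr0_eq; apply: (rn_small_scaled (M := 8)) => e e0 _.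
have [b fb] := near_C0_ex fC e0; have [b' gb] := near_C0_ex gC e0.
have e2 : 0 < 2 * e by rewrite mulr_gt0.
have := C0_mapP (C0D fC gC) e2 (near_C0D fb gb); rewrite idiagD; [|exact: fb.1|exact: gb.1].
have := C0_mapP fC e0 fb; have := C0_mapP gC e0 gb.
set x := C0_map f; set y := C0_map g; set z := C0_map (f + g) => yy xx zz.
have -> : z - (x + y) = (z - (idiag b + idiag b')) - ((x - idiag b) + (y - idiag b')).
  by rewrite addrACA -opprD opprB addrA subrK.
have := rnD (z - (idiag b + idiag b')) (- ((x - idiag b) + (y - idiag b'))); rewrite rnN.
have := rnD (x - idiag b) (y - idiag b'); lra.
Qed.

Lemma C0_mapZ c f : C0 f -> C0_map (c *: f) = c *: C0_map f.
Proof.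
move=> fC; apply/subr0_eq; apply: (rn_small_scaled (M := 4 * cabs c + 2)) => e e0 _.
have [b fb] := near_C0_ex fC e0; have c0 := cabs_ge0 c.
have e2 : 0 < (cabs c + 1) * e by rewrite mulr_gt0 // ltr_wpDl.
have := C0_mapP (C0Z c fC) e2 (near_C0Z c fb e0); rewrite idiagZ; last exact: fb.1.
have := C0_mapP fC e0 fb => xx zz.
have := rn_dist (c *: idiag b) (C0_map (c *: f)) (c *: C0_map f).
rewrite -(scalerBr c (idiag b)) rnZ (rnB (idiag b)).
nra.
Qed.

Lemma C0_mapM f g : C0 f -> C0 g ->
  C0_map (fun x => f x * g x) = cs_mul A (C0_map f) (C0_map g).
Proof.
move=> fC gC; have [M M0 fM] := C0_bounded fC; have [N N0 gN] := C0_bounded gC.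
(* The three summands account for approximating the product of the functions, replacing the left
   factor next to [idiag b'], whose norm is at most [2 * (N + 1)], and replacing the right factor
   next to [C0_map f]. *)
apply/subr0_eq; apply: (rn_small_scaled
  (M := 2 * (M + N + 1) + (2 * (2 * (N + 1)) + realnorm (C0_map f) * 2))) => e e0 e1.
have [b fb] := near_C0_ex fC e0; have [b' gb] := near_C0_ex gC e0.
have m0 : 0 < (M + N + 1) * e by rewrite mulr_gt0 //; lra.
have := C0_mapP (C0M fC gC) m0 (near_C0M fM gN e0 e1 fb gb).
rewrite idiagM; [|exact: fb.1|exact: gb.1].
have := C0_mapP fC e0 fb; have := C0_mapP gC e0 gb.
set x := C0_map f; set y := C0_map g; set z := C0_map _ => yy xx zz.
have b'N : realnorm (idiag b') <= 2 * (N + 1).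
  apply: idiag_bound; [exact: gb.1|lra|] => u.
  have := cabsD (g u) (- (g u - b' u)); rewrite cabsN opprB addrC subrK.
  by have := gN u; have := gb.2 u; lra.
apply: le_trans (rn_dist (cs_mul A (idiag b) (idiag b')) _ _) _.
have -> : cs_mul A (idiag b) (idiag b') - cs_mul A x y =
    cs_mul A (idiag b - x) (idiag b') + cs_mul A x (idiag b' - y).
  by rewrite cs_mulBl cs_mulBr addrA subrK.
have := rnD (cs_mul A (idiag b - x) (idiag b')) (cs_mul A x (idiag b' - y)).
have := cs_rnM (idiag b - x) (idiag b'); have := cs_rnM x (idiag b' - y).
rewrite (rnB (idiag b)) (rnB (idiag b')) => q1 q2 q3.
have h1 : realnorm (x - idiag b) * realnorm (idiag b') <= 2 * e * (2 * (N + 1)).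
  by apply: ler_pM => //; exact: rn_ge0.
have h2 : realnorm x * realnorm (y - idiag b') <= realnorm x * (2 * e).
  by apply: ler_wpM2l => //; exact: rn_ge0.
lra.
Qed.

Lemma C0_mapJ f : C0 f -> C0_map (fun x => (f x)^*) = cs_star (C0_map f).
Proof.
move=> fC; apply/subr0_eq; apply: (rn_small_scaled (M := 4)) => e e0 _.
have [b fb] := near_C0_ex fC e0.
have := C0_mapP (C0J fC) e0 (near_C0J fb); rewrite idiag_star; last exact: fb.1.
have := C0_mapP fC e0 fb; rewrite -cs_rn_star cs_starB => xx zz.
have := rn_dist (cs_star (idiag b)) (C0_map (fun x => (f x)^*)) (cs_star (C0_map f)).
by rewrite (rnB (cs_star (idiag b))); lra.
Qed.

Lemma C0_map_hom : @star_hom R (C0X R X) A C0_map.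
Proof.
split.
- by [].
- exact: C0_mapD.
- by move=> c f; exact: C0_mapZ.
- exact: C0_mapM.
- move=> f g fC _ gE; rewrite /= -C0_mapJ //; congr C0_map.
  by apply/funext => x; rewrite gE.
Qed.

Lemma Delta_representation : is_representation E (fun s : S => iota (Delta s) : A).
Proof.
split.
- by [].
- exact: iota_Delta_mul.
- exact: iota_Delta_star.
- move=> s t u st stu; rewrite (Delta_join E st stu).
  by apply: iotaD; exact: CcGS_Delta.
- rewrite Delta_izero.
  have -> : (fun=> 0) = 0 *: (Delta izero : twist E -> C) by rewrite scale0r.
  by rewrite iotaZ ?scale0r //; exact: CcGS_Delta.
exists C0_map; split; first exact: C0_map_hom.
- move=> U coU; have := C0_map_CcX (CcX_torus (torus_ind R coU)).
  by rewrite /idiag diagonal_torus.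
- by move=> h; rewrite C0_map_CcX /idiag ?diagonal_torus //; exact: CcX_torus.
Qed.

End UniversalRepresentation.

Theorem theorem1p12 (R : realType) (X : booleanSpaceType)
    (G S : invSemigroupType) (E : twisted_boolean R X G S) (A : full_cstar E) :
  is_representation E (fun s : S => full_inj A (Delta E s) : A) /\
  forall (K : hilbert R) (pi : S -> bounded_operators K),
    is_representation E pi ->
    exists! pit : A -> bounded_operators K,
      star_hom pit /\
      forall s : S, pit (full_inj A (Delta E s)) = pi s.
Proof.
split; first exact: Delta_representation.
move=> K pi rep; exists (extension rep); split.
  by split; [exact: extension_hom|exact: extension_Delta].
move=> rho [hom rhoD]; apply: star_hom_determined => //; first exact: extension_hom.
by move=> s; rewrite extension_Delta rhoD.
Qed.
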